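(* Let $\mu_s=(a_s,b_s,c_s,d_s,e_s)$ with $a_s,b_s,c_s,d_s,e_s\in\mathbb R$, $b_s\neq 0$, $s=1,2$. Let $\alpha,\beta>0$. Consider functions $f\in L^2(\mathbb R^2,\mathbb H)$ satisfying, for some positive constants $C,C'$, $$|f(\mathbf x)|\le Ce^{-\alpha|\mathbf x|^2}\quad(\mathbf x\in\mathbb R^2)\qquad\text{and}\qquad\left|\mathbb Q^{\mathbb H}_{\mu_1,\mu_2}[f]\left(\frac{w_1}{b_1},\frac{w_2}{b_2}\right)\right|\le C'e^{-\beta|\mathbf w|^2}\quad(\mathbf w=(w_1,w_2)\in\mathbb R^2).\qquad( * )$$ Then: (1) if $\alpha\beta>\frac14$, every $f$ satisfying $( * )$ is $f\equiv0$ (almost everywhere); (2) if $\alpha\beta=\frac14$, every $f$ satisfying $( * )$ is (almost everywhere) of the form $f(\mathbf x)=e^{i(a_1x_1^2+d_1x_1)}\,K\,e^{-\alpha|\mathbf x|^2}\,e^{j(a_2x_2^2+d_2x_2)}$ for some constant $K\in\mathbb H$; (3) if $\alpha\beta<\frac14$, there are infinitely many functions $f$ satisfying $( * )$.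
   Context: $\mathbb H$ is the real quaternion algebra with imaginary units $i,j,k$; $|\mathbf x|$ is the Euclidean norm on $\mathbb R^2$. $L^p(\mathbb R^2,\mathbb H)$ is the space of $\mathbb H$-valued functions $f$ with $|f|\in L^p(\mathbb R^2)$. Two-sided quaternion quadratic-phase Fourier transform (Q-QPFT) of $f\in L^1(\mathbb R^2,\mathbb H)$ (the Gaussian bound on $f$ makes $f$ integrable): $$\mathbb Q^{\mathbb H}_{\mu_1,\mu_2}[f](\mathbf w)=\int_{\mathbb R^2}\Lambda^i_{\mu_1}(x_1,w_1)f(\mathbf x)\Lambda^j_{\mu_2}(x_2,w_2)\,d\mathbf x,$$ where $\Lambda^i_{\mu_1}(x_1,w_1)=\sqrt{\tfrac{b_1i}{2\pi}}\,e^{-i(a_1x_1^2+b_1x_1w_1+c_1w_1^2+d_1x_1+e_1w_1)}$ and $\Lambda^j_{\mu_2}(x_2,w_2)=\sqrt{\tfrac{b_2j}{2\pi}}\,e^{-j(a_2x_2^2+b_2x_2w_2+c_2w_2^2+d_2x_2+e_2w_2)}$. The square roots are principal square roots in the complex planes $\mathbb R+\mathbb R i$ and $\mathbb R+\mathbb R j$ respectively. *)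

(* Defs.v *)
From HB Require Import structures.
From mathcomp Require Import all_boot all_order all_algebra.
From mathcomp Require Import all_classical all_reals all_analysis.
From mathcomp Require Import complex.
From mathcomp Require Import ring.

Set Implicit Arguments.
Unset Strict Implicit.
Unset Printing Implicit Defensive.

Import Order.TTheory GRing.Theory Num.Theory.

Local Open Scope ring_scope.

(* Quat t x y z stands for t + x i + y j + z k. *)
Record quat (R : Type) := Quat {
  q1 : R; qi : R; qj : R; qk : R }.

Section QuatRing.
Variable R : realType.
Implicit Types p q r : quat R.

Definition quat_tuple q : R * R * R * R := (q1 q, qi q, qj q, qk q).
Definition tuple_quat (t : R * R * R * R) : quat R :=
  let: (a, b, c, d) := t in Quat a b c d.
Lemma quat_tupleK : cancel quat_tuple tuple_quat.
Proof. by case. Qed.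

HB.instance Definition _ := Choice.copy (quat R) (can_type quat_tupleK).

Definition addq p q :=
  Quat (q1 p + q1 q) (qi p + qi q) (qj p + qj q) (qk p + qk q).
Definition oppq p := Quat (- q1 p) (- qi p) (- qj p) (- qk p).
Definition zeroq : quat R := Quat 0 0 0 0.
Definition oneq : quat R := Quat 1 0 0 0.

(* Hamilton's product: i^2 = j^2 = k^2 = ijk = -1. *)
Definition mulq p q :=
  Quat (q1 p * q1 q - qi p * qi q - qj p * qj q - qk p * qk q)
       (q1 p * qi q + qi p * q1 q + qj p * qk q - qk p * qj q)
       (q1 p * qj q - qi p * qk q + qj p * q1 q + qk p * qi q)
       (q1 p * qk q + qi p * qj q - qj p * qi q + qk p * q1 q).

Fact addqA : associative addq.
Proof. by move=> p q r; rewrite /addq /= !addrA. Qed.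
Fact addqC : commutative addq.
Proof. by move=> p q; congr Quat; exact: addrC. Qed.
Fact add0q : left_id zeroq addq.
Proof. by case=> *; rewrite /addq /= !add0r. Qed.
Fact addNq : left_inverse zeroq oppq addq.
Proof. by case=> *; rewrite /addq /= !addNr. Qed.

HB.instance Definition _ :=
  GRing.isZmodule.Build (quat R) addqA addqC add0q addNq.

Fact mulqA : associative mulq.
Proof. by move=> p q r; congr Quat => /=; ring. Qed.
Fact mul1q : left_id oneq mulq.
Proof. by case=> *; congr Quat => /=; ring. Qed.
Fact mulq1 : right_id oneq mulq.
Proof. by case=> *; congr Quat => /=; ring. Qed.
Fact mulqDl : left_distributive mulq addq.
Proof. by move=> p q r; congr Quat => /=; ring. Qed.
Fact mulqDr : right_distributive mulq addq.
Proof. by move=> p q r; congr Quat => /=; ring. Qed.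
Fact oneq_neq0 : oneq != 0 :> quat R.
Proof. by apply/eqP => -[] /eqP; rewrite oner_eq0. Qed.

HB.instance Definition _ := GRing.Zmodule_isNzRing.Build (quat R)
  mulqA mul1q mulq1 mulqDl mulqDr oneq_neq0.

Definition qnorm q : R :=
  Num.sqrt (q1 q ^+ 2 + qi q ^+ 2 + qj q ^+ 2 + qk q ^+ 2).

Definition qreal (t : R) : quat R := Quat t 0 0 0.

(* The identifications of R[i] with the planes R + R i and R + R j of H. *)
Definition in_i (z : R[i]) : quat R := Quat (complex.Re z) (complex.Im z) 0 0.
Definition in_j (z : R[i]) : quat R := Quat (complex.Re z) 0 (complex.Im z) 0.

End QuatRing.

Section QQPFT.
Variable R : realType.

Definition leb2 :
    {measure set (measurableTypeR R * measurableTypeR R) -> \bar R} :=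
  (@lebesgue_measure R \x @lebesgue_measure R)%E.

(* Euclidean norm; the library's norm on R * R is the maximum norm. *)
Definition enorm (x : R * R) : R := Num.sqrt (x.1 ^+ 2 + x.2 ^+ 2).

Definition qmeasurable (f : measurableTypeR R * measurableTypeR R -> quat R)
    : Prop :=
  [/\ measurable_fun setT (fun x => q1 (f x)),
      measurable_fun setT (fun x => qi (f x)),
      measurable_fun setT (fun x => qj (f x)) &
      measurable_fun setT (fun x => qk (f x))].

Definition qL (p : \bar R) (f : R * R -> quat R) : Prop :=
  qmeasurable f /\ (fun x => qnorm (f x)) \in Lfun leb2 p.

Definition qintegral (f : R * R -> quat R) : quat R :=
  Quat (\int[leb2]_x q1 (f x)) (\int[leb2]_x qi (f x))
       (\int[leb2]_x qj (f x)) (\int[leb2]_x qk (f x)).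

Record qpf_param := QpfParam {
  qa : R; qb : R; qc : R; qd : R; qe : R }.

Definition cis (t : R) : R[i] := Complex (cos t) (sin t).

(* sqrtc is the principal square root: for b != 0 the square root of
   b i / (2 pi) below is the one of positive real part. *)
Definition qpf_kernel (mu : qpf_param) (x w : R) : R[i] :=
  sqrtc (Complex 0 (qb mu / (2 * pi))) *
  cis (- (qa mu * x ^+ 2 + qb mu * x * w + qc mu * w ^+ 2
          + qd mu * x + qe mu * w)).

Definition qqpft (mu1 mu2 : qpf_param) (f : R * R -> quat R) (w : R * R)
    : quat R :=
  qintegral (fun x =>
    in_i (qpf_kernel mu1 x.1 w.1) * f x * in_j (qpf_kernel mu2 x.2 w.2)).

Definition hardy_bounds (mu1 mu2 : qpf_param) (alpha beta : R)
    (f : R * R -> quat R) : Prop :=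
  exists C C' : R, [/\ 0 < C, 0 < C',
    forall x, qnorm (f x) <= C * expR (- alpha * enorm x ^+ 2) &
    forall w, qnorm (qqpft mu1 mu2 f (w.1 / qb mu1, w.2 / qb mu2))
              <= C' * expR (- beta * enorm w ^+ 2)].

Definition ae_class (f : R * R -> quat R) : set (R * R -> quat R) :=
  [set g | {ae leb2, forall x, g x = f x}].

End QQPFT.

Arguments leb2 R : clear implicits.

(* Main.v *)
(* Let h be real and integrable, X a coordinate, m_k the integral of X^k h, and
   suppose that h is dominated by a Gaussian of parameter alpha.  With
   q_n = (2n)! / (n! (4 alpha)^n) the numbers b_n = (-1)^n m_(2n) / q_n are
   bounded, and the cosine transform of h at w is phi(w^2 / (4 alpha)), where
   phi(x) = sum_n b_n x^n / n!; critical decay of the transform therefore means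
   |phi(x)| <= K e^(-x) for x >= 0.  Hence the Laplace transform of phi exists for
   Re s > -1, and for |s| > 1 it agrees there with sum_n b_n s^(-n-1).  Multiply
   both by (1 + s)^2 s^m and integrate over the circle |s - 1| = 2, which leaves
   these two domains only at s = -1, where the factor (1 + s)^2 restores
   integrability.  The Laplace side gives 0 and the series side a nonzero multiple
   of b_m + 2 b_(m+1) + b_(m+2).  A bounded solution of this recurrence is
   (-1)^n b_0, so phi(x) = b_0 e^(-x).  The same argument applied to the odd
   moments shows that the sine transform vanishes.

   For the quaternionic transform, absorb the chirps e^(-i(a1 x1^2 + d1 x1)) and
   e^(-j(a2 x2^2 + d2 x2)) into f.  Changing the signs of w_1 and w_2 separates
   the sixteen real cosine/sine transforms of the four components, so each of
   them inherits the bound.  Applying the above in x_1 and then in x_2, each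
   component has the transforms of a multiple of a Gaussian and is that multiple,
   because cosine and sine transforms determine an integrable function.  If
   alpha beta > 1/4, f is critical already for the smaller parameter 1/(4 beta), and
   its decay with alpha forces the constant to be 0.  If alpha beta < 1/4, the
   unchirped multiples n e^(-alpha |x|^2) are witnesses. *)

From mathcomp Require Import all_boot all_order all_algebra.
From mathcomp Require Import all_classical all_reals all_analysis.
From mathcomp Require Import complex measurable_realfun.
From mathcomp Require finmap.
From mathcomp Require Import ring lra zify.
Require Import Defs.

Set Implicit Arguments.
Unset Strict Implicit.
Unset Printing Implicit Defensive.

Import Order.TTheory GRing.Theory Num.Theory.
Import numFieldNormedType.Exports.

Local Open Scope classical_set_scope.
Local Open Scope complex_scope.
Local Open Scope ring_scope.

(** Hardy's theorem is usually derived from a Phragmen-Lindelof argument; here one sequence carries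
    everything. Bounded b_n make sum_n b_n s^(-n-1) analytic for |s| > 1, decay of phi makes its
    Laplace transform analytic for Re s > -1, and together these domains leave out only s = -1. The
    weight (1 + s)^2 says that the singularity there is at most a double pole: a simple pole stands
    for e^(-x), a double one for x e^(-x), whose coefficients are unbounded. Analyticity is carried
    by families indexed by k: the Taylor coefficients of either side, up to sign. Their expansions
    come from dominated convergence, over Lebesgue measure on one side and counting measure on the
    other, and equality spreads from s = 3 by short Taylor steps. The steps are parallel to the
    axes, where the complex exponential series is a real exponential series or a pair of cosine and
    sine series. The odd moments need extra care: the sine transform is w times such a phi, so
    dividing its bound by w yields no control near w = 0. *)

Notation itg mu f := (mu.-integrable setT (EFin \o f)).
Notation cabs := (@ComplexField.Normc.normc _).

(** * Real and complex integrals *)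

Section RealIntegral.
Context d (T : measurableType d) (R : realType).
Variable mu : {measure set T -> \bar R}.
Implicit Types f g : T -> R.

Lemma itg_meas f : itg mu f -> measurable_fun setT f.
Proof. by move/(measurable_int mu)/measurable_EFinP. Qed.

Lemma itg_dom f g : measurable_fun setT f -> (forall x, `|f x| <= g x) ->
  itg mu g -> itg mu f.
Proof.
move=> mf fg ig; apply: (le_integrable measurableT _ _ ig).
  exact/measurable_EFinP.
move=> x _ /=; rewrite lee_fin; apply: le_trans (fg x) _; exact: ler_norm.
Qed.

Lemma itgD f g : itg mu f -> itg mu g -> itg mu (fun x => f x + g x).
Proof.
move=> i1 i2; have := integrableD measurableT i1 i2.
by apply: eq_integrable.
Qed.

Lemma itgZ k f : itg mu f -> itg mu (fun x => k * f x).
Proof.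
move=> i1; have := integrableZl measurableT k i1.
by apply: eq_integrable.
Qed.

Lemma itgN f : itg mu f -> itg mu (fun x => - f x).
Proof.
move=> i1; have := integrableN i1.
by apply: eq_integrable.
Qed.

Lemma itgB f g : itg mu f -> itg mu g -> itg mu (fun x => f x - g x).
Proof. by move=> i1 i2; apply: itgD => //; apply: itgN. Qed.

Lemma itg_abs f : itg mu f -> itg mu (fun x => `|f x|).
Proof. by move=> i1; apply: integrable_norm. Qed.

Lemma itg_ext f g : f =1 g -> itg mu f -> itg mu g.
Proof. by move=> /funext ->. Qed.

Lemma RintN f : itg mu f -> \int[mu]_x (- f x) = - \int[mu]_x f x.
Proof.
move=> i1; under eq_Rintegral do rewrite -mulN1r.
by rewrite RintegralZl // mulN1r.
Qed.

Lemma Rint_le_dom f g : itg mu f -> itg mu g -> (forall x, `|f x| <= g x) ->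
  `|\int[mu]_x f x| <= \int[mu]_x g x.
Proof.
move=> i1 i2 fg; apply: le_trans (le_normr_Rintegral measurableT i1) _.
by apply: le_Rintegral => //; apply: itg_abs.
Qed.

Lemma Rint_dct (f_ : (T -> R)^nat) f g :
  (forall n, measurable_fun setT (f_ n)) -> measurable_fun setT f ->
  {ae mu, forall x, f_ ^~ x @ \oo --> f x} ->
  (forall n x, `|f_ n x| <= g x) -> itg mu g ->
  itg mu f /\ (fun n => \int[mu]_x f_ n x) @ \oo --> \int[mu]_x f x.
Proof.
move=> mf_ mf ff fg ig.
have [] := @dominated_convergence _ T R mu setT measurableT
  (fun n => EFin \o f_ n) (EFin \o f) (EFin \o g).
- by move=> n; apply/measurable_EFinP.
- exact/measurable_EFinP.
- apply: filterS ff => x h _; apply: (@cvg_comp _ _ _ (f_ ^~ x) EFin _ (nbhs (f x))) => //.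
- exact: ig.
- by apply: aeW => x n _ /=; rewrite lee_fin.
move=> if_ _ cv; split=> //.
have /fine_cvg : (\int[mu]_x (f_ n x)%:E)%E @[n --> \oo] --> (fine (\int[mu]_x (f x)%:E)%E)%:E.
  rewrite fineK //; exact: integrable_fin_num.
by [].
Qed.

Lemma meas_lim (f_ : (T -> R)^nat) f :
  (forall n, measurable_fun setT (f_ n)) -> (forall x, f_ ^~ x @ \oo --> f x) ->
  measurable_fun setT f.
Proof. by move=> m c; apply: measurable_fun_cvg m _ => x _; exact: c. Qed.

Lemma Rint_dct' (f_ : (T -> R)^nat) f g :
  (forall n, measurable_fun setT (f_ n)) ->
  (forall x, f_ ^~ x @ \oo --> f x) ->
  (forall n x, `|f_ n x| <= g x) -> itg mu g ->
  itg mu f /\ (fun n => \int[mu]_x f_ n x) @ \oo --> \int[mu]_x f x.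
Proof.
move=> mf_ ff fg ig; apply: (Rint_dct mf_ _ _ fg ig).
  exact: meas_lim mf_ ff.
exact: aeW.
Qed.

End RealIntegral.

(** * Modulus and convergence of complex numbers *)

Section Complex.
Variable R : realType.
Local Notation C := R[i].
Implicit Types (z w : C) (u v : nat -> C).

Local Notation Re := complex.Re.
Local Notation Im := complex.Im.

Lemma cReD z w : Re (z + w) = Re z + Re w. Proof. by case: z w => [? ?] []. Qed.
Lemma cImD z w : Im (z + w) = Im z + Im w. Proof. by case: z w => [? ?] []. Qed.
Lemma cReN z : Re (- z) = - Re z. Proof. by case: z. Qed.
Lemma cImN z : Im (- z) = - Im z. Proof. by case: z. Qed.
Lemma cReM z w : Re (z * w) = Re z * Re w - Im z * Im w.
Proof. by case: z w => [? ?] []. Qed.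
Lemma cImM z w : Im (z * w) = Re z * Im w + Im z * Re w.
Proof. by case: z w => [? ?] []. Qed.

Lemma cE z : z = Complex (Re z) (Im z). Proof. by case: z. Qed.

Lemma cabsE z : cabs z = Num.sqrt (Re z ^+ 2 + Im z ^+ 2).
Proof. by case: z. Qed.
Lemma cabs_ge0 z : 0 <= cabs z. Proof. by rewrite cabsE sqrtr_ge0. Qed.
Lemma cabsM z w : cabs (z * w) = cabs z * cabs w.
Proof. exact: ComplexField.Normc.normcM. Qed.
Lemma cabsV z : cabs (z^-1) = (cabs z)^-1.
Proof. exact: ComplexField.Normc.normcV. Qed.
Lemma cabs0 : cabs (0 : C) = 0. Proof. exact: ComplexField.Normc.normc0. Qed.
Lemma cabs1 : cabs (1 : C) = 1. Proof. exact: ComplexField.Normc.normc1. Qed.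
Lemma cabsN z : cabs (- z) = cabs z.
Proof. by rewrite !cabsE cReN cImN !sqrrN. Qed.
Lemma cabsX z n : cabs (z ^+ n) = cabs z ^+ n.
Proof. by elim: n => [|n IH]; rewrite ?expr0 ?cabs1 // !exprS cabsM IH. Qed.
Lemma cabsD z w : cabs (z + w) <= cabs z + cabs w.
Proof. exact: le_normcD. Qed.
Lemma cabs_eq0 z : (cabs z == 0) = (z == 0).
Proof.
apply/eqP/eqP => [/ComplexField.Normc.eq0_normc //|->]; exact: cabs0.
Qed.
Lemma cabs_real (x : R) : cabs (x%:C) = `|x|.
Proof. by rewrite cabsE /= expr0n /= addr0 sqrtr_sqr. Qed.
Lemma cabs_nat n : cabs (n%:R : C) = n%:R.
Proof. by rewrite -(rmorph_nat (@real_complex R)) cabs_real normr_nat. Qed.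
Lemma cRe_le z : `|Re z| <= cabs z.
Proof.
rewrite cabsE -sqrtr_sqr; apply: ler_wsqrtr; rewrite lerDl; exact: sqr_ge0.
Qed.
Lemma cIm_le z : `|Im z| <= cabs z.
Proof.
rewrite cabsE -sqrtr_sqr; apply: ler_wsqrtr; rewrite lerDr; exact: sqr_ge0.
Qed.
Lemma cabs_sqr z : cabs z ^+ 2 = Re z ^+ 2 + Im z ^+ 2.
Proof. by rewrite cabsE sqr_sqrtr // addr_ge0 ?sqr_ge0. Qed.
Lemma cabs_le z : cabs z <= `|Re z| + `|Im z|.
Proof.
rewrite [in cabs z](cE z) [Complex _ _](_ : _ = (Re z)%:C + (Im z)%:C * 'i%C).
  apply: le_trans (cabsD _ _) _; rewrite cabsM !cabs_real.
  by rewrite [cabs 'i%C]cabsE /= expr0n expr1n add0r sqrtr1 mulr1.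
by simpc.
Qed.
Lemma cRe_sum I (r : seq I) (P : pred I) (F : I -> C) :
  Re (\sum_(j <- r | P j) F j) = \sum_(j <- r | P j) Re (F j).
Proof. by elim/big_rec2: _ => // j x y _ <-; rewrite cReD. Qed.
Lemma cIm_sum I (r : seq I) (P : pred I) (F : I -> C) :
  Im (\sum_(j <- r | P j) F j) = \sum_(j <- r | P j) Im (F j).
Proof. by elim/big_rec2: _ => // j x y _ <-; rewrite cImD. Qed.
Lemma cabs_sum I (r : seq I) (P : pred I) (F : I -> C) :
  cabs (\sum_(j <- r | P j) F j) <= \sum_(j <- r | P j) cabs (F j).
Proof.
elim/big_ind2: _ => [|z a w b h1 h2|//]; first by rewrite cabs0.
exact: le_trans (cabsD _ _) (lerD h1 h2).
Qed.

(** Phrased through the real sequence of distances, so that real squeeze arguments apply directly;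
    [ccvgP] passes to real and imaginary parts. *)
Definition ccvg u (l : C) : Prop :=
  (fun n => cabs (u n - l)) @ \oo --> (0 : R).

Lemma squeeze0 (a b : nat -> R) : (forall n, `|a n| <= b n) ->
  b @ \oo --> (0 : R) -> a @ \oo --> (0 : R).
Proof.
move=> ab b0; apply/norm_cvg0P.
apply: (@squeeze_cvgr _ _ _ _ (fun=> 0 : R) b) => //; last exact: cvg_cst.
by apply: nearW => n; rewrite normr_ge0 ab.
Qed.

Lemma ccvgP u l : ccvg u l <->
  ((fun n => Re (u n)) @ \oo --> Re l /\ (fun n => Im (u n)) @ \oo --> Im l).
Proof.
split=> [h|[h1 h2]].
  split; apply/subr_cvg0; apply: squeeze0 h => n.
    by rewrite -cReN -cReD cRe_le.
  by rewrite -cImN -cImD cIm_le.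
apply: (@squeeze0 _ (fun n => `|Re (u n) - Re l| + `|Im (u n) - Im l|)).
  move=> n; rewrite ger0_norm ?cabs_ge0 //; apply: le_trans (cabs_le _) _.
  by rewrite cReD cImD cReN cImN.
rewrite -[0](addr0 0); apply: cvgD; rewrite -[X in _ --> X](@normr0 _ R);
  by apply: cvg_norm; apply/subr_cvg0.
Qed.

Lemma ccvg_cst l : ccvg (fun=> l) l.
Proof. by rewrite /ccvg; under eq_fun do rewrite subrr cabs0; exact: cvg_cst. Qed.

Lemma ccvg_unique u l1 l2 : ccvg u l1 -> ccvg u l2 -> l1 = l2.
Proof.
move=> /ccvgP[a b] /ccvgP[a' b']; rewrite (cE l1) (cE l2).
by congr Complex; [have := cvg_unique _ a a'|have := cvg_unique _ b b']; apply; exact: norm_hausdorff.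
Qed.

Lemma ccvgZ k u l : ccvg u l -> ccvg (fun n => k * u n) (k * l).
Proof.
move=> h; rewrite /ccvg; under eq_fun do rewrite -mulrBr cabsM.
by rewrite -(mulr0 (cabs k)); apply: cvgM => //; exact: cvg_cst.
Qed.

Lemma ccvgD u v l m : ccvg u l -> ccvg v m -> ccvg (fun n => u n + v n) (l + m).
Proof.
move=> h1 h2; apply: (@squeeze0 _ (fun n => cabs (u n - l) + cabs (v n - m))).
  move=> n; rewrite ger0_norm ?cabs_ge0 // opprD addrACA; exact: cabsD.
by rewrite -[0](addr0 0); apply: cvgD.
Qed.

Lemma ccvg_near u v l : (forall n, u n = v n) -> ccvg u l -> ccvg v l.
Proof. by move=> /funext ->. Qed.

End Complex.

Ltac mfun_step := first
  [ assumption | exact: measurable_cst | exact: measurable_id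
  | apply: measurable_funD | apply: measurable_funB | apply: measurable_funM
  | apply: measurable_funX
  | apply: (measurableT_comp (@measurable_expR _))
  | apply: (measurableT_comp (continuous_measurable_fun (@continuous_cos _)))
  | apply: (measurableT_comp (continuous_measurable_fun (@continuous_sin _)))
  | apply: (measurableT_comp (@oppr_measurable _ _)) ].
Ltac mfun := repeat mfun_step.

(** * Integrals of complex functions over an arbitrary measure *)

Section ComplexIntegral.
Context d (T : measurableType d) (R : realType).
Variable mu : {measure set T -> \bar R}.
Local Notation C := R[i].
Local Notation Re := complex.Re.
Local Notation Im := complex.Im.
Implicit Types F G : T -> C.

Definition cmeas F := measurable_fun setT (fun x => Re (F x)) /\
  measurable_fun setT (fun x => Im (F x)).
Definition citg F := itg mu (fun x => Re (F x)) /\ itg mu (fun x => Im (F x)).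
Definition cint F : C := Complex (\int[mu]_x Re (F x)) (\int[mu]_x Im (F x)).

Lemma cmeasM F G : cmeas F -> cmeas G -> cmeas (fun x => F x * G x).
Proof.
move=> [a b] [a' b']; split.
  under eq_fun do rewrite cReM; by mfun.
under eq_fun do rewrite cImM; by mfun.
Qed.

Lemma cmeasD F G : cmeas F -> cmeas G -> cmeas (fun x => F x + G x).
Proof.
move=> [a b] [a' b']; split.
  under eq_fun do rewrite cReD; by mfun.
under eq_fun do rewrite cImD; by mfun.
Qed.

Lemma cmeas_cst (c : C) : cmeas (fun=> c).
Proof. by split; exact: measurable_cst. Qed.

Lemma cmeas_real (f : T -> R) : measurable_fun setT f ->
  cmeas (fun x => (f x)%:C).
Proof. by move=> mf; split => //=; exact: measurable_cst. Qed.

Lemma cmeas_sum n (F : nat -> T -> C) : (forall j, cmeas (F j)) ->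
  cmeas (fun x => \sum_(j < n) F j x).
Proof.
move=> mF; elim: n => [|n IH].
  by under eq_fun do rewrite big_ord0; exact: cmeas_cst.
by under eq_fun do rewrite big_ord_recr /=; exact: cmeasD.
Qed.

Lemma cmeas_citg F : citg F -> cmeas F.
Proof. by case=> a b; split; apply: itg_meas; [exact: a|exact: b]. Qed.

Lemma citg_dom F g : cmeas F -> (forall x, cabs (F x) <= g x) -> itg mu g ->
  citg F.
Proof.
move=> [a b] Fg ig; split; apply: itg_dom ig => // x; apply: le_trans (Fg x).
  exact: cRe_le.
exact: cIm_le.
Qed.

Lemma citgZ (k : C) F : citg F -> citg (fun x => k * F x).
Proof.
move=> [a b]; split.
  by under eq_fun do rewrite cReM; apply: itgB; apply: itgZ.
by under eq_fun do rewrite cImM; apply: itgD; apply: itgZ.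
Qed.

Lemma citgD F G : citg F -> citg G -> citg (fun x => F x + G x).
Proof.
move=> [a b] [a' b']; split.
  by under eq_fun do rewrite cReD; apply: itgD.
by under eq_fun do rewrite cImD; apply: itgD.
Qed.

Lemma cintZ (k : C) F : citg F -> cint (fun x => k * F x) = k * cint F.
Proof.
move=> [a b]; rewrite /cint [RHS]cE cReM cImM /=; congr Complex.
  under eq_Rintegral do rewrite cReM.
  rewrite RintegralB //; [|exact: itgZ|exact: itgZ].
  by rewrite !RintegralZl.
under eq_Rintegral do rewrite cImM.
rewrite RintegralD //; [|exact: itgZ|exact: itgZ].
by rewrite !RintegralZl.
Qed.

Lemma cintD F G : citg F -> citg G ->
  cint (fun x => F x + G x) = cint F + cint G.
Proof.
move=> [a b] [a' b']; rewrite /cint [RHS]cE cReD cImD /=; congr Complex.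
  by under eq_Rintegral do rewrite cReD; rewrite RintegralD.
by under eq_Rintegral do rewrite cImD; rewrite RintegralD.
Qed.

Lemma cint0 : cint (fun=> 0) = 0.
Proof. by rewrite /cint /= Rintegral_cst // mul0r. Qed.

Lemma citg0 : citg (fun=> 0).
Proof. by split => /=; exact: integrable0. Qed.

Lemma citg_sum n (F : nat -> T -> C) : (forall j, citg (F j)) ->
  citg (fun x => \sum_(j < n) F j x).
Proof.
move=> mF; elim: n => [|n IH].
  by under eq_fun do rewrite big_ord0; exact: citg0.
by under eq_fun do rewrite big_ord_recr /=; exact: citgD.
Qed.

Lemma cint_sum n (F : nat -> T -> C) : (forall j, citg (F j)) ->
  cint (fun x => \sum_(j < n) F j x) = \sum_(j < n) cint (F j).
Proof.
move=> mF; elim: n => [|n IH].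
  by under eq_fun do rewrite big_ord0; rewrite cint0 big_ord0.
under eq_fun do rewrite big_ord_recr /=.
by rewrite cintD // ?IH ?big_ord_recr //; exact: citg_sum.
Qed.

Lemma cint_dct (F_ : nat -> T -> C) F g : (forall n, cmeas (F_ n)) -> cmeas F ->
  {ae mu, forall x, ccvg (F_ ^~ x) (F x)} ->
  (forall n x, cabs (F_ n x) <= g x) -> itg mu g ->
  ccvg (fun n => cint (F_ n)) (cint F).
Proof.
move=> mF_ mF FF Fg ig; apply/ccvgP; split.
  apply: (Rint_dct _ _ _ _ ig).2 => [n|||n x].
  - exact: (mF_ n).1.
  - exact: mF.1.
  - by apply: filterS FF => x /ccvgP[].
  - exact: le_trans (cRe_le _) (Fg n x).
apply: (Rint_dct _ _ _ _ ig).2 => [n|||n x].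
- exact: (mF_ n).2.
- exact: mF.2.
- by apply: filterS FF => x /ccvgP[].
- exact: le_trans (cIm_le _) (Fg n x).
Qed.

(* The kernels [E s k] below are, up to sign, the k-th Taylor coefficients at
   [s] of a function holomorphic in [s]; integrating in the parameter [x : T]
   preserves the Taylor expansion. *)
Definition taylor_at (g : nat -> C -> C) (s h : C) := forall k,
  ccvg (fun J => \sum_(j < J) 'C(k + j, k)%:R * (- h) ^+ j * g (k + j)%N s)
       (g k (s + h)).

(** Finite Taylor sums commute with the integral; the bound [g k], uniform in the length [J] of the
    sum, lets dominated convergence pass to the limit. The measure is left general because Laplace
    integrals and power series both go through this lemma. *)
Lemma taylor_cint (E : C -> nat -> T -> C) (s h : C) (g : nat -> T -> R) :
  (forall k, citg (E s k)) -> (forall k, cmeas (E (s + h) k)) ->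
  (forall k, itg mu (g k)) ->
  (forall x, taylor_at (fun k s' => E s' k x) s h) ->
  (forall k J x, cabs (\sum_(j < J) 'C(k + j, k)%:R * (- h) ^+ j *
     E s (k + j)%N x) <= g k x) ->
  taylor_at (fun k s' => cint (E s' k)) s h.
Proof.
move=> iE mE ig tE bE k.
have c : forall J, cint (fun x => \sum_(j < J) 'C(k + j, k)%:R * (- h) ^+ j *
     E s (k + j)%N x) = \sum_(j < J) 'C(k + j, k)%:R * (- h) ^+ j *
       cint (E s (k + j)%N).
  move=> J.
  rewrite (@cint_sum J (fun j x => 'C(k + j, k)%:R * (- h) ^+ j *
     E s (k + j)%N x)); last by move=> j; exact: citgZ.
  by apply: eq_bigr => j _; rewrite cintZ.
apply: (ccvg_near c); apply: (cint_dct _ _ _ (bE k) (ig k)) => //.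
  move=> J; apply: (@cmeas_sum J (fun j x => 'C(k + j, k)%:R * (- h) ^+ j *
     E s (k + j)%N x)) => j; apply: cmeasM; first exact: cmeas_cst.
  exact: cmeas_citg.
by apply: aeW => x; exact: tE.
Qed.

End ComplexIntegral.

(** * Exponential, cosine and sine series *)

Section Series.
Variable R : realType.
Local Notation C := R[i].
Local Notation Re := complex.Re.
Local Notation Im := complex.Im.
Implicit Types (z s h : C) (x y : R).

Definition cexp z : C := Complex (expR (Re z) * cos (Im z)) (expR (Re z) * sin (Im z)).

Lemma cexpD z s : cexp (z + s) = cexp z * cexp s.
Proof.
rewrite /cexp [RHS]cE cReM cImM cReD cImD expRD cosD sinD /=; congr Complex; ring.
Qed.

Lemma cabs_cexp z : cabs (cexp z) = expR (Re z).
Proof.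
rewrite cabsE /= !exprMn -mulrDr cos2Dsin2 mulr1 sqrtr_sqr ger0_norm //.
Qed.

Lemma cexp0 : cexp 0 = 1.
Proof. by rewrite /cexp /= expR0 cos0 sin0 !mul1r. Qed.

Lemma series_ordE (u : nat -> R) n : series u n = \sum_(j < n) u j.
Proof. by rewrite /series /= big_mkord. Qed.

Lemma exp_series_le x n : 0 <= x -> \sum_(j < n) exp_coeff x j <= expR x.
Proof.
move=> x0; rewrite -series_ordE.
apply: nondecreasing_cvgn_le; last exact: is_cvg_series_exp_coeff.
by apply: nondecreasing_series => i _ _; exact: exp_coeff_ge0.
Qed.

Lemma exp_coeff_le x n : 0 <= x -> exp_coeff x n <= expR x.
Proof.
move=> x0; apply: le_trans (exp_series_le n.+1 x0).
by rewrite big_ord_recr /= lerDr sumr_ge0 // => i _; exact: exp_coeff_ge0.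
Qed.

Lemma cvg_exp_series x : (fun n => \sum_(j < n) exp_coeff x j) @ \oo --> expR x.
Proof.
under eq_fun do rewrite -series_ordE.
exact: is_cvg_series_exp_coeff.
Qed.

Lemma cvg_cos_series x : (fun n => \sum_(j < n) cos_coeff x j) @ \oo --> cos x.
Proof.
under eq_fun do rewrite -series_ordE.
by rewrite unlock; exact: is_cvg_series_cos_coeff.
Qed.

Lemma cvg_sin_series x : (fun n => \sum_(j < n) sin_coeff x j) @ \oo --> sin x.
Proof.
under eq_fun do rewrite -series_ordE.
by rewrite unlock; exact: is_cvg_series_sin_coeff.
Qed.

Lemma imag_powE y j : (Complex 0 y) ^+ j / j`!%:R =
  Complex (cos_coeff y j) (sin_coeff y j).
Proof.
have -> : (Complex 0 y) ^+ j = Complex ((~~ odd j)%:R * (-1) ^+ j./2 * y ^+ j)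
   ((odd j)%:R * (-1) ^+ j.-1./2 * y ^+ j).
  elim: j => [|j IH]; first by rewrite /= !expr0 !mulr1.
  rewrite exprS IH [LHS]cE cReM cImM /= !mul0r sub0r add0r.
  case: (boolP (odd j)) => oj /=; congr Complex;
    rewrite ?mul0r ?mulr0 ?mul1r ?oppr0 ?add0r ?addr0 ?exprS //.
    have -> : uphalf j = j.-1./2.+1.
      by case: j oj {IH} => // j /= oj; rewrite uphalf_half (negbTE oj).
    rewrite exprS; ring.
  ring.
rewrite -(rmorph_nat (@real_complex R)) -fmorphV /=.
by simpc; rewrite /cos_coeff /sin_coeff.
Qed.

Lemma cexp_bound z J : cabs (\sum_(j < J) z ^+ j / j`!%:R) <= expR (cabs z).
Proof.
apply: le_trans (cabs_sum _ _ _) _.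
apply: le_trans (exp_series_le J (cabs_ge0 z)).
by apply: ler_sum => j _; rewrite cabsM cabsX cabsV cabs_nat.
Qed.

(** On the imaginary axis the partial sums split into the cosine and sine series, on the real axis
    they are those of the real exponential. Continuation along axis-parallel segments meets no other
    arguments. *)
Lemma cexp_series z : Re z = 0 \/ Im z = 0 ->
  ccvg (fun J => \sum_(j < J) z ^+ j / j`!%:R) (cexp z).
Proof.
case: z => a b /= [->|->]; apply/ccvgP => /=.
  rewrite expR0 !mul1r; split.
    under eq_fun do rewrite cRe_sum.
    apply: cvg_trans (@cvg_cos_series b); apply: near_eq_cvg.
    by apply: nearW => n; apply: eq_bigr => j _; rewrite imag_powE.
  under eq_fun do rewrite cIm_sum.
  apply: cvg_trans (@cvg_sin_series b); apply: near_eq_cvg.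
  by apply: nearW => n; apply: eq_bigr => j _; rewrite imag_powE.
have e : forall j : nat, (Complex a 0) ^+ j / j`!%:R = (exp_coeff a j)%:C.
  move=> j; rewrite -(rmorph_nat (@real_complex R)) -fmorphV /=.
  by rewrite -[Complex a 0]/(a%:C) -rmorphXn -rmorphM.
rewrite cos0 sin0 mulr1 mulr0; split.
  under eq_fun do rewrite cRe_sum.
  apply: cvg_trans (@cvg_exp_series a); apply: near_eq_cvg.
  by apply: nearW => n; apply: eq_bigr => j _; rewrite e.
under eq_fun do rewrite cIm_sum.
under eq_fun do under eq_bigr do rewrite e.
by under eq_fun do rewrite big1 //; exact: cvg_cst.
Qed.

End Series.

(** * The negative binomial series *)

Section NegBin.
Variable R : realType.
Local Notation C := R[i].

(** Pascal's rule in summed form: multiplication by [1 - z] lowers the order by one at the cost of a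
    boundary term. The bounds and limits below follow from it by induction on [m]. *)
Lemma negbin_rec (F : comPzRingType) m J (z : F) :
  (1 - z) * \sum_(j < J) 'C(m.+1 + j, m.+1)%:R * z ^+ j =
  \sum_(j < J) 'C(m + j, m)%:R * z ^+ j - 'C(m + J, m.+1)%:R * z ^+ J.
Proof.
elim: J => [|J IH].
  by rewrite !big_ord0 addn0 bin_small // mulr0 mul0r subr0.
rewrite !big_ord_recr /= mulrDr IH addnS addSn binS natrD exprS.
ring.
Qed.

Lemma geo_rec (F : comPzRingType) J (z : F) :
  (1 - z) * \sum_(j < J) 'C(0 + j, 0)%:R * z ^+ j = 1 - z ^+ J.
Proof.
elim: J => [|J IH]; first by rewrite !big_ord0 expr0 subrr mulr0.
rewrite !big_ord_recr /= mulrDr IH bin0 exprS; ring.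
Qed.

Lemma negbin_le m J (r : R) : 0 <= r < 1 ->
  \sum_(j < J) 'C(m + j, m)%:R * r ^+ j <= ((1 - r)^-1) ^+ m.+1.
Proof.
move=> /andP[r0 r1]; have r1' : 0 < 1 - r by rewrite subr_gt0.
elim: m => [|m IH].
  rewrite expr1 -(ler_pM2l r1') geo_rec divff ?gt_eqF // gerBl; exact: exprn_ge0.
rewrite -(ler_pM2l r1') negbin_rec exprS mulrA divff ?gt_eqF // mul1r.
by apply: le_trans IH; rewrite gerBl mulr_ge0 // exprn_ge0.
Qed.

Lemma negbin_term m J (r : R) : 0 <= r < 1 ->
  'C(m + J, m)%:R * r ^+ J <= ((1 - r)^-1) ^+ m.+1.
Proof.
move=> r01; apply: le_trans (negbin_le m J.+1 r01).
rewrite big_ord_recr /= lerDr sumr_ge0 // => i _.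
by case/andP: r01 => r0 _; rewrite mulr_ge0 // exprn_ge0.
Qed.

(** At an intermediate radius [r'] between [r] and 1 the terms stay bounded, so at [r] they are at
    most a constant times [(r / r')^J]. *)
Lemma negbin_term_cvg m (r : R) : 0 <= r < 1 ->
  (fun J => 'C(m + J, m)%:R * r ^+ J) @ \oo --> (0 : R).
Proof.
move=> /andP[r0 r1]; pose r' := (r + 1) / 2.
have r'0 : 0 < r' by rewrite /r'; lra.
have r'1 : r' < 1 by rewrite /r'; lra.
have rr' : r < r' by rewrite /r'; lra.
apply: (@squeeze0 _ _ (fun J => ((1 - r')^-1) ^+ m.+1 * (r / r') ^+ J)).
  move=> J; rewrite ger0_norm ?mulr_ge0 ?exprn_ge0 //.
  have -> : r ^+ J = r' ^+ J * (r / r') ^+ J.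
    by rewrite -exprMn mulrC divfK // gt_eqF.
  rewrite mulrA ler_wpM2r //.
    by rewrite exprn_ge0 // divr_ge0 // ltW.
  by apply: negbin_term; rewrite ltW.
rewrite -(mulr0 (((1 - r')^-1) ^+ m.+1)); apply: cvgM; first exact: cvg_cst.
apply: cvg_expr; rewrite ger0_norm; last by rewrite divr_ge0 // ltW.
by rewrite ltr_pdivrMr // mul1r.
Qed.

Lemma negbin_cvg m (z : C) : cabs z < 1 ->
  ccvg (fun J => \sum_(j < J) 'C(m + j, m)%:R * z ^+ j) (((1 - z)^-1) ^+ m.+1).
Proof.
move=> z1.
have z01 : 0 <= cabs z < 1 by rewrite cabs_ge0.
have nz : 1 - z != 0.
  apply/eqP => /eqP; rewrite subr_eq0 => /eqP e; move: z1.
  by rewrite -e cabs1 ltxx.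
have key (u : nat -> C) l : ccvg (fun J => (1 - z) * u J) ((1 - z) * l) ->
    ccvg u l.
  move=> /(ccvgZ (1 - z)^-1); rewrite mulKf //.
  by apply: ccvg_near => n; rewrite mulKf.
have zJ0 m' : ccvg (fun J => - ('C(m' + J, m')%:R * z ^+ J)) 0.
  rewrite /ccvg; apply: cvg_trans (negbin_term_cvg m' z01); apply: near_eq_cvg.
  by apply: nearW => J; rewrite subr0 cabsN cabsM cabs_nat cabsX.
elim: m => [|m IH]; apply: key.
  rewrite expr1 divff // -[X in ccvg _ X](addr0 1).
  apply: (@ccvg_near _ (fun J => 1 - 'C(0 + J, 0)%:R * z ^+ J)).
    by move=> J; rewrite geo_rec bin0 mul1r.
  by apply: ccvgD; [exact: ccvg_cst|exact: zJ0].
rewrite exprS mulVKf // -[X in ccvg _ X](addr0 _).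
apply: ccvg_near; first by move=> J; rewrite negbin_rec.
apply: ccvgD => //.
apply: (@squeeze0 _ _ (fun J => 'C(m.+1 + J, m.+1)%:R * cabs z ^+ J)).
  move=> J; rewrite subr0 ger0_norm ?cabs_ge0 // cabsN cabsM cabs_nat cabsX.
  rewrite ler_wpM2r ?exprn_ge0 ?cabs_ge0 // ler_nat.
  by rewrite leq_bin2l // addSn.
exact: negbin_term_cvg.
Qed.

End NegBin.

(** * Series as integrals over the counting measure *)

Section Counting.
Variable R : realType.

Lemma itg_count_ge0 (a : nat -> R) B : (forall n, 0 <= a n) ->
  (forall N, \sum_(n < N) a n <= B) -> itg (@counting nat R) a.
Proof.
move=> a0 aB; apply/integrableP; split; first by [].
under eq_integral do rewrite /= ger0_norm //.
rewrite ge0_integral_count; last by move=> k; rewrite lee_fin.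
apply: (@le_lt_trans _ _ B%:E); last exact: ltry.
apply: lime_le; first by apply: is_cvg_nneseries => n _ _; rewrite lee_fin.
apply: nearW => N; rewrite sumEFin lee_fin /= big_mkord; exact: aB.
Qed.

(** The truncations of [a] have the partial sums as integrals and are dominated by [|a|]. *)
Lemma Rint_count (a : nat -> R) : itg (@counting nat R) a ->
  (fun N => \sum_(n < N) a n) @ \oo --> \int[@counting nat R]_n a n.
Proof.
move=> ia; pose aN (N n : nat) := if (n < N)%N then a n else 0.
have step N : itg (@counting nat R) (aN N) /\
    \int[@counting nat R]_n aN N n = \sum_(n < N) a n.
  elim: N => [|N [iN eN]].
    rewrite big_ord0 /aN; split; first exact: integrable0.
    by rewrite Rintegral_cst // mul0r.
  have e n : aN N.+1 n = aN N n + a N * \1_[set N] n.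
    rewrite /aN indicE ltnS leq_eqVlt.
    have [->|/eqP nN] := eqVneq n N.
      by rewrite ltnn mem_set // add0r mulr1.
    by rewrite memNset // mulr0 addr0.
  have i1 : itg (@counting nat R) (\1_[set N]).
    apply: (itg_count_ge0 (B := 1)) => [n|M]; first by rewrite indicE.
    rewrite (@le_trans _ _ (\sum_(n < M) (n == N :> nat)%:R)) //.
      apply: ler_sum => n _; rewrite indicE.
      by case: eqP => [->|nN]; [rewrite mem_set|rewrite memNset].
    rewrite -natr_sum -[leRHS]/(1%:R) ler_nat.
    have [NM|NM] := ltnP N M.
      rewrite (bigD1 (Ordinal NM)) //= eqxx big1 // => i niN.
      by move: niN; rewrite -val_eqE /= => /negbTE ->.
    rewrite big1 // => i _; rewrite (_ : (_ == _) = false) //.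
    by apply/negbTE; rewrite neq_ltn (leq_trans (ltn_ord i)).
  rewrite (_ : aN N.+1 = fun n => aN N n + a N * \1_[set N] n); last exact/funext.
  split; first by apply: itgD => //; exact: itgZ.
  rewrite RintegralD //; last exact: itgZ.
  rewrite eN RintegralZl // big_ord_recr /=; congr (_ + _).
  rewrite -[RHS]mulr1; congr (_ * _); rewrite /Rintegral integral_indic //.
  rewrite setIT /= /counting asboolT //.
  by rewrite fset_set1 finmap.cardfs1.
have -> : (fun N => \sum_(n < N) a n) =
    (fun N => \int[@counting nat R]_n aN N n).
  by apply/funext => N; rewrite (step N).2.
apply: (@Rint_dct' _ _ _ _ aN a (fun n => `|a n|) _ _ _ _).2 => //.
- move=> n; apply: cvg_near_cst; exists n.+1 => // N /= nN.
  by rewrite /aN nN.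
- move=> N n; rewrite /aN; case: ifP => // _; by rewrite normr0.
- exact: itg_abs.
Qed.

End Counting.

(** * Laplace transform and power series *)

Section LaplaceKernel.
Variable R : realType.
Local Notation C := R[i].
Local Notation Re := complex.Re.
Local Notation Im := complex.Im.
Local Notation mu := (@lebesgue_measure R).
Implicit Types (s h : C) (x : R).
Local Notation epdf := (@exponential_pdf R).

(** If F is the Laplace transform of [f], the integral of this kernel is (-1)^k F^(k)(s) / k!. *)
Definition LK (f : R -> R) s k x : C :=
  (f x * exp_coeff x k)%:C * cexp (- (s * x%:C)).

Lemma epdfE a x : 0 <= x -> epdf a x = a * expR (- a * x).
Proof. by move=> x0; rewrite exponential_pdfE. Qed.

Lemma epdf_lt0 a x : x < 0 -> epdf a x = 0.
Proof. exact: lt0_exponential_pdf. Qed.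

Lemma epdf_itg a : 0 < a -> itg mu (epdf a).
Proof. exact: integrable_exponential_pdf. Qed.

Variables (f : R -> R) (K : R).
Hypothesis K0 : 0 <= K.
Hypothesis mf : measurable_fun setT f.
Hypothesis fK : forall x, `|f x| <= K * epdf 1 x.

Let f0 x : x < 0 -> f x = 0.
Proof.
move=> x0; have := fK x; rewrite epdf_lt0 // mulr0 normr_le0.
by move/eqP.
Qed.

Definition LB (a : R) k := K * (2 / a) ^+ k.+1.

(** The available decay rate is [1 + sg]. Half of it absorbs the power, since [x^k / k!] is at most
    [(2 / (1 + sg))^k e^((1 + sg) x / 2)]; the other half remains as an exponential density, whose
    normalization accounts for the exponent [k.+1] in [LB]. *)
Lemma LK_real_bound (sg : R) k x : -1 < sg ->
  `|f x| * `|exp_coeff x k| * expR (- (sg * x)) <=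
  LB (1 + sg) k * epdf ((1 + sg) / 2) x.
Proof.
move=> s1; have a0 : 0 < 1 + sg by lra.
have [x0|x0] := ltP x 0.
  by rewrite f0 // normr0 !mul0r epdf_lt0 ?mulr0.
have h1 : `|exp_coeff x k| <= (2 / (1 + sg)) ^+ k * expR ((1 + sg) / 2 * x).
  rewrite ger0_norm ?exp_coeff_ge0 //.
  have -> : exp_coeff x k = (2 / (1 + sg)) ^+ k * exp_coeff ((1 + sg) / 2 * x) k.
    rewrite /exp_coeff /= mulrA -exprMn mulrA; congr (_ ^+ _ / _).
    field; lra.
  rewrite ler_pM2l ?exprn_gt0 ?divr_gt0 //; apply: exp_coeff_le.
  by rewrite mulr_ge0 // divr_ge0 // ltW.
have h2 := fK x; rewrite epdfE // in h2.
apply: le_trans (_ : (K * (1 * expR (- 1 * x))) *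
  ((2 / (1 + sg)) ^+ k * expR ((1 + sg) / 2 * x)) * expR (- (sg * x)) <= _).
  by rewrite ler_wpM2r ?expR_ge0 // ler_pM.
rewrite epdfE // /LB exprSr le_eqVlt; apply/orP; left; apply/eqP.
have -> : expR (- ((1 + sg) / 2) * x) =
   expR (- 1 * x) * expR ((1 + sg) / 2 * x) * expR (- (sg * x)).
  by rewrite -!expRD; congr expR; field.
field; lra.
Qed.

Lemma cmeas_LK s k : cmeas (LK f s k).
Proof.
apply: cmeasM.
  apply: cmeas_real; rewrite /exp_coeff /=; mfun.
have e1 x : Re (- (s * x%:C)) = - (Re s * x).
  by rewrite cReN cReM /= mulr0 subr0.
have e2 x : Im (- (s * x%:C)) = - (Im s * x).
  by rewrite cImN cImM /= mulr0 add0r.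
split => /=.
  rewrite (_ : (fun x => _) = fun x => expR (- (Re s * x)) * cos (- (Im s * x))).
    by mfun.
  by apply/funext => x; rewrite e1 e2.
rewrite (_ : (fun x => _) = fun x => expR (- (Re s * x)) * sin (- (Im s * x))).
  by mfun.
by apply/funext => x; rewrite e1 e2.
Qed.

Lemma cabs_LK s k x : cabs (LK f s k x) =
  `|f x| * `|exp_coeff x k| * expR (- (Re s * x)).
Proof.
rewrite /LK cabsM cabs_real normrM cabs_cexp cReN cReM /= mulr0 subr0 //.
Qed.

Lemma citg_LK s k : -1 < Re s -> citg mu (LK f s k).
Proof.
move=> s1; apply: (@citg_dom _ _ R mu _ (fun x =>
  LB (1 + Re s) k * epdf ((1 + Re s) / 2) x)).
- exact: cmeas_LK.
- by move=> x; rewrite cabs_LK; exact: LK_real_bound.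
- by apply: itgZ; apply: epdf_itg; rewrite divr_gt0 //; lra.
Qed.

Lemma exp_coeff_bin x k j : 'C(k + j, k)%:R * exp_coeff x (k + j)%N =
  exp_coeff x k * exp_coeff x j.
Proof.
rewrite /exp_coeff /= exprD.
have e : 'C(k + j, k)%:R * k`!%:R * j`!%:R = (k + j)`!%:R :> R.
  by rewrite -!natrM -mulnA -(@bin_fact (k + j) k) ?leq_addr // addKn.
rewrite -e; have k0 : k`!%:R != 0 :> R by rewrite pnatr_eq0 -lt0n fact_gt0.
have j0 : j`!%:R != 0 :> R by rewrite pnatr_eq0 -lt0n fact_gt0.
have c0 : 'C(k + j, k)%:R != 0 :> R.
  by rewrite pnatr_eq0 -lt0n bin_gt0 leq_addr.
by field; rewrite ?k0 ?j0 ?c0.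
Qed.

Lemma LK_partial s h k J x :
  \sum_(j < J) 'C(k + j, k)%:R * (- h) ^+ j * LK f s (k + j) x =
  LK f s k x * \sum_(j < J) (- (h * x%:C)) ^+ j / j`!%:R.
Proof.
rewrite mulr_sumr; apply: eq_bigr => j _.
have LE m : LK f s m x = (f x)%:C * (exp_coeff x m)%:C * cexp (- (s * x%:C)).
  by rewrite /LK rmorphM.
rewrite !LE; have -> : 'C(k + j, k)%:R * (- h) ^+ j *
   ((f x)%:C * (exp_coeff x (k + j)%N)%:C * cexp (- (s * x%:C))) =
   (f x)%:C * ('C(k + j, k)%:R * exp_coeff x (k + j)%N)%:C * (- h) ^+ j *
     cexp (- (s * x%:C)).
  by rewrite (rmorphM (@real_complex R) 'C(k + j, k)%:R) /= (rmorph_nat (@real_complex R)); ring.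
rewrite exp_coeff_bin rmorphM /=.
have -> : (exp_coeff x j)%:C = (x%:C) ^+ j / j`!%:R :> C.
  by rewrite /exp_coeff /= fmorph_div rmorphXn rmorph_nat.
rewrite -[- (h * _)]mulNr exprMn; ring.
Qed.

(** The kernel at [s + h] is the kernel at [s] times e^(-hx). The partial sums of that factor are at
    most e^(|h|x), so everything is dominated by the real kernel at [Re s - |h|], which still
    exceeds -1. *)
Lemma L_taylor s h : Re h = 0 \/ Im h = 0 -> cabs h < 1 + Re s ->
  taylor_at (fun k s' => cint mu (LK f s' k)) s h.
Proof.
move=> hax hs; have h0 := cabs_ge0 h.
have Rs1 : -1 < Re s by lra.
have sh : -1 < Re s - cabs h by lra.
apply: (@taylor_cint _ _ R mu _ s h (fun k x => LB (1 + (Re s - cabs h)) k *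
   epdf ((1 + (Re s - cabs h)) / 2) x)).
- by move=> k; exact: citg_LK.
- by move=> k; exact: cmeas_LK.
- by move=> k; apply: itgZ; apply: epdf_itg; rewrite divr_gt0 //; lra.
- move=> x k; apply: ccvg_near; first by move=> J; rewrite LK_partial.
  have -> : LK f (s + h) k x = LK f s k x * cexp (- (h * x%:C)).
    by rewrite /LK -mulrA -cexpD mulrDl opprD.
  apply: ccvgZ; apply: cexp_series.
  rewrite cReN cImN cReM cImM /= !mulr0 subr0 add0r.
  by case: hax => ->; [left|right]; rewrite mul0r oppr0.
- move=> k J x; rewrite LK_partial cabsM cabs_LK.
  have [x0|x0] := ltP x 0.
    by rewrite f0 // normr0 !mul0r epdf_lt0 ?mulr0.
  apply: le_trans (LK_real_bound k x sh).
  rewrite -[leLHS]mulrA ler_wpM2l ?mulr_ge0 //.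
  rewrite mulrBl opprB addrC expRD ler_wpM2l ?expR_ge0 //.
  apply: le_trans (cexp_bound _ _) _.
  by rewrite cabsN cabsM cabs_real ger0_norm.
Qed.

End LaplaceKernel.

(** * Taylor expansion of the series in 1/s *)

Section PowerKernel.
Variable R : realType.
Local Notation C := R[i].
Implicit Types (s h : C).
Local Notation cnt := (@counting nat R).

Variables (b : nat -> R) (M : R).
Hypothesis bM : forall n, `|b n| <= M.

(** The n-th term of (-1)^k G^(k)(s) / k! for G(s) = sum_n b_n s^(-n-1), matching the normalization
    of [LK]. *)
Definition RK s k n : C :=
  (b n)%:C * 'C(n + k, k)%:R * s^-1 ^+ (n + k).+1.

Let M0 : 0 <= M. Proof. exact: le_trans (normr_ge0 _) (bM 0%N). Qed.

Definition RB (rho : R) k n : R := M * 'C(n + k, k)%:R * rho^-1 ^+ (n + k).+1.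

Lemma itg_RB rho k : 1 < rho -> itg cnt (RB rho k).
Proof.
move=> r1; have r0 : 0 < rho by lra.
apply: (@itg_count_ge0 _ _ (M * rho^-1 ^+ k.+1 * ((1 - rho^-1)^-1) ^+ k.+1)).
  by move=> n; rewrite /RB !mulr_ge0 // exprn_ge0 // invr_ge0 ltW.
move=> N; under eq_bigr => n _.
  have -> : RB rho k n = M * rho^-1 ^+ k.+1 * ('C(k + n, k)%:R * rho^-1 ^+ n).
    rewrite /RB -addnS exprD [(n + k)%N]addnC; ring.
  over.
rewrite -mulr_sumr ler_wpM2l //.
  by rewrite mulr_ge0 // exprn_ge0 // invr_ge0 ltW.
by apply: negbin_le; rewrite invr_ge0 ltW //= invf_lt1.
Qed.

Lemma cabs_RK s k n : cabs (RK s k n) <= RB (cabs s) k n.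
Proof.
rewrite /RK /RB !cabsM cabs_real cabs_nat cabsX cabsV.
by rewrite !ler_wpM2r ?exprn_ge0 ?invr_ge0 ?cabs_ge0.
Qed.

Lemma cmeas_RK s k : cmeas (RK s k). Proof. by []. Qed.

Lemma citg_RK s k : 1 < cabs s -> citg cnt (RK s k).
Proof.
move=> s1; apply: (citg_dom (cmeas_RK s k) (cabs_RK s k)); exact: itg_RB.
Qed.

(** Both sides are the multinomial coefficient (n+k+j)! / (n! k! j!). *)
Lemma bin_mul3 n k j :
  ('C(k + j, k) * 'C(n + (k + j), k + j) = 'C(n + k, k) * 'C(n + k + j, n + k))%N.
Proof.
have f0 := fact_gt0.
apply/eqP; rewrite -(eqn_pmul2r (f0 n)) -(eqn_pmul2r (f0 k)) -(eqn_pmul2r (f0 j)).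
have e1 := @bin_fact (k + j) k (leq_addr _ _).
have e2 := @bin_fact (n + (k + j)) (k + j) (leq_addl _ _).
have e3 := @bin_fact (n + k) k (leq_addl _ _).
have e4 := @bin_fact (n + k + j) (n + k) (leq_addr _ _).
rewrite addKn in e1; rewrite addnK in e2; rewrite addnK in e3.
rewrite addKn in e4.
apply/eqP; transitivity ((n + (k + j))`!).
  rewrite -e2 -e1; ring.
rewrite addnA -e4 -e3; ring.
Qed.

Lemma RK_partial s h k J n : s != 0 ->
  \sum_(j < J) 'C(k + j, k)%:R * (- h) ^+ j * RK s (k + j) n =
  RK s k n * \sum_(j < J) 'C(n + k + j, n + k)%:R * (- (h / s)) ^+ j.
Proof.
move=> s0; rewrite mulr_sumr; apply: eq_bigr => j _.
have e : 'C(k + j, k)%:R * 'C(n + (k + j), k + j)%:R =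
   'C(n + k, k)%:R * 'C(n + k + j, n + k)%:R :> C.
  by rewrite -!natrM bin_mul3.
rewrite /RK -mulNr exprMn addnA -[(n + k + j).+1]addSn exprD.
transitivity ((b n)%:C * ('C(k + j, k)%:R * 'C(n + (k + j), k + j)%:R) *
   (- h) ^+ j * (s^-1 ^+ (n + k).+1 * s^-1 ^+ j)).
  by rewrite addnA; ring.
rewrite e; ring.
Qed.

(** Each term at [s + h] is the term at [s] times a power of 1 / (1 + h/s), a negative binomial
    series in -h/s. Its absolute partial sums turn the bound at radius |s| into the bound at radius
    |s| - |h|, which still exceeds 1. *)
Lemma R_taylor s h : cabs h < cabs s - 1 ->
  taylor_at (fun k s' => cint cnt (RK s' k)) s h.
Proof.
move=> hs; have h0 := cabs_ge0 h; have s1 : 1 < cabs s by lra.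
have cs0 : 0 < cabs s by lra.
have s0 : s != 0 by rewrite -cabs_eq0 gt_eqF.
have hs1 : cabs (- (h / s)) < 1.
  by rewrite cabsN cabsM cabsV ltr_pdivrMr // mul1r; lra.
apply: (taylor_cint (g := fun k n => RB (cabs s - cabs h) k n)).
- by move=> k; exact: citg_RK.
- by move=> k; exact: cmeas_RK.
- by move=> k; apply: itg_RB; lra.
- move=> n k; apply: ccvg_near; first by move=> J; rewrite RK_partial.
  have -> : RK (s + h) k n = RK s k n * ((1 - - (h / s))^-1) ^+ (n + k).+1.
    rewrite /RK -[RHS]mulrA -exprMn; congr (_ * _ ^+ _).
    by rewrite opprK -invfM mulrDr mulr1 [s * _]mulrC divfK.
  by apply: ccvgZ; exact: negbin_cvg.
- move=> k J n; rewrite RK_partial // cabsM.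
  apply: le_trans (_ : RB (cabs s) k n *
     ((1 - cabs h / cabs s)^-1) ^+ (n + k).+1 <= _).
    apply: ler_pM; rewrite ?cabs_ge0 ?cabs_RK //.
    apply: le_trans (cabs_sum _ _ _) _.
    under eq_bigr do rewrite cabsM cabs_nat cabsX.
    rewrite cabsN cabsM cabsV; apply: negbin_le.
    rewrite divr_ge0 ?cabs_ge0 //= ltr_pdivrMr // mul1r; lra.
  rewrite /RB -mulrA -exprMn -invfM mulrBr mulr1 [cabs s * _]mulrC divfK //.
  by rewrite gt_eqF.
Qed.

End PowerKernel.

(** * Differentiation rules for pointwise expressions *)

Section PointwiseDerive.
Variable R : realType.
Implicit Types (f g : R -> R) (x c : R).

Lemma deq f x (df df' : R) : is_derive x 1 f df -> df = df' ->
  is_derive x 1 f df'.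
Proof. by move=> h <-. Qed.

Lemma dcst c x : is_derive x 1 (fun=> c : R) (0 : R).
Proof. exact: is_derive_cst. Qed.

Lemma did x : is_derive x 1 (fun y => y : R) (1 : R).
Proof. exact: is_derive_id. Qed.

Lemma dadd f g x (df dg : R) : is_derive x 1 f df -> is_derive x 1 g dg ->
  is_derive x 1 (fun y => f y + g y) (df + dg).
Proof. by move=> h1 h2; exact: is_deriveD. Qed.

Lemma dsub f g x (df dg : R) : is_derive x 1 f df -> is_derive x 1 g dg ->
  is_derive x 1 (fun y => f y - g y) (df - dg).
Proof. by move=> h1 h2; exact: is_deriveB. Qed.

Lemma dopp f x (df : R) : is_derive x 1 f df -> is_derive x 1 (fun y => - f y) (- df).
Proof. by move=> h1; exact: is_deriveN. Qed.

Lemma dmul f g x (df dg : R) : is_derive x 1 f df -> is_derive x 1 g dg ->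
  is_derive x 1 (fun y => f y * g y) (df * g x + f x * dg).
Proof.
move=> h1 h2; have := is_deriveM h1 h2; rewrite addrC => h.
by apply: (is_derive_eq h); rewrite /GRing.scale /= [g x * df]mulrC.
Qed.

Lemma dcmul c f x (df : R) : is_derive x 1 f df ->
  is_derive x 1 (fun y => c * f y) (c * df).
Proof.
move=> h; eapply deq; first exact (dmul (dcst c x) h).
by rewrite mul0r add0r.
Qed.

Lemma dX n x : is_derive x 1 (fun y => y ^+ n.+1 : R) (n.+1%:R * x ^+ n).
Proof.
elim: n => [|n IH].
  by rewrite mul1r expr0; under eq_fun do rewrite expr1; exact: did.
rewrite (_ : (fun y => _) = fun y => y * y ^+ n.+1); last first.
  by apply/funext => y; rewrite exprS.
eapply deq; first exact (dmul (did x) IH).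
rewrite mul1r exprS -[n.+2%:R]natr1; ring.
Qed.

Lemma dcomp f g x (df dg : R) : is_derive x 1 f df -> is_derive (f x) 1 g dg ->
  is_derive x 1 (fun y => g (f y)) (dg * df).
Proof.
move=> h1 h2; eapply deq; first exact (is_derive1_comp h2 h1).
by rewrite /GRing.scale /=.
Qed.

Lemma dexp f x (df : R) : is_derive x 1 f df ->
  is_derive x 1 (fun y => expR (f y)) (expR (f x) * df).
Proof. by move=> h; exact: (dcomp h (is_derive_expR _)). Qed.

Lemma dcos f x (df : R) : is_derive x 1 f df ->
  is_derive x 1 (fun y => cos (f y)) (- sin (f x) * df).
Proof. by move=> h; exact: (dcomp h (is_derive_cos _)). Qed.

Lemma dsin f x (df : R) : is_derive x 1 f df ->
  is_derive x 1 (fun y => sin (f y)) (cos (f x) * df).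
Proof. by move=> h; exact: (dcomp h (is_derive_sin _)). Qed.

Lemma derive_continuous f (df : R -> R) :
  (forall x, is_derive x 1 f (df x)) -> continuous f.
Proof.
move=> h x; apply/differentiable_continuous/derivable1_diffP.
by apply: ex_derive; exact: h.
Qed.

End PointwiseDerive.

(** * Gamma integrals at the base point s = 3 *)

Section GammaIntegral.
Variable R : realType.
Local Notation mu := (@lebesgue_measure R).

(** A primitive of [x^m / m! e^(-3x)], the recursion being integration by parts. It vanishes at
    infinity, so minus its value at 0 is the integral over the half-line. *)
Fixpoint gamma_prim m (x : R) : R :=
  if m is m'.+1 then (gamma_prim m' x - exp_coeff x m * expR (- (3 * x))) / 3
  else - expR (- (3 * x)) / 3.

Lemma exp_coeffS (x : R) n : exp_coeff x n.+1 = exp_coeff x n * x / n.+1%:R.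
Proof.
rewrite /exp_coeff /= factS natrM invfM exprS; ring.
Qed.

Lemma is_derive_exp_coeff n (x : R) :
  is_derive x 1 (fun y => exp_coeff y n.+1) (exp_coeff x n).
Proof.
rewrite (_ : (fun y => _) = fun y => (n.+1`!%:R)^-1 * y ^+ n.+1); last first.
  by apply/funext => y; rewrite /exp_coeff /= mulrC.
eapply deq; first exact (dcmul _ (dX n x)).
have n0 : n.+1%:R != 0 :> R by rewrite pnatr_eq0.
by rewrite factS natrM invfM /exp_coeff /= mulrACA mulVf // mul1r mulrC.
Qed.

Lemma is_derive_exp3 (x : R) :
  is_derive x 1 (fun y => expR (- (3 * y))) (- 3 * expR (- (3 * x))).
Proof.
eapply deq; first by eapply dexp; eapply dopp; eapply dcmul; exact: did.
by rewrite mulr1 mulrC.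
Qed.

Lemma is_derive_gamma m (x : R) :
  is_derive x 1 (gamma_prim m) (exp_coeff x m * expR (- (3 * x))).
Proof.
elim: m => [|m IH] /=.
  under eq_fun do rewrite mulrC.
  eapply deq; first by eapply dcmul; eapply dopp; exact: is_derive_exp3.
  rewrite /exp_coeff /= expr0 fact0; by field.
rewrite (_ : (fun y => _) = fun y => 3^-1 * (gamma_prim m y - exp_coeff y m.+1 * expR (- (3 * y)))); last first.
  by apply/funext => y; rewrite mulrC.
eapply deq.
  eapply dcmul; eapply dsub; first exact: IH; eapply dmul; [exact: is_derive_exp_coeff|exact: is_derive_exp3].
cbv beta; move: (exp_coeff x m) (exp_coeff x m.+1) (expR _) => u v e /=; by field.
Qed.

Lemma gamma_prim0 m : gamma_prim m 0 = - (3^-1) ^+ m.+1.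
Proof.
elim: m => [|m IH] /=; first by rewrite mulr0 oppr0 expR0 expr1 mulN1r.
by rewrite IH exp_coeffS mulr0 !mul0r subr0 [in RHS]exprSr mulNr.
Qed.

Lemma cvg_gamma_prim m : gamma_prim m x @[x --> +oo] --> (0 : R).
Proof.
have e0 : expR (- (2 * x)) @[x --> +oo] --> (0 : R).
  apply: (@cvg_comp _ _ _ (fun x : R => 2 * x) (fun z => expR (- z)) _ (pinfty_nbhs R)); last exact: cvgr_expR.
  exact: gt0_cvgMry.
have c m' : exp_coeff x m' * expR (- (3 * x)) @[x --> +oo] --> (0 : R).
  apply: (@squeeze_cvgr _ _ _ _ (fun=> 0) (fun x => expR (- (2 * x)))) => //.
    near=> x; have x0 : 0 <= x by near: x; exact: nbhs_pinfty_ge.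
    rewrite mulr_ge0 ?exp_coeff_ge0 ?expR_ge0 //=.
    have -> : - (2 * x) = x + - (3 * x) by ring.
    by rewrite expRD ler_wpM2r ?expR_ge0 // exp_coeff_le.
  exact: cvg_cst.
have cz (g : R -> R) : g x @[x --> +oo] --> (0 : R) ->
    g x / 3 @[x --> +oo] --> (0 : R).
  by move=> g0; rewrite -(mul0r (3^-1 : R)); apply: cvgM => //; exact: cvg_cst.
elim: m => [|m IH] /=.
  apply: cz; rewrite -oppr0; apply: cvgN; have := c 0%N; rewrite /exp_coeff /=.
  by under eq_fun do rewrite expr0 fact0 divr1 mul1r.
by apply: cz; rewrite -(subr0 0); apply: cvgB.
Unshelve. all: by end_near. Qed.

Lemma cont_expc m : continuous (fun x : R => exp_coeff x m * expR (- (3 * x))).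
Proof.
case: m => [|m].
  apply: (@derive_continuous _ _ (fun x => - 3 * expR (- (3 * x)))) => x.
  rewrite (_ : (fun y => _) = fun y => expR (- (3 * y))).
    exact: is_derive_exp3.
  by apply/funext => y; rewrite /exp_coeff /= expr0 fact0 divr1 mul1r.
apply: (@derive_continuous _ _ (fun x => exp_coeff x m * expR (- (3 * x)) +
  exp_coeff x m.+1 * (- 3 * expR (- (3 * x))))) => x.
apply: dmul; [exact: is_derive_exp_coeff|exact: is_derive_exp3].
Qed.

Lemma gamma_int m : \int[mu]_(x in `[0, +oo[) (exp_coeff x m * expR (- (3 * x)))
  = (3^-1) ^+ m.+1.
Proof.
rewrite (@Rintegral_ge0_continuous_FTC2y _ _ (gamma_prim m) 0 0).
- by rewrite gamma_prim0 sub0r opprK.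
- by move=> x x0; rewrite mulr_ge0 ?exp_coeff_ge0 ?expR_ge0.
- by apply: continuous_subspaceT => x; exact: cont_expc.
- exact: cvg_gamma_prim.
- by move=> x _; apply: ex_derive; exact: is_derive_gamma.
- apply: cvg_at_right_filter; apply/differentiable_continuous/derivable1_diffP.
  by apply: ex_derive; exact: is_derive_gamma.
- by move=> x _; rewrite derive1E; apply: derive_val; exact: is_derive_gamma.
Qed.

End GammaIntegral.

(** * Agreement of the Laplace transform with the series *)

Section Continuation.
Variable R : realType.
Local Notation C := R[i].
Local Notation Re := complex.Re.
Local Notation Im := complex.Im.
Local Notation mu := (@lebesgue_measure R).
Local Notation cnt := (@counting nat R).
Local Notation epdf := (@exponential_pdf R).
Implicit Types (s h : C).

Definition restr0 (phi : R -> R) := phi \_ `[0, +oo[.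

Lemma restr0E phi x : 0 <= x -> restr0 phi x = phi x.
Proof. by move=> x0; rewrite /restr0 patchE mem_set //= in_itv /= x0. Qed.

Lemma restr0_lt0 phi x : x < 0 -> restr0 phi x = 0.
Proof.
by move=> x0; rewrite /restr0 patchE memNset //= in_itv /= andbT leNgt x0.
Qed.

Variables (b : nat -> R) (M K : R) (phi : R -> R).
Hypothesis bM : forall n, `|b n| <= M.
Hypothesis phiE : forall x,
  (fun N => \sum_(n < N) b n * exp_coeff x n) @ \oo --> phi x.
Hypothesis phiK : forall x, 0 <= x -> `|phi x| <= K * expR (- x).

Let M0 : 0 <= M. Proof. exact: le_trans (normr_ge0 _) (bM 0%N). Qed.

Lemma decay_K0 : 0 <= K.
Proof.
have := phiK (lexx 0); rewrite oppr0 expR0 mulr1; exact: le_trans.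
Qed.

Lemma meas_exp_coeff n : measurable_fun setT (fun x : R => exp_coeff x n).
Proof. rewrite /exp_coeff /=; mfun. Qed.

Lemma meas_phi : measurable_fun setT phi.
Proof.
apply: (meas_lim (f_ := fun N x => \sum_(n < N) b n * exp_coeff x n)) phiE.
move=> N; elim: N => [|N IH].
  by under eq_fun do rewrite big_ord0; exact: measurable_cst.
under eq_fun do rewrite big_ord_recr /=.
by apply: measurable_funD => //; apply: measurable_funM => //; exact: meas_exp_coeff.
Qed.

Lemma meas_restr0 psi : measurable_fun setT psi -> measurable_fun setT (restr0 psi).
Proof.
by move=> m; apply/(measurable_restrictT _ _).1 => //; exact: measurable_funTS.
Qed.

Lemma restr0_le x : `|restr0 phi x| <= K * epdf 1 x.
Proof.
have [x0|x0] := ltP x 0; first by rewrite restr0_lt0 // epdf_lt0 // normr0 mulr0.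
by rewrite restr0E // epdfE // mul1r mulN1r phiK.
Qed.

(** All Taylor coefficients at [s] are compared and not only the values ([k = 0]): a Taylor step can
    then reproduce the whole statement at a nearby point. *)
Definition agree s := forall k,
  cint mu (LK (restr0 phi) s k) = cint cnt (RK b s k).

Lemma ccvg_count (F : nat -> C) : citg cnt F ->
  ccvg (fun N => \sum_(n < N) F n) (cint cnt F).
Proof.
move=> [i1 i2]; apply/ccvgP; split.
  by under eq_fun do rewrite cRe_sum; exact: Rint_count.
by under eq_fun do rewrite cIm_sum; exact: Rint_count.
Qed.

Lemma ccvg_real (u : nat -> R) (l : R) : u @ \oo --> l ->
  ccvg (fun n => (u n)%:C) l%:C.
Proof. by move=> h; apply/ccvgP; split => //=; exact: cvg_cst. Qed.

Lemma cexp_real (r : R) : cexp (r%:C) = (expR r)%:C.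
Proof. by rewrite /cexp /= cos0 sin0 mulr0 mulr1. Qed.

(** On the half-line the partial sums of [phi] are at most [M e^x], which e^(-3x) outweighs; the
    series may therefore be integrated term by term, and each term is a gamma integral. *)
Lemma agree_base : agree (3 : C).
Proof.
move=> k; have c3 : 1 < cabs (3 : C) by rewrite cabs_nat ltr1n.
have e3 (x : R) : cexp (- (3 * x%:C)) = (expR (- (3 * x)))%:C.
  rewrite (_ : - (3 * x%:C) = (- (3 * x))%:C); first exact: cexp_real.
  by rewrite rmorphN rmorphM /= (rmorph_nat (@real_complex R)).
have h1 := ccvg_count (citg_RK bM k c3).
apply: (ccvg_unique _ h1).
(* A stand-in for [f] in [LK_real_bound]: writing M e^x e^(-3x) as M e^(-x) e^(-x) makes the
   domination the case [sg = 1] for the function e^(-x). *)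
pose one1 := restr0 (fun x => expR (- x)).
have one1K x : `|one1 x| <= 1 * epdf 1 x.
  have [x0|x0] := ltP x 0.
    by rewrite /one1 restr0_lt0 // epdf_lt0 // normr0 mulr0.
  by rewrite /one1 restr0E // epdfE // !mul1r mulN1r ger0_norm ?expR_ge0.
have one1m : measurable_fun setT one1 by apply: meas_restr0; mfun.
pose Fn n (x : R) : C := (restr0 (fun y => exp_coeff y n * b n) x * exp_coeff x k)%:C
  * cexp (- (3 * x%:C)).
have Fn_dom N x : cabs (\sum_(n < N) Fn n x) <=
    M * (LB 1 (1 + 1) k * epdf ((1 + 1) / 2) x).
  have [x0|x0] := ltP x 0.
    rewrite big1 ?cabs0 ?epdf_lt0 ?mulr0 // => i _.
    by rewrite /Fn restr0_lt0 // mul0r mul0r.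
  apply: le_trans (_ : M * (`|one1 x| * `|exp_coeff x k| * expR (- (1 * x))) <= _).
    apply: le_trans (cabs_sum _ _ _) _.
    apply: le_trans (_ : \sum_(n < N) exp_coeff x n * (M * (exp_coeff x k *
       expR (- (3 * x)))) <= _).
      apply: ler_sum => n _; rewrite /Fn e3 cabsM !cabs_real (ger0_norm (expR_ge0 _)) restr0E //.
      rewrite 2!normrM !(ger0_norm (exp_coeff_ge0 _ x0)).
      move: (exp_coeff_ge0 n x0) (exp_coeff_ge0 k x0) (expR_ge0 (- (3 * x))) (bM n).
      move: (exp_coeff x n) (exp_coeff x k) (expR _) (b n) => u v e' bn u0 v0 e0 bn0.
      have -> : u * `|bn| * v * e' = u * (`|bn| * (v * e')) by ring.
      by apply: ler_wpM2l => //; apply: ler_wpM2r => //; exact: mulr_ge0.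
    rewrite -mulr_suml mulrCA ler_wpM2l // mul1r.
    rewrite /one1 restr0E // !ger0_norm ?expR_ge0 ?exp_coeff_ge0 //.
    move: (exp_coeff_ge0 k x0); move: (exp_coeff x k) => v v0.
    have -> : expR (- x) * v * expR (- x) = v * expR (- x + - x).
      by rewrite expRD; ring.
    rewrite mulrCA ler_wpM2l //. have -> : - x + - x = x + - (3 * x) by ring.
    by rewrite expRD ler_wpM2r ?expR_ge0 // exp_series_le.
  rewrite ler_wpM2l //.
  by apply: (@LK_real_bound _ one1 1 one1K 1); lra.
have mFn n : cmeas (Fn n).
  apply: cmeasM.
    apply: cmeas_real; apply: measurable_funM; last exact: meas_exp_coeff.
    by apply: meas_restr0; apply: measurable_funM => //; exact: meas_exp_coeff.
  under eq_fun do rewrite e3.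
  by apply: cmeas_real; mfun.
have idom : itg mu (fun x => M * (LB 1 (1 + 1) k * epdf ((1 + 1) / 2) x)).
  by apply: itgZ; apply: itgZ; apply: epdf_itg; lra.
have FnE n (x : R) : Fn n x = (b n)%:C * 'C(n + k, k)%:R *
    (restr0 (fun y => exp_coeff y (n + k) * expR (- (3 * y))) x)%:C.
  rewrite /Fn; have [x0|x0] := ltP x 0.
    by rewrite !restr0_lt0 // !mul0r mulr0.
  rewrite !restr0E //.
  rewrite e3.
  have := exp_coeff_bin x k n; rewrite [(k + n)%N]addnC.
  rewrite -(rmorph_nat (@real_complex R)) -!rmorphM /=.
  move: (exp_coeff x n) (exp_coeff x k) (exp_coeff x (n + k)) (expR _) => u v w e E.
  congr (_%:C); transitivity (b n * (v * u) * e); first by ring.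
  by rewrite -E; ring.
(* A single term is the difference of two consecutive partial sums, so twice the dominating function
   bounds it. *)
have iFn n : citg mu (Fn n).
  apply: (@citg_dom _ _ R mu _ _ (mFn n) _ (itgD idom idom)) => x.
  rewrite (_ : Fn n x = \sum_(i < n.+1) Fn i x - \sum_(i < n) Fn i x).
    by apply: le_trans (cabsD _ _) _; rewrite cabsN lerD.
  by rewrite big_ord_recr /= addrC addrK.
have cFn n : cint mu (Fn n) = RK b 3 k n.
  have -> : Fn n = fun x => (b n * 'C(n + k, k)%:R * restr0 (fun y => exp_coeff y (n + k) * expR (- (3 * y))) x)%:C.
    apply/funext => x; rewrite FnE.
    by rewrite -(rmorph_nat (@real_complex R)) -!rmorphM.
  have iw : itg mu (restr0 (fun y => exp_coeff y (n + k) * expR (- (3 * y)))).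
    apply: (@itg_dom _ _ R mu _ (fun x => LB 1 (1 + 2) (n + k) * epdf ((1 + 2) / 2) x)).
    - by apply: meas_restr0; apply: measurable_funM; [exact: meas_exp_coeff|mfun].
    - move=> x; apply: le_trans (@LK_real_bound _ one1 1 one1K 2 (n + k) x _); last by lra.
      have [x0|x0] := ltP x 0.
        by rewrite restr0_lt0 // normr0 !mulr_ge0 // expR_ge0.
      rewrite /one1 !restr0E // normrM [X in _ <= X * _]mulrC -mulrA.
      rewrite ler_wpM2l // !(ger0_norm (expR_ge0 _)) -expRD.
      by rewrite le_eqVlt; apply/orP; left; apply/eqP; congr expR; ring.
    - by apply: itgZ; apply: epdf_itg; lra.
  rewrite /cint /= Rintegral_cst // mul0r RintegralZl //.
  rewrite -Rintegral_mkcond gamma_int.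
  rewrite /RK -(rmorph_nat (@real_complex R)) -(rmorph_nat (@real_complex R) 3).
  by rewrite -fmorphV -rmorphXn -!rmorphM.
apply: (@ccvg_near _ (fun N => cint mu (fun x => \sum_(n < N) Fn n x))); last first.
  apply: (@cint_dct _ _ R mu (fun N x => \sum_(n < N) Fn n x) _
     (fun x => M * (LB 1 (1 + 1) k * epdf ((1 + 1) / 2) x))).
  - by move=> N; exact: cmeas_sum.
  - by apply: cmeas_LK; apply: meas_restr0; exact: meas_phi.
  - apply: aeW => x; have [x0|x0] := ltP x 0.
      apply: (@ccvg_near _ (fun=> 0)).
        by move=> N; rewrite big1 // => i _; rewrite /Fn restr0_lt0 // mul0r mul0r.
      by rewrite /LK restr0_lt0 // mul0r mul0r; exact: ccvg_cst.
    apply: (@ccvg_near _ (fun N => ((exp_coeff x k)%:C * cexp (- (3 * x%:C))) *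
        (\sum_(n < N) b n * exp_coeff x n)%:C)).
      move=> N; rewrite rmorph_sum mulr_sumr; apply: eq_bigr => i _.
      by rewrite /Fn restr0E // !rmorphM /=; ring.
    have -> : LK (restr0 phi) 3 k x =
        ((exp_coeff x k)%:C * cexp (- (3 * x%:C))) * (phi x)%:C.
      by rewrite /LK restr0E // rmorphM /=; ring.
    by apply: ccvgZ; apply: ccvg_real; exact: phiE.
  - exact: Fn_dom.
  - exact: idom.
by move=> N /=; rewrite (@cint_sum _ _ R mu) //; apply: eq_bigr => n _; rewrite cFn.
Qed.

(** By uniqueness of limits: both sides at [s + h] are limits of the same Taylor sums, built from
    the common coefficients at [s]. The two bounds keep |h| below the distances from [s] to the line
    Re s = -1 and to the unit circle. *)
Lemma agree_step s h : Re h = 0 \/ Im h = 0 -> cabs h < 1 + Re s ->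
  cabs h < cabs s - 1 -> agree s -> agree (s + h).
Proof.
move=> ax h1 h2 ag k.
have mf := meas_restr0 meas_phi.
have t1 := L_taylor mf restr0_le ax h1 k.
have t2 := R_taylor bM h2 k.
apply: (ccvg_unique t1); apply: ccvg_near t2 => J.
by apply: eq_bigr => j _; rewrite ag.
Qed.

(** A segment whose points all stay at distance at least [rho] from both boundaries is covered by
    [N] equal steps shorter than [rho]. *)
Lemma agree_segment s h rho : 0 < rho -> Re h = 0 \/ Im h = 0 ->
  (forall t : R, 0 <= t <= 1 -> rho <= 1 + Re (s + t%:C * h) /\
     rho <= cabs (s + t%:C * h) - 1) ->
  agree s -> agree (s + h).
Proof.
move=> r0 ax hr ag.
pose N := (Num.truncn (cabs h / rho)).+1.
have hN : cabs h / rho < N%:R by exact: truncnS_gt.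
have N0 : 0 < N%:R :> R by rewrite ltr0n.
have st : cabs ((N%:R^-1)%:C * h) < rho.
  rewrite cabsM cabs_real ger0_norm ?invr_ge0 ?ler0n //.
  by rewrite mulrC ltr_pdivrMr // mulrC -ltr_pdivrMr.
suff ind j : (j <= N)%N -> agree (s + (j%:R / N%:R)%:C * h).
  by have := ind N (leqnn _); rewrite divff ?mul1r // gt_eqF.
elim: j => [|j IH] jN; first by rewrite mul0r mul0r addr0.
have -> : s + (j.+1%:R / N%:R)%:C * h =
    (s + (j%:R / N%:R)%:C * h) + (N%:R^-1)%:C * h.
  rewrite -addrA -mulrDl -rmorphD; congr (_ + _%:C * _).
  by rewrite -natr1 mulrDl mul1r.
have [|r1 r2] := hr (j%:R / N%:R).
  rewrite divr_ge0 ?ler0n //= ler_pdivrMr // mul1r ler_nat; exact: ltnW.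
apply: agree_step.
- rewrite cReM cImM /= !mul0r subr0 addr0.
  by case: ax => ->; [left|right]; rewrite mulr0.
- exact: lt_le_trans st r1.
- exact: lt_le_trans st r2.
- by apply: IH; exact: ltnW.
Qed.

(* Continue from [s = 3] along three axis-parallel segments that pass the unit
   disc on the side given by the sign of [y]. *)
Lemma agree_domain (x y : R) : -1 < x -> 1 < cabs (Complex x y) ->
  agree (Complex x y).
Proof.
move=> x1 c1.
pose e : R := if 0 <= y then 1 else -1.
(* [Y] has the sign chosen for [y] and modulus at least 2, so the horizontal segment at this height
   keeps distance 1 from the unit disc. *)
pose Y := y + 2 * e.
have Y2 : 2 <= `|Y|.
  rewrite /Y /e; case: (leP 0 y) => y0.
    by rewrite ger0_norm; lra.
  by rewrite ltr0_norm; lra.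
have mono (u v v' : R) : `|v| <= `|v'| -> cabs (Complex u v) <= cabs (Complex u v').
  move=> vv; rewrite !cabsE /=; apply: ler_wsqrtr; rewrite lerD2l.
  by rewrite -(real_normK (num_real v)) -(real_normK (num_real v')) lerXn2r.
have E3 : (3 : C) = Complex 3 0 by rewrite -(rmorph_nat (@real_complex R)).
have a1 : agree (3 + Complex 0 Y).
  apply: (@agree_segment _ _ 2) => //; [by left| |exact: agree_base].
  move=> t t01; have -> : 3 + t%:C * Complex 0 Y = Complex 3 (t * Y).
    by rewrite E3; simpc.
  split; first by rewrite /=; lra.
  have := mono 3 0 (t * Y); rewrite normr0 normr_ge0 => /(_ isT).
  have -> : cabs (Complex 3 (0 : R)) = 3 by rewrite -E3 cabs_nat.
  by lra.
have a2 : agree (3 + Complex 0 Y + Complex (x - 3) 0).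
  apply: (@agree_segment _ _ (Num.min 1 (1 + x))) => //.
  - rewrite lt_min ltr01 /=; lra.
  - by right.
  - move=> t /andP[t0 t1].
    have -> : 3 + Complex 0 Y + t%:C * Complex (x - 3) 0 =
       Complex (3 + t * (x - 3)) Y by rewrite E3; simpc.
    have -> : Re (Complex (3 + t * (x - 3)) Y) = 3 + t * (x - 3) by [].
    split.
      have [] : Num.min 1 (1 + x) <= 1 /\ Num.min 1 (1 + x) <= 1 + x.
        by rewrite !ge_min !lexx orbT.
      nra.
    have := @cIm_le R (Complex (3 + t * (x - 3)) Y).
    have -> : Im (Complex (3 + t * (x - 3)) Y) = Y by [].
    have : Num.min 1 (1 + x) <= 1 by rewrite !ge_min !lexx.
    lra.
have -> : Complex x y = 3 + Complex 0 Y + Complex (x - 3) 0 + Complex 0 (y - Y).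
  rewrite E3 [RHS]cE !cReD !cImD /=; congr Complex; ring.
(* On the last segment the imaginary part keeps its sign while its modulus decreases from |Y| to
   |y|, so the end point is the one closest to the disc. *)
apply: (@agree_segment _ _ (Num.min (1 + x) (cabs (Complex x y) - 1))) => //.
- by rewrite lt_min; apply/andP; split; lra.
- by left.
- move=> t /andP[t0 t1].
  have -> : 3 + Complex 0 Y + Complex (x - 3) 0 + t%:C * Complex 0 (y - Y) =
     Complex x (Y + t * (y - Y)).
    by rewrite E3; simpc; congr Complex; ring.
  split; first by rewrite /= ge_min lexx.
  rewrite ge_min; apply/orP; right; rewrite lerD2r; apply: mono.
  rewrite /Y /e; case: (leP 0 y) => y0.
    by rewrite !ger0_norm; nra.
  by rewrite !ltr0_norm; nra.
Qed.

End Continuation.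

(** * Integrals over the circle *)

Section ComplexDerive.
Variable R : realType.
Local Notation C := R[i].
Local Notation Re := complex.Re.
Local Notation Im := complex.Im.
Implicit Types (F G : R -> C).

Definition cder F F' := forall t,
  is_derive t (1 : R) (fun t => Re (F t)) (Re (F' t)) /\
  is_derive t (1 : R) (fun t => Im (F t)) (Im (F' t)).
Definition ccont F := continuous (fun t => Re (F t)) /\
  continuous (fun t => Im (F t)).

Lemma cder_ccont F F' : cder F F' -> ccont F.
Proof.
move=> h; split; [apply: (@derive_continuous _ _ (fun t => Re (F' t)))|
  apply: (@derive_continuous _ _ (fun t => Im (F' t)))] => t; by have [] := h t.
Qed.

Lemma cder_ext F F' G' : (forall t, F' t = G' t) -> cder F F' -> cder F G'.
Proof. by move=> /funext ->. Qed.

Lemma cder_extl F G F' : (forall t, F t = G t) -> cder F F' -> cder G F'.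
Proof. by move=> /funext ->. Qed.

Lemma ccont_ext F G : (forall t, F t = G t) -> ccont F -> ccont G.
Proof. by move=> /funext ->. Qed.

Lemma cder_mul F F' G G' : cder F F' -> cder G G' ->
  cder (fun t => F t * G t) (fun t => F' t * G t + F t * G' t).
Proof.
move=> hF hG t; have [a b] := hF t; have [c d] := hG t; split.
  rewrite (_ : (fun t => _) = fun t => Re (F t) * Re (G t) - Im (F t) * Im (G t)).
    eapply deq; first by eapply dsub; eapply dmul; [exact: a|exact: c|exact: b|exact: d].
    by rewrite cReD !cReM; cbv beta; ring.
  by apply/funext => u; rewrite cReM.
rewrite (_ : (fun t => _) = fun t => Re (F t) * Im (G t) + Im (F t) * Re (G t)).
  eapply deq; first by eapply dadd; eapply dmul; [exact: a|exact: d|exact: b|exact: c].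
  by rewrite cImD !cImM; cbv beta; ring.
by apply/funext => u; rewrite cImM.
Qed.

Lemma cder_cst (c : C) : cder (fun=> c) (fun=> 0).
Proof. by move=> t; split; exact: dcst. Qed.

Lemma cder_cmul (c : C) F F' : cder F F' ->
  cder (fun t => c * F t) (fun t => c * F' t).
Proof.
move=> h; apply: cder_ext (cder_mul (cder_cst c) h) => t.
by rewrite mul0r add0r.
Qed.

Lemma cderX n F F' : cder F F' ->
  cder (fun t => F t ^+ n.+1) (fun t => n.+1%:R * F t ^+ n * F' t).
Proof.
move=> h; elim: n => [|n IH].
  apply: (cder_extl (F := F)) => [t|]; first by rewrite expr1.
  by apply: cder_ext h => t; rewrite expr0 mulr1 mul1r.
apply: (cder_extl (F := fun t => F t * F t ^+ n.+1)) => [t|].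
  by rewrite -exprS.
apply: cder_ext (cder_mul h IH) => t.
by rewrite -[n.+2%:R]natr1 !exprS; ring.
Qed.

Lemma cReV (z : C) : Re z^-1 = Re z / (Re z ^+ 2 + Im z ^+ 2).
Proof. by case: z. Qed.
Lemma cImV (z : C) : Im z^-1 = - (Im z / (Re z ^+ 2 + Im z ^+ 2)).
Proof. by case: z. Qed.

Lemma dinv (f : R -> R) x (df : R) : f x != 0 -> is_derive x (1 : R) f df ->
  is_derive x (1 : R) (fun y => (f y)^-1) (- (f x)^-1 ^+ 2 * df).
Proof.
move=> h d; eapply deq; first exact (is_deriveV h d).
by rewrite /GRing.scale /= exprVn.
Qed.

Lemma cder_inv F F' : (forall t, F t != 0) -> cder F F' ->
  cder (fun t => (F t)^-1) (fun t => - F' t * ((F t)^-1 * (F t)^-1)).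
Proof.
move=> nz h t; have [a b] := h t.
have n0 : Re (F t) ^+ 2 + Im (F t) ^+ 2 != 0.
  by rewrite -cabs_sqr expf_neq0 // cabs_eq0.
have dn : is_derive t (1 : R) (fun t => Re (F t) ^+ 2 + Im (F t) ^+ 2)
    (2 * (Re (F t) * Re (F' t) + Im (F t) * Im (F' t))).
  rewrite (_ : (fun t => _) = fun t => Re (F t) * Re (F t) + Im (F t) * Im (F t)).
    eapply deq; first by eapply dadd; eapply dmul; [exact: a|exact: a|exact: b|exact: b].
    by cbv beta; ring.
  by apply/funext => u; rewrite !expr2.
have di := @dinv (fun t => Re (F t) ^+ 2 + Im (F t) ^+ 2) t _ n0 dn.
split.
  rewrite (_ : (fun t => _) = fun t => Re (F t) * (Re (F t) ^+ 2 + Im (F t) ^+ 2)^-1).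
    eapply deq; first by eapply dmul; [exact: a|exact: di].
    rewrite !(cReM, cImM, cReN, cImN, cReV, cImV); cbv beta.
    move: (Re (F t)) (Im (F t)) (Re (F' t)) (Im (F' t)) n0 => u v u' v' n0.
    by field.
  by apply/funext => u; rewrite cReV.
rewrite (_ : (fun t => _) = fun t => - (Im (F t) * (Re (F t) ^+ 2 + Im (F t) ^+ 2)^-1)).
  eapply deq; first by eapply dopp; eapply dmul; [exact: b|exact: di].
  rewrite !(cReM, cImM, cReN, cImN, cReV, cImV); cbv beta.
  move: (Re (F t)) (Im (F t)) (Re (F' t)) (Im (F' t)) n0 => u v u' v' n0.
  by field.
by apply/funext => u; rewrite cImV.
Qed.

Lemma cder_cexp F F' : cder F F' ->
  cder (fun t => cexp (F t)) (fun t => F' t * cexp (F t)).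
Proof.
move=> h t; have [a b] := h t; split => /=.
  eapply deq; first by eapply dmul; [eapply dexp; exact: a|eapply dcos; exact: b].
  by cbv beta; rewrite cReM /=; ring.
eapply deq; first by eapply dmul; [eapply dexp; exact: a|eapply dsin; exact: b].
by cbv beta; rewrite cImM /=; ring.
Qed.

Lemma ccontM F G : ccont F -> ccont G -> ccont (fun t => F t * G t).
Proof.
move=> [a b] [c d]; split.
  rewrite (_ : (fun t => _) = fun t => Re (F t) * Re (G t) - Im (F t) * Im (G t)).
    by move=> t; apply: cvgB; apply: cvgM; [exact: a|exact: c|exact: b|exact: d].
  by apply/funext => u; rewrite cReM.
rewrite (_ : (fun t => _) = fun t => Re (F t) * Im (G t) + Im (F t) * Re (G t)).
  by move=> t; apply: cvgD; apply: cvgM; [exact: a|exact: d|exact: b|exact: c].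
by apply/funext => u; rewrite cImM.
Qed.

Lemma ccontD F G : ccont F -> ccont G -> ccont (fun t => F t + G t).
Proof.
move=> [a b] [c d]; split.
  rewrite (_ : (fun t => _) = fun t => Re (F t) + Re (G t)).
    by move=> t; apply: cvgD; [exact: a|exact: c].
  by apply/funext => u; rewrite cReD.
rewrite (_ : (fun t => _) = fun t => Im (F t) + Im (G t)).
  by move=> t; apply: cvgD; [exact: b|exact: d].
by apply/funext => u; rewrite cImD.
Qed.

Lemma ccont_cst (c : C) : ccont (fun=> c).
Proof. by split => t; exact: cvg_cst. Qed.

Lemma ccontX n F : ccont F -> ccont (fun t => F t ^+ n).
Proof.
move=> h; elim: n => [|n IH].
  by apply: ccont_ext (ccont_cst 1) => t; rewrite expr0.
by apply: ccont_ext (ccontM h IH) => t; rewrite exprS.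
Qed.

End ComplexDerive.

(** * Contour integrals over the circle *)

Section Circle.
Variable R : realType.
Local Notation C := R[i].
Local Notation Re := complex.Re.
Local Notation Im := complex.Im.
Local Notation mu := (@lebesgue_measure R).
Implicit Types (F G : R -> C) (t x : R).

(** The parameter interval enters as a factor rather than as a domain of integration, so that the
    whole-space lemmas on complex integrals, including Fubini, apply unchanged. *)
Definition chi : R -> R := \1_(`[- pi, pi]%classic).

Lemma npi_lt_pi : - pi < pi :> R.
Proof. by have := pi_gt0 R; lra. Qed.

Lemma chi_mul (g : R -> R) t : chi t * g t = (g \_ `[- pi, pi]) t.
Proof.
rewrite /chi indicE patchE; by case: (t \in _); rewrite ?mul1r ?mul0r.
Qed.

Lemma chi01 t : 0 <= chi t <= 1.
Proof. by rewrite /chi indicE; case: (_ \in _); rewrite /= ?lexx ler01. Qed.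

Lemma meas_chi : measurable_fun setT chi.
Proof. by apply: measurable_indic; exact: measurable_itv. Qed.

Lemma itg_chi (g : R -> R) : continuous g -> itg mu (fun t => chi t * g t).
Proof.
move=> cg; rewrite (_ : (fun t => _) = g \_ `[- pi, pi]); last first.
  by apply/funext => t; exact: chi_mul.
have h : mu.-integrable `[- pi, pi] (EFin \o g).
  apply: continuous_compact_integrable; first exact: segment_compact.
  exact: continuous_subspaceT.
rewrite -restrict_EFin.
exact (proj1 (@integrable_mkcond _ _ R mu `[- pi, pi]%classic (EFin \o g) (measurable_itv _)) h).
Qed.

Lemma Rint_chi_FTC (G g : R -> R) : (forall t, is_derive t (1 : R) G (g t)) ->
  continuous g -> \int[mu]_t (chi t * g t) = G pi - G (- pi).
Proof.
move=> dG cg; rewrite (_ : (fun t => _) = g \_ `[- pi, pi]); last first.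
  by apply/funext => t; exact: chi_mul.
have cG : continuous G by exact: derive_continuous dG.
rewrite -Rintegral_mkcond /Rintegral (@continuous_FTC2 _ g G) //.
- exact: npi_lt_pi.
- exact: continuous_subspaceT.
- split.
  + by move=> t _; apply: ex_derive; exact: dG.
  + by apply: cvg_at_right_filter; exact: cG.
  + by apply: cvg_at_left_filter; exact: cG.
- by move=> t _; rewrite derive1E; apply: derive_val; exact: dG.
Qed.

Definition oint F : C := cint mu (fun t => (chi t)%:C * F t).

Lemma Re_chi F t : Re ((chi t)%:C * F t) = chi t * Re (F t).
Proof. by rewrite cReM /= mul0r subr0. Qed.
Lemma Im_chi F t : Im ((chi t)%:C * F t) = chi t * Im (F t).
Proof. by rewrite cImM /= mul0r addr0. Qed.

Lemma citg_chi F : ccont F -> citg mu (fun t => (chi t)%:C * F t).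
Proof.
move=> [a b]; split.
  by under eq_fun do rewrite Re_chi; exact: itg_chi.
by under eq_fun do rewrite Im_chi; exact: itg_chi.
Qed.

Lemma oint_FTC F F' : cder F F' -> ccont F' -> F pi = F (- pi) -> oint F' = 0.
Proof.
move=> d [a b] e; rewrite /oint /cint.
under eq_Rintegral do rewrite Re_chi.
under [X in Complex _ X]eq_Rintegral do rewrite Im_chi.
rewrite (Rint_chi_FTC (fun t => (d t).1) a).
rewrite (Rint_chi_FTC (fun t => (d t).2) b).
by rewrite e !subrr.
Qed.

Lemma ointZ (c : C) F : ccont F -> oint (fun t => c * F t) = c * oint F.
Proof.
move=> h; rewrite -cintZ; last exact: citg_chi.
by congr cint; apply/funext => t; rewrite mulrCA.
Qed.

Lemma ointD F G : ccont F -> ccont G ->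
  oint (fun t => F t + G t) = oint F + oint G.
Proof.
move=> h1 h2; rewrite -cintD; [|exact: citg_chi|exact: citg_chi].
by congr cint; apply/funext => t; rewrite mulrDr.
Qed.

Lemma eq_oint F G : F =1 G -> oint F = oint G. Proof. by move=> /funext ->. Qed.

(* The circle [|s - 1| = 2] and its tangent; it touches the line [Re s = -1] and
   the unit circle at [s = -1] only. *)
Definition circ t : C := Complex (1 + 2 * cos t) (2 * sin t).
Definition dcirc t : C := Complex (- (2 * sin t)) (2 * cos t).

Lemma cder_circ : cder circ dcirc.
Proof.
move=> t; split => /=.
  eapply deq; first by eapply dadd; [exact: dcst|eapply dcmul; eapply dcos; exact: did].
  by ring.
eapply deq; first by eapply dcmul; eapply dsin; exact: did.
by ring.
Qed.

Lemma cder_dcirc : cder dcirc (fun t => Complex (- (2 * cos t)) (- (2 * sin t))).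
Proof.
move=> t; split => /=.
  eapply deq; first by eapply dopp; eapply dcmul; eapply dsin; exact: did.
  by ring.
eapply deq; first by eapply dcmul; eapply dcos; exact: did.
by ring.
Qed.

Lemma ccont_circ : ccont circ. Proof. exact: cder_ccont cder_circ. Qed.
Lemma ccont_dcirc : ccont dcirc. Proof. exact: cder_ccont cder_dcirc. Qed.

Lemma circ_periodic : circ pi = circ (- pi).
Proof. by rewrite /circ cosN sinN sinpi oppr0. Qed.

Lemma circ_norm t : cabs (circ t) ^+ 2 = 5 + 4 * cos t.
Proof.
rewrite cabs_sqr /=; have e : sin t ^+ 2 = 1 - cos t ^+ 2.
  by rewrite -(cos2Dsin2 t); ring.
by rewrite exprMn e; ring.
Qed.

Lemma circ_ge1 t : 1 <= cabs (circ t).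
Proof.
rewrite -(@ler_sqr _ 1) ?nnegrE ?cabs_ge0 // circ_norm.
by have := cos_geN1 t; lra.
Qed.

Lemma circ_le3 t : cabs (circ t) <= 3.
Proof.
rewrite -(@ler_sqr _ _ 3) ?nnegrE ?cabs_ge0 // circ_norm.
by have := cos_le1 t; lra.
Qed.

Lemma circ_neq0 t : circ t != 0.
Proof. by rewrite -cabs_eq0 gt_eqF // (lt_le_trans ltr01) // circ_ge1. Qed.

Lemma ccont_circV : ccont (fun t => (circ t)^-1).
Proof. exact: cder_ccont (cder_inv circ_neq0 cder_circ). Qed.

Lemma oint_pow n : oint (fun t => circ t ^+ n * dcirc t) = 0.
Proof.
have cc : ccont (fun t => circ t ^+ n * dcirc t).
  by apply: ccontM; [apply: ccontX; exact: ccont_circ|exact: ccont_dcirc].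
have n0 : n.+1%:R != 0 :> C by rewrite pnatr_eq0.
apply: (mulfI n0); rewrite mulr0 -ointZ //.
apply: (oint_FTC (F := fun t => circ t ^+ n.+1)).
- by apply: cder_ext (cderX n cder_circ) => t; rewrite mulrA.
- by apply: ccontM => //; exact: ccont_cst.
- by rewrite circ_periodic.
Qed.

Lemma oint_powV n : oint (fun t => (circ t)^-1 ^+ n.+2 * dcirc t) = 0.
Proof.
have cc : ccont (fun t => (circ t)^-1 ^+ n.+2 * dcirc t).
  by apply: ccontM; [apply: ccontX; exact: ccont_circV|exact: ccont_dcirc].
have n0 : - n.+1%:R != 0 :> C by rewrite oppr_eq0 pnatr_eq0.
apply: (mulfI n0); rewrite mulr0 -ointZ //.
apply: (oint_FTC (F := fun t => (circ t)^-1 ^+ n.+1)).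
- apply: cder_ext (cderX n (cder_inv circ_neq0 cder_circ)) => t.
  by rewrite !exprS; ring.
- by apply: ccontM => //; exact: ccont_cst.
- by rewrite circ_periodic.
Qed.

Definition wexp n x t : C := circ t ^+ n * cexp (- (circ t * x%:C)) * dcirc t.

Lemma cder_cexp_circ x : cder (fun t => cexp (- (circ t * x%:C)))
  (fun t => - x%:C * dcirc t * cexp (- (circ t * x%:C))).
Proof.
apply: cder_cexp; have h := cder_cmul (- x%:C) cder_circ.
by apply: cder_extl h => t; rewrite mulNr mulrC.
Qed.

Lemma ccont_cexp_circ x : ccont (fun t => cexp (- (circ t * x%:C))).
Proof. exact: cder_ccont (cder_cexp_circ x). Qed.

Lemma ccont_wexp n x : ccont (wexp n x).
Proof.
apply: ccontM; last exact: ccont_dcirc.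
by apply: ccontM; [apply: ccontX; exact: ccont_circ|exact: ccont_cexp_circ].
Qed.

(** Cauchy's theorem for s^n e^(-sx), from explicit primitives: the derivative of s^(n+1) e^(-sx)
    relates the exponents n and n + 1, which gives an induction. At [x = 0] division by [x] fails
    and the integrand is a pure power. *)
Lemma oint_wexp n x : oint (wexp n x) = 0.
Proof.
have [->|x0] := eqVneq x 0.
  rewrite -(oint_pow n); apply: eq_oint => t.
  by rewrite /wexp mulr0 oppr0 cexp0 mulr1.
have x0' : - x%:C != 0 :> C by rewrite oppr_eq0 fmorph_eq0.
elim: n => [|n IH]; apply: (mulfI x0'); rewrite mulr0.
  rewrite -ointZ; last exact: ccont_wexp.
  apply: (oint_FTC (F := fun t => cexp (- (circ t * x%:C)))).
  - apply: cder_ext (cder_cexp_circ x) => t; rewrite /wexp expr0; ring.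
  - by apply: ccontM; [exact: ccont_cst|exact: ccont_wexp].
  - by rewrite circ_periodic.
have e : oint (fun t => n.+1%:R * wexp n x t + - x%:C * wexp n.+1 x t) = 0.
  apply: (oint_FTC (F := fun t => circ t ^+ n.+1 * cexp (- (circ t * x%:C)))).
  - apply: cder_ext (cder_mul (cderX n cder_circ) (cder_cexp_circ x)) => t.
    by rewrite /wexp; ring.
  - by apply: ccontD; apply: ccontM; first [exact: ccont_cst|exact: ccont_wexp].
  - by rewrite circ_periodic.
rewrite ointD in e; first last.
- by apply: ccontM; [exact: ccont_cst|exact: ccont_wexp].
- by apply: ccontM; [exact: ccont_cst|exact: ccont_wexp].
by rewrite !ointZ ?IH ?mulr0 ?add0r in e; [|exact: ccont_wexp|exact: ccont_wexp].
Qed.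

(** The Cauchy integral of 1/s, that is 2 pi i, kept as a symbol. *)
Definition oint1 : C := oint (fun t => (circ t)^-1 * dcirc t).

(** The imaginary part of ds/s is the change of argument, which is positive all along the circle
    because 0 lies inside it. *)
Lemma oint1_neq0 : oint1 != 0.
Proof.
have eI : Im oint1 = \int[mu]_t (chi t * ((4 + 2 * cos t) / (5 + 4 * cos t))).
  transitivity (\int[mu]_t Im ((chi t)%:C * ((circ t)^-1 * dcirc t))); first by [].
  congr (Rintegral _ _ _); apply/funext => t; rewrite (Im_chi (fun t => (circ t)^-1 * dcirc t)) cImM cReV cImV -cabs_sqr circ_norm /=.
  have n0 : 5 + 4 * cos t != 0 by rewrite gt_eqF //; have := cos_geN1 t; lra.
  congr (_ * _); have e : sin t ^+ 2 = 1 - cos t ^+ 2.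
    by rewrite -(cos2Dsin2 t); ring.
  transitivity ((2 * cos t + 4 * cos t ^+ 2 + 4 * sin t ^+ 2) / (5 + 4 * cos t)).
    by field.
  by rewrite e; field.
apply/eqP => o0; move: eI; rewrite o0 => /esym.
move=> e0.
have c1 : continuous (fun t : R => (4 + 2 * cos t) / (5 + 4 * cos t)).
  have [_ h] := ccontM ccont_circV ccont_dcirc.
  move: h; rewrite (_ : (fun t => _) = (fun t : R => (4 + 2 * cos t) / (5 + 4 * cos t))) //.
  apply/funext => t; rewrite cImM cReV cImV -cabs_sqr circ_norm /=.
  have n0 : 5 + 4 * cos t != 0 by rewrite gt_eqF //; have := cos_geN1 t; lra.
  have e : sin t ^+ 2 = 1 - cos t ^+ 2.
    by rewrite -(cos2Dsin2 t); ring.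
  transitivity ((2 * cos t + 4 * cos t ^+ 2 + 4 * sin t ^+ 2) / (5 + 4 * cos t)).
    by field.
  by rewrite e; field.
(* The numerator is at least 2 and the denominator at most 9. *)
have : \int[mu]_t (chi t * (2 / 9)) <=
    \int[mu]_t (chi t * ((4 + 2 * cos t) / (5 + 4 * cos t))).
  apply: le_Rintegral => //.
  - by apply: itg_chi => t; exact: cvg_cst.
  - exact: itg_chi.
  - move=> t _; apply: ler_wpM2l; first by case/andP: (chi01 t).
    rewrite ler_pdivlMr; last by have := cos_geN1 t; lra.
    by have := cos_geN1 t; have := cos_le1 t; lra.
have d t : is_derive t (1 : R) (fun t => 2 / 9 * t) (2 / 9 : R).
  by eapply deq; [eapply dcmul; exact: did|rewrite mulr1].
have c2 : continuous (fun _ : R => 2 / 9 : R) by move=> t; exact: cvg_cst.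
by rewrite e0 (Rint_chi_FTC d c2); have := pi_gt0 R; lra.
Qed.

Lemma oint_z (i : int) : oint (fun t => circ t ^ i * dcirc t) =
  if i == -1 then oint1 else 0.
Proof.
case: i => n; first exact: oint_pow.
case: n => [|n].
  by apply: eq_oint => t; rewrite /exprz expr1.
rewrite (_ : (_ == _) = false) // -(oint_powV n).
by apply: eq_oint => t; rewrite exprVn.
Qed.

End Circle.

(** * Fubini for complex integrands *)

Section ComplexFubini.
Variable R : realType.
Local Notation C := R[i].
Local Notation Re := complex.Re.
Local Notation Im := complex.Im.
Local Notation mu := (@lebesgue_measure R).
Local Notation mT := (measurableTypeR R).

Lemma rFubini (F : mT -> mT -> R) (h : mT -> R) :
  measurable_fun setT (fun z : mT * mT => F z.1 z.2) ->
  (forall t, itg mu (F t)) -> (forall x, itg mu (F ^~ x)) ->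
  (forall t, \int[mu]_x `|F t x| <= h t) -> itg mu h ->
  \int[mu]_t \int[mu]_x F t x = \int[mu]_x \int[mu]_t F t x.
Proof.
move=> mF i1 i2 Fh ih.
have iF : (mu \x mu)%E.-integrable setT (EFin \o (fun z : mT * mT => F z.1 z.2)).
  apply/integrable12ltyP; first exact/measurable_EFinP.
  apply: (@le_lt_trans _ _ (\int[mu]_t `|(h t)%:E|)%E); last first.
    by have /integrableP[] := ih.
  apply: ge0_le_integral => //.
  - by move=> t _; apply: integral_ge0.
  - apply: (@measurable_fun_fubini_tonelli_F _ _ mT mT R _ (fun z : mT * mT => `|(F z.1 z.2)%:E|%E)).
      by apply: measurableT_comp => //; exact/measurable_EFinP.
    by move=> z; exact: abse_ge0.
  - by apply: measurableT_comp => //; exact: (measurable_int mu ih).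
  - move=> t _ /=; apply: (@le_trans _ _ (h t)%:E); last first.
      by rewrite lee_fin ler_norm.
    have := Fh t; rewrite /Rintegral -lee_fin fineK //.
    exact: (integrable_fin_num measurableT (itg_abs (i1 t))).
have := Fubini iF => /=; rewrite /Rintegral => e.
under eq_integral => t _.
  rewrite fineK; last exact: (integrable_fin_num measurableT (i1 t)).
  over.
under [in RHS]eq_integral => x _.
  rewrite fineK; last exact: (integrable_fin_num measurableT (i2 x)).
  over.
by rewrite /= e.
Qed.

Lemma cFubini (F : mT -> mT -> C) (g : mT -> mT -> R) (h : mT -> R) :
  cmeas (fun z : mT * mT => F z.1 z.2) ->
  (forall t, citg mu (F t)) -> (forall x, citg mu (F ^~ x)) ->
  (forall t x, cabs (F t x) <= g t x) -> (forall t, itg mu (g t)) ->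
  (forall t, \int[mu]_x g t x <= h t) -> itg mu h ->
  cint mu (fun t => cint mu (F t)) = cint mu (fun x => cint mu (F ^~ x)).
Proof.
move=> [m1 m2] i1 i2 Fg ig gh ih; rewrite /cint /=; congr Complex.
  apply: (rFubini (h := h)) => //.
  - by move=> t; exact: (i1 t).1.
  - by move=> x; exact: (i2 x).1.
  - move=> t; apply: le_trans (gh t); apply: le_Rintegral => //.
      by apply: itg_abs; exact: (i1 t).1.
    by move=> x _; exact: le_trans (cRe_le _) (Fg t x).
apply: (rFubini (h := h)) => //.
- by move=> t; exact: (i1 t).2.
- by move=> x; exact: (i2 x).2.
- move=> t; apply: le_trans (gh t); apply: le_Rintegral => //.
    by apply: itg_abs; exact: (i1 t).2.
  by move=> x _; exact: le_trans (cIm_le _) (Fg t x).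
Qed.

End ComplexFubini.

(** * Hardy's theorem in one variable *)

Section HardySequence.
Variable R : realType.
Local Notation C := R[i].
Local Notation Re := complex.Re.
Local Notation Im := complex.Im.
Local Notation mu := (@lebesgue_measure R).
Local Notation cnt := (@counting nat R).
Local Notation epdf := (@exponential_pdf R).
Local Notation mT := (measurableTypeR R).

(* [ca t = 1 + Re (circ t)]; the weight [cw] vanishes to the same order
   ([cabs_1circ]), which makes the integrands below integrable near [s = -1]. *)
Definition ca (t : R) : R := 2 + 2 * cos t.

Lemma ca_ge0 t : 0 <= ca t.
Proof. by rewrite /ca; have := cos_geN1 t; lra. Qed.

Definition cw m (t : R) : C := (1 + circ t) ^+ 2 * circ t ^+ m * dcirc t.

Lemma cabs_1circ t : cabs (1 + circ t) ^+ 2 = 4 * ca t.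
Proof.
rewrite cabs_sqr /= add0r /ca; have e : sin t ^+ 2 = 1 - cos t ^+ 2.
  by rewrite -(cos2Dsin2 t); ring.
by rewrite exprMn e; ring.
Qed.

Lemma cabs_dcirc (t : R) : cabs (dcirc t) = 2.
Proof.
rewrite cabsE /= sqrrN !exprMn -mulrDr addrC cos2Dsin2 mulr1.
by rewrite sqrtr_sqr ger0_norm.
Qed.

(** The factor (1 + s)^2 contributes [4 * ca t], the bound |s| <= 3 contributes [3 ^+ m], and the
    tangent contributes 2. *)
Lemma cabs_cw m t : cabs (cw m t) <= 8 * 3 ^+ m * ca t.
Proof.
rewrite /cw cabsM [cabs (_ * circ t ^+ m)]cabsM !cabsX cabs_1circ cabs_dcirc.
have := ca_ge0 t => a0.
rewrite (_ : 8 * 3 ^+ m * ca t = 4 * ca t * 3 ^+ m * 2); last by ring.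
rewrite ler_wpM2r // ler_wpM2l ?mulr_ge0 //.
by rewrite lerXn2r ?nnegrE ?cabs_ge0 // circ_le3.
Qed.

Lemma cw_eq0 m t : ca t = 0 -> cw m t = 0.
Proof.
move=> a0; have := cabs_1circ t; rewrite a0 mulr0 => /eqP.
rewrite expf_eq0 => /andP[_]; rewrite cabs_eq0 => /eqP e.
by rewrite /cw e expr0n /= !mul0r.
Qed.

Lemma circ_sqr_ca t : cabs (circ t) ^+ 2 = 1 + 2 * ca t.
Proof. by rewrite circ_norm /ca; ring. Qed.

Lemma circ_gt1 t : 0 < ca t -> 1 < cabs (circ t).
Proof.
move=> a0; rewrite -(@ltr_sqr _ 1) ?nnegrE ?cabs_ge0 // circ_sqr_ca; lra.
Qed.

Lemma ccont_1circ : ccont (fun t : R => 1 + circ t).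
Proof. by apply: ccontD; [exact: ccont_cst|exact: ccont_circ]. Qed.

Lemma ccont_cw m : ccont (cw m).
Proof.
apply: ccontM; last exact: ccont_dcirc.
by apply: ccontM; apply: ccontX; [exact: ccont_1circ|exact: ccont_circ].
Qed.

Lemma ccont_cmeas (F : R -> C) : ccont F -> @cmeas _ mT R F.
Proof. by move=> [a b]; split; exact: continuous_measurable_fun. Qed.

Lemma oint_cw_exp m x : oint (fun t => cw m t * cexp (- (circ t * x%:C))) = 0.
Proof.
rewrite (eq_oint (G := fun t => wexp m x t + (2 * wexp m.+1 x t + wexp m.+2 x t))).
  rewrite ointD; [|exact: ccont_wexp|].
    rewrite ointD; [| |exact: ccont_wexp].
      by rewrite ointZ; [rewrite !oint_wexp mulr0 !addr0|exact: ccont_wexp].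
    by apply: ccontM; [exact: ccont_cst|exact: ccont_wexp].
  apply: ccontD; last exact: ccont_wexp.
  by apply: ccontM; [exact: ccont_cst|exact: ccont_wexp].
by move=> t; rewrite /cw /wexp !exprS expr0; ring.
Qed.

(** The residue at 0 of (1 + s)^2 s^(m-n-1): the coefficients 1, 2, 1 of the square are picked out
    at n = m, m + 1, m + 2. *)
Lemma oint_cw_pow m n : oint (fun t => cw m t * (circ t)^-1 ^+ n.+1) =
  ((n == m)%:R + 2 * (n == m.+1)%:R + (n == m.+2)%:R) * oint1 R.
Proof.
pose zp (i : int) (t : R) : C := circ t ^ i * dcirc t.
have cz i : ccont (zp i).
  apply: ccontM; last exact: ccont_dcirc.
  case: i => k; first exact: (ccontX k (@ccont_circ R)).
  apply: (ccont_ext (F := fun t => (circ t)^-1 ^+ k.+1)); last first.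
    exact: (ccontX k.+1 (@ccont_circV R)).
  by move=> t; rewrite exprVn.
rewrite (eq_oint (G := fun t => zp (m%:Z - n.+1%:Z) t + (2 * zp (m.+1%:Z - n.+1%:Z) t + zp (m.+2%:Z - n.+1%:Z) t))).
  rewrite ointD //; last by apply: ccontD => //; apply: ccontM => //; exact: ccont_cst.
  rewrite ointD //; last by apply: ccontM => //; exact: ccont_cst.
  rewrite ointZ // !oint_z.
  have e1 : (m%:Z - n.+1%:Z == -1) = (n == m) by lia.
  have e2 : (m.+1%:Z - n.+1%:Z == -1) = (n == m.+1) by lia.
  have e3 : (m.+2%:Z - n.+1%:Z == -1) = (n == m.+2) by lia.
  rewrite e1 e2 e3; do 3! case: (n == _); rewrite /=; ring.
move=> t; rewrite /zp !expfzDr ?circ_neq0 //.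
have -> : circ t ^ (- n.+1%:Z) = (circ t)^-1 ^+ n.+1 by rewrite exprVn.
rewrite -!exprnP /cw !exprS expr0; ring.
Qed.

Variables (b : nat -> R) (M K : R) (phi : R -> R).
Hypothesis bM : forall n, `|b n| <= M.
Hypothesis phiE : forall x,
  (fun N => \sum_(n < N) b n * exp_coeff x n) @ \oo --> phi x.
Hypothesis phiK : forall x, 0 <= x -> `|phi x| <= K * expR (- x).

Local Notation f := (restr0 phi).

Let M0 : 0 <= M. Proof. exact: le_trans (normr_ge0 _) (bM 0%N). Qed.
Let K0 : 0 <= K. Proof. exact: decay_K0 phiK. Qed.
Let mf : measurable_fun setT f.
Proof. by apply: meas_restr0; exact: meas_phi phiE. Qed.
Let fK := restr0_le phiK.

Definition fubini_ker m (t x : R) : C :=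
  (chi t)%:C * (cw m t * LK f (circ t) 0 x).

Lemma exp_coeff0 (x : R) : exp_coeff x 0 = 1.
Proof. by rewrite /exp_coeff /= expr0 fact0 divr1. Qed.

(** The decay of [f] and of e^(-sx) combine to the rate [ca t], and the factor [ca t] from the
    weight is exactly what normalizes an exponential density of that rate. Its mass is at most 1
    however close the circle comes to s = -1, which is what Fubini requires. *)
Lemma fubini_ker_le m t x :
  cabs (fubini_ker m t x) <= chi t * (8 * 3 ^+ m * K) * epdf (ca t) x.
Proof.
rewrite /fubini_ker cabsM cabs_real cabsM cabs_LK exp_coeff0 normr1 mulr1.
have /andP[c0 c1] := chi01 t.
rewrite (ger0_norm c0) -!mulrA ler_wpM2l //.
have [x0|x0] := ltP x 0.
  by rewrite restr0_lt0 // epdf_lt0 // normr0 !mul0r !mulr0.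
have := fK x; rewrite !epdfE // => h.
rewrite (_ : 8 * (3 ^+ m * (K * (ca t * expR (- ca t * x)))) =
  (8 * 3 ^+ m * ca t) * (K * (1 * expR (- 1 * x)) * expR (- (Re (circ t) * x)))).
  by apply: ler_pM; rewrite ?cabs_ge0 ?mulr_ge0 ?expR_ge0 // ?cabs_cw // ler_wpM2r ?expR_ge0.
have -> : expR (- ca t * x) = expR (- 1 * x) * expR (- (Re (circ t) * x)).
  by rewrite -expRD; congr expR; rewrite /ca /=; ring.
ring.
Qed.

(** The rate 0 occurs where the circle passes through s = -1; the density then degenerates to the
    zero function. *)
Lemma epdf_int_le a : 0 <= a -> itg mu (epdf a) /\ \int[mu]_x epdf a x <= 1.
Proof.
rewrite le_eqVlt => /predU1P[<-|a0].
  have -> : epdf 0 = fun=> 0.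
    apply/funext => x; have [x0|x0] := ltP x 0; first by rewrite epdf_lt0.
    by rewrite epdfE // mul0r.
  split; first exact: integrable0.
  by rewrite Rintegral_cst // mul0r.
split; first exact: epdf_itg.
by rewrite /Rintegral integral_exponential_pdf.
Qed.

Lemma cmeas_fubini_ker m :
  cmeas (fun z : mT * mT => fubini_ker m z.1 z.2).
Proof.
have m1 (F : mT -> C) : cmeas F -> cmeas (fun z : mT * mT => F z.1).
  move=> [u v]; split.
    exact: (measurableT_comp u (@measurable_fst _ _ mT mT)).
  exact: (measurableT_comp v (@measurable_fst _ _ mT mT)).
have m2 (F : mT -> C) : cmeas F -> cmeas (fun z : mT * mT => F z.2).
  move=> [u v]; split.
    exact: (measurableT_comp u (@measurable_snd _ _ mT mT)).
  exact: (measurableT_comp v (@measurable_snd _ _ mT mT)).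
apply: cmeasM; first by apply: (m1 (fun t => (chi t)%:C)); apply: cmeas_real; exact: meas_chi.
apply: cmeasM; first by apply: (m1 (cw m)); apply: ccont_cmeas; exact: ccont_cw.
apply: cmeasM.
  apply: (m2 (fun x => (f x * exp_coeff x 0)%:C)); apply: cmeas_real.
  by apply: measurable_funM => //; exact: meas_exp_coeff.
have [u v] : cmeas (fun z : mT * mT => circ z.1 * (z.2)%:C).
  apply: cmeasM; first by apply: (m1 (@circ R)); apply: ccont_cmeas; exact: ccont_circ.
  by apply: (m2 (fun x => x%:C)); apply: cmeas_real; exact: measurable_id.
split => /=.
  rewrite (_ : (fun x => _) = fun z : mT * mT => expR (- Re (circ z.1 * (z.2)%:C)) *
    cos (- Im (circ z.1 * (z.2)%:C))); first by mfun.
  by apply/funext => z; rewrite -cReN -cImN.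
rewrite (_ : (fun x => _) = fun z : mT * mT => expR (- Re (circ z.1 * (z.2)%:C)) *
    sin (- Im (circ z.1 * (z.2)%:C))); first by mfun.
by apply/funext => z; rewrite -cReN -cImN.
Qed.

(** After exchanging the integrals, the inner one is, for each [x], a contour integral of an entire
    function of s. *)
Lemma oint_L m : oint (fun t => cw m t * cint mu (LK f (circ t) 0)) = 0.
Proof.
have iL t : citg mu (fubini_ker m t).
  have [ie _] := epdf_int_le (ca_ge0 t).
  apply: (@citg_dom _ _ R mu _ (fun x => chi t * (8 * 3 ^+ m * K) * epdf (ca t) x)).
  - apply: cmeasM; first exact: cmeas_cst.
    by apply: cmeasM; [exact: cmeas_cst|exact: cmeas_LK].
  - by move=> x; exact: fubini_ker_le.
  - exact: itgZ.
have iT x : citg mu (fubini_ker m ^~ x).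
  rewrite (_ : _ ^~ x = fun t => (chi t)%:C * ((f x)%:C * (cw m t * cexp (- (circ t * x%:C))))).
    apply: citg_chi; apply: ccontM; first exact: ccont_cst.
    by apply: ccontM; [exact: ccont_cw|exact: ccont_cexp_circ].
  by apply/funext => t; rewrite /fubini_ker /LK exp_coeff0 mulr1; ring.
transitivity (cint mu (fun t => cint mu (fubini_ker m t))).
  rewrite /oint; congr cint; apply/funext => t.
  (* At s = -1 the Laplace integral lies outside the range where integrability is known, but there
     the weight is 0. *)
  have := ca_ge0 t; rewrite le_eqVlt => /predU1P[a0|a0].
    rewrite cw_eq0 // mul0r mulr0 -(@cint0 _ _ R mu); congr cint.
    by apply/funext => x; rewrite /fubini_ker cw_eq0 // mul0r mulr0.
  rewrite mulrA -(@cintZ _ _ R mu).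
    by congr cint; apply/funext => x; rewrite /fubini_ker mulrA.
  by apply: (citg_LK mf fK); move: a0; rewrite /ca /=; lra.
rewrite (cFubini (g := fun t x => chi t * (8 * 3 ^+ m * K) * epdf (ca t) x)
  (h := fun t => chi t * (8 * 3 ^+ m * K))).
- rewrite -(@cint0 _ _ R mu); congr cint; apply/funext => x.
  transitivity (oint (fun t => (f x)%:C * (cw m t * cexp (- (circ t * x%:C))))).
    congr cint; apply/funext => t; rewrite /fubini_ker /LK exp_coeff0 mulr1; ring.
  rewrite ointZ ?oint_cw_exp ?mulr0 //.
  by apply: ccontM; [exact: ccont_cw|exact: ccont_cexp_circ].
- exact: cmeas_fubini_ker.
- exact: iL.
- exact: iT.
- exact: fubini_ker_le.
- by move=> t; apply: itgZ; exact: (epdf_int_le (ca_ge0 t)).1.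
- move=> t; have [ie le1] := epdf_int_le (ca_ge0 t).
  rewrite RintegralZl // ler_piMr //.
  by have /andP[c0 _] := chi01 t; rewrite !mulr_ge0 // exprn_ge0.
- by apply: itg_chi => t; exact: cvg_cst.
Qed.

Lemma RK0_partial_le t N : 0 < ca t ->
  cabs (\sum_(n < N) RK b (circ t) 0 n) <= M * (cabs (circ t) - 1)^-1.
Proof.
move=> a0; have c1 := circ_gt1 a0; set r := cabs (circ t) in c1 *.
have r0 : 0 < r by lra.
apply: le_trans (cabs_sum _ _ _) _.
apply: le_trans (_ : \sum_(n < N) M * r^-1 * ('C(0 + n, 0)%:R * r^-1 ^+ n) <= _).
  apply: ler_sum => n _; apply: le_trans (cabs_RK bM _ _ _) _.
  by rewrite /RB bin0 bin0 addn0 exprS mulr1 mul1r -mulrA.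
rewrite -mulr_sumr -mulrA ler_wpM2l //.
apply: le_trans (_ : r^-1 * ((1 - r^-1)^-1) ^+ 1 <= _).
  rewrite ler_wpM2l ?invr_ge0 ?(ltW r0) //; apply: negbin_le.
  by rewrite invr_ge0 (ltW r0) /= invf_lt1.
rewrite expr1 -invfM mulrBr mulr1 divff // gt_eqF //.
Qed.

(** Termwise integration. The partial sums are of size M / (|s| - 1), unbounded near s = -1; the
    weight compensates because [ca t = (|s|^2 - 1) / 2]. *)
Lemma oint_R m :
  oint (fun t => cw m t * cint cnt (RK b (circ t) 0)) =
  (b m + 2 * b m.+1 + b m.+2)%:C * oint1 R.
Proof.
pose FN N (t : R) : C := (chi t)%:C * (cw m t * \sum_(n < N) RK b (circ t) 0 n).
have term N t : cw m t * \sum_(n < N) RK b (circ t) 0 n =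
    \sum_(n < N) (b n)%:C * (cw m t * (circ t)^-1 ^+ n.+1).
  rewrite mulr_sumr; apply: eq_bigr => n _.
  by rewrite /RK bin0 addn0 mulr1 mulrCA.
have ct n : ccont (fun t => cw m t * (circ t)^-1 ^+ n.+1).
  by apply: ccontM; [exact: ccont_cw|exact: (ccontX n.+1 (@ccont_circV R))].
have FNE N : FN N = fun t => \sum_(n < N) (chi t)%:C * ((b n)%:C * (cw m t * (circ t)^-1 ^+ n.+1)).
  by apply/funext => t; rewrite /FN term mulr_sumr.
have iFN n : citg mu (fun t => (chi t)%:C * ((b n)%:C * (cw m t * (circ t)^-1 ^+ n.+1))).
  by apply: citg_chi; apply: ccontM => //; exact: ccont_cst.
have pc t : ccvg (FN ^~ t) ((chi t)%:C * (cw m t * cint cnt (RK b (circ t) 0))).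
  apply: ccvgZ; have := ca_ge0 t; rewrite le_eqVlt => /predU1P[a0|a0].
    rewrite cw_eq0 // mul0r; apply: (ccvg_near (u := fun=> 0)); last exact: ccvg_cst.
    by move=> N; rewrite mul0r.
  apply: ccvgZ; apply: ccvg_count; apply: (citg_RK bM); exact: circ_gt1.
have mFN N : @cmeas _ mT R (FN N).
  rewrite FNE; apply: (@cmeas_sum _ mT R N (fun n t => (chi t)%:C * ((b n)%:C * (cw m t * (circ t)^-1 ^+ n.+1)))) => n.
  exact: (cmeas_citg (iFN n)).
have cv : ccvg (fun N => cint mu (FN N))
   (oint (fun t => cw m t * cint cnt (RK b (circ t) 0))).
  apply: (@cint_dct _ _ R mu FN _ (fun t => chi t * (16 * 3 ^+ m * M))).
  - exact: mFN.
  - split.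
      apply: (@meas_lim _ mT R (fun N t => Re (FN N t))).
        by move=> N; exact: (mFN N).1.
      by move=> t; have /ccvgP[] := pc t.
    apply: (@meas_lim _ mT R (fun N t => Im (FN N t))).
      by move=> N; exact: (mFN N).2.
    by move=> t; have /ccvgP[] := pc t.
  - by apply: aeW => t; exact: pc.
  - move=> N t; rewrite /FN cabsM cabs_real.
    have /andP[c0 _] := chi01 t; rewrite (ger0_norm c0) ler_wpM2l //.
    have := ca_ge0 t; rewrite le_eqVlt => /predU1P[a0|a0].
      by rewrite cw_eq0 // mul0r cabs0 !mulr_ge0 // exprn_ge0.
    rewrite cabsM; have c1 := circ_gt1 a0.
    apply: le_trans (_ : (8 * 3 ^+ m * ca t) * (M * (cabs (circ t) - 1)^-1) <= _).
      by apply: ler_pM; rewrite ?cabs_ge0 // ?cabs_cw // RK0_partial_le.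
    rewrite mulrA ler_pdivrMr ?subr_gt0 //.
    rewrite (_ : 16 * 3 ^+ m * M * (cabs (circ t) - 1) =
      8 * 3 ^+ m * (2 * (cabs (circ t) - 1)) * M); last by ring.
    rewrite ler_wpM2r // ler_wpM2l ?mulr_ge0 ?exprn_ge0 //.
    (* [ca t = (|s| - 1)(|s| + 1) / 2], and |s| + 1 is at most 4. *)
    have := circ_sqr_ca t; have := circ_le3 t; nra.
  - by apply: itg_chi => t; exact: cvg_cst.
(* Only the indices m, m + 1, m + 2 contribute, so the integrals of the partial sums are constant
   from [m.+3] on. *)
apply: (ccvg_unique cv); apply: cvg_near_cst; exists m.+3 => // N mN.
change (cabs (cint mu (FN N) - (b m + 2 * b m.+1 + b m.+2)%:C * oint1 R) = 0).
apply/eqP; rewrite cabs_eq0 subr_eq0; apply/eqP.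
have {}mN : (m.+3 <= N)%N := mN.
have -> : cint mu (FN N) = \sum_(n < N) ((b n)%:C *
    ((n == m :> nat)%:R + 2 * (n == m.+1 :> nat)%:R + (n == m.+2 :> nat)%:R)) * oint1 R.
  rewrite FNE (@cint_sum _ _ R mu N (fun n t => (chi t)%:C * ((b n)%:C * (cw m t * (circ t)^-1 ^+ n.+1)))) //.
  apply: eq_bigr => n _; rewrite -mulrA -oint_cw_pow -ointZ //.
rewrite -mulr_suml; congr (_ * _).
have pick j : (j < N)%N -> \sum_(n < N) (b n)%:C * (n == j :> nat)%:R = (b j)%:C :> C.
  move=> jN; rewrite (bigD1 (Ordinal jN)) //= eqxx mulr1 big1 ?addr0 // => i ij.
  by move: ij; rewrite -val_eqE /= => /negbTE ->; rewrite mulr0.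
under eq_bigr do rewrite !mulrDr [_ * (2 * _)]mulrCA.
rewrite !big_split /= -mulr_sumr !pick; [|lia|lia|lia].
by rewrite !rmorphD rmorphM /= rmorph_nat.
Qed.

Lemma hardy_rec m : b m + 2 * b m.+1 + b m.+2 = 0.
Proof.
have e : oint (fun t => cw m t * cint mu (LK f (circ t) 0)) =
    oint (fun t => cw m t * cint cnt (RK b (circ t) 0)).
  apply: eq_oint => t; have := ca_ge0 t; rewrite le_eqVlt => /predU1P[a0|a0].
    by rewrite cw_eq0 // !mul0r.
  congr (_ * _); apply: (agree_domain bM phiE phiK); last exact: circ_gt1.
  by move: a0; rewrite /ca; lra.
move: e; rewrite oint_L oint_R => /esym/eqP.
rewrite mulf_eq0 (negbTE (oint1_neq0 R)) orbF fmorph_eq0.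
by move/eqP.
Qed.

(** For [c k = (-1)^k b_k] the recurrence says that second differences vanish. Hence [c] is an
    arithmetic progression, and boundedness forces its step [dl] to be 0. *)
Theorem hardy_sequence n : b n = (-1) ^+ n * b 0%N.
Proof.
pose c k : R := (-1) ^+ k * b k; pose dl : R := c 1%N - c 0%N.
have cS k : c k.+1 = c k + dl.
  elim: k => [|k IH]; first by rewrite /dl addrC subrK.
  have : c k.+2 - 2 * c k.+1 + c k = 0.
    rewrite /c !exprS; have := hardy_rec k => h.
    transitivity ((-1) ^+ k * (b k + 2 * b k.+1 + b k.+2)); first by ring.
    by rewrite h mulr0.
  by move: IH; lra.
have cE k : c k = c 0%N + k%:R * dl.
  elim: k => [|k IH]; first by rewrite mul0r addr0.
  by rewrite cS IH -natr1; ring.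
have cM k : `|c k| <= M by rewrite normrM normrX normrN1 expr1n mul1r.
have dl0 : dl = 0.
  apply/eqP; apply/negPn/negP => d0.
  have d1 : 0 < `|dl| by rewrite normr_gt0.
  have [k hk] : exists k : nat, 2 * M / `|dl| < k%:R.
    by exists (Num.truncn (2 * M / `|dl|)).+1; exact: truncnS_gt.
  have := cM k; have := cM 0%N; move: hk; rewrite ltr_pdivrMr // => hk h0 h1.
  have : `|k%:R * dl| <= 2 * M.
    have -> : k%:R * dl = c k - c 0%N by rewrite [c k]cE; ring.
    by apply: le_trans (ler_normB _ _) _; lra.
  by rewrite normrM normr_nat; lra.
have := cE n; rewrite dl0 mulr0 addr0 /c expr0 mul1r => e.
by rewrite -e mulrA -exprMn mulrNN mulr1 expr1n mul1r.
Qed.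

End HardySequence.

Section SequenceLimits.
Variable R : realType.
Implicit Types (u v : nat -> R) (l m B : R).

Lemma lim_uniq u v l m : u @ \oo --> l -> v @ \oo --> m ->
  (forall n, u n = v n) -> l = m.
Proof.
move=> ul vm /funext uv; rewrite uv in ul.
exact: (cvg_unique (@norm_hausdorff _ _) ul vm).
Qed.

Lemma lim_abs_le u l B : u @ \oo --> l -> (forall n, `|u n| <= B) -> `|l| <= B.
Proof.
move=> ul uB; have c : (fun n => `|u n|) @ \oo --> `|l| by exact: cvg_norm.
have e := cvg_lim (@norm_hausdorff _ R) c; rewrite -e; apply: limr_le.
  by apply/cvg_ex; exists `|l|.
exact: nearW.
Qed.

End SequenceLimits.

(** * Cosine and sine transforms through moments *)

Section HardyMoments.
Context d (T : measurableType d) (R : realType).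
Variable mu : {measure set T -> \bar R}.
Variables (X h : T -> R) (alpha C0 : R).
Hypothesis a0 : 0 < alpha.
Hypothesis mX : measurable_fun setT X.
Hypothesis mh : measurable_fun setT h.

(* Up to normalization, the moments of the Gaussian of parameter [alpha]. *)
Definition qmom n : R := (n.*2)`!%:R / (n`!%:R * (4 * alpha) ^+ n).

Hypothesis iexp : forall r, itg mu (fun t => expR (r * `|X t|) * `|h t|).
Hypothesis hmom : forall n, \int[mu]_t (X t ^+ n.*2 * `|h t|) <= C0 * qmom n.

Let aa0 : 0 < 4 * alpha. Proof. by rewrite mulr_gt0. Qed.

Lemma fact_neq0 n : n`!%:R != 0 :> R.
Proof. by rewrite pnatr_eq0 -lt0n fact_gt0. Qed.

Lemma fact_gt0R n : 0 < n`!%:R :> R.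
Proof. by rewrite ltr0n fact_gt0. Qed.

Lemma qmom_gt0 n : 0 < qmom n.
Proof. by rewrite divr_gt0 ?mulr_gt0 ?fact_gt0R ?exprn_gt0. Qed.

Lemma itg_mom n : itg mu (fun t => `|X t| ^+ n * `|h t|).
Proof.
apply: (itg_dom _ _ (itgZ n`!%:R (iexp 1))).
  apply: measurable_funM; first by apply: measurable_funX; exact: measurableT_comp.
  exact: measurableT_comp.
move=> t; rewrite normrM normrX !normr_id mulrA ler_wpM2r //.
have := exp_coeff_le n (normr_ge0 (X t)); rewrite /exp_coeff /= mul1r.
by rewrite ler_pdivrMr ?fact_gt0R // mulrC.
Qed.

Definition mom k : R := \int[mu]_t (X t ^+ k * h t).

Lemma itg_Xh k : itg mu (fun t => X t ^+ k * h t).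
Proof.
apply: itg_dom (itg_mom k); first by apply: measurable_funM => //; exact: measurable_funX.
by move=> t; rewrite normrM normrX.
Qed.

Lemma C0_ge0 : 0 <= C0.
Proof.
have := hmom 0; rewrite -(ler_pdivrMr _ _ (qmom_gt0 0)); apply: le_trans.
rewrite divr_ge0 ?(ltW (qmom_gt0 0)) //; apply: Rintegral_ge0 => t _.
by rewrite expr0 mul1r.
Qed.

Lemma abs_even k (x : R) : `|x| ^+ k.*2 = x ^+ k.*2.
Proof. by rewrite -mul2n !exprM real_normK // num_real. Qed.

Lemma mom_even_le n : `|mom n.*2| <= C0 * qmom n.
Proof.
apply: le_trans (hmom n); apply: le_trans (le_normr_Rintegral _ (itg_Xh _)) _ => //.
apply: le_Rintegral => //.
- exact: itg_abs (itg_Xh _).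
- by apply: itg_ext (itg_mom n.*2) => t; rewrite abs_even.
- by move=> t _; rewrite normrM normrX abs_even.
Qed.

(** An odd power is controlled by its even neighbours: |x|^(2n+1) <= x^(2n) + x^(2n+2). *)
Lemma mom_odd_le n : `|mom n.*2.+1| <= C0 * (qmom n + qmom n.+1).
Proof.
have i2 k : itg mu (fun t => X t ^+ k.*2 * `|h t|).
  by apply: itg_ext (itg_mom k.*2) => t; rewrite abs_even.
apply: le_trans (_ : \int[mu]_t (X t ^+ n.*2 * `|h t| + X t ^+ n.+1.*2 * `|h t|) <= _).
  apply: Rint_le_dom; [exact: itg_Xh|exact: itgD|] => t.
  rewrite normrM normrX -mulrDl ler_wpM2r //.
  rewrite -(abs_even n (X t)) -(abs_even n.+1 (X t)) doubleS.
  rewrite !exprS; have := exprn_ge0 n.*2 (normr_ge0 (X t)).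
  set u := _ ^+ n.*2; have := normr_ge0 (X t); move: (`|X t|) => y y0 u0.
  have -> : u + y * (y * u) = u * (1 + y * y) by ring.
  by rewrite mulrC ler_wpM2l //; nra.
by rewrite RintegralD // mulrDr lerD.
Qed.

(** Even and odd parts are kept side by side, so that one inequality dominates both the cosine and
    the sine series. *)
Lemma exp_coeff_even_le (y : R) N : 0 <= y ->
  \sum_(n < N) exp_coeff y n.*2 + \sum_(n < N) exp_coeff y n.*2.+1 <= expR y.
Proof.
move=> y0; apply: le_trans (exp_series_le N.*2 y0).
elim: N => [|N IH]; first by rewrite !big_ord0 addr0.
rewrite doubleS !big_ord_recr /=; move: IH.
move: (exp_coeff y N.*2) (exp_coeff y N.*2.+1) => u v; lra.
Qed.

Lemma Rint_lincomb N (c : nat -> R) (F : nat -> T -> R) :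
  (forall n, itg mu (F n)) ->
  itg mu (fun t => \sum_(n < N) c n * F n t) /\
  \int[mu]_t (\sum_(n < N) c n * F n t) = \sum_(n < N) c n * \int[mu]_t F n t.
Proof.
move=> iF; elim: N => [|N [i1 e1]].
  rewrite (_ : (fun t => _) = fun=> 0); last by apply/funext => t; rewrite big_ord0.
  by rewrite big_ord0 Rintegral_cst // mul0r; split => //; exact: integrable0.
rewrite (_ : (fun t => _) = fun t => \sum_(n < N) c n * F n t + c N * F N t); last first.
  by apply/funext => t; rewrite big_ord_recr.
split; first by apply: itgD => //; exact: itgZ.
rewrite RintegralD //; last exact: itgZ.
by rewrite e1 RintegralZl // big_ord_recr.
Qed.

(** The cosine series is integrated term by term; its partial sums are at most e^(|w| |X|), which is
    integrable against [|h|] by [iexp]. *)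
Lemma cvg_cos_transform w :
  (fun N => \sum_(n < N) (-1) ^+ n * w ^+ n.*2 / (n.*2)`!%:R * mom n.*2)
  @ \oo --> \int[mu]_t (h t * cos (w * X t)).
Proof.
pose FN N t := \sum_(n < N) (-1) ^+ n * w ^+ n.*2 / (n.*2)`!%:R * (X t ^+ n.*2 * h t).
have E : (fun N => \sum_(n < N) (-1) ^+ n * w ^+ n.*2 / (n.*2)`!%:R * mom n.*2) =
    (fun N => \int[mu]_t FN N t).
  apply/funext => N; rewrite /FN; symmetry.
  exact: (@Rint_lincomb N (fun n => (-1) ^+ n * w ^+ n.*2 / (n.*2)`!%:R)
    (fun n t => X t ^+ n.*2 * h t) (fun n => itg_Xh _)).2.
have EF N t : FN N t = h t * \sum_(n < N) cos_coeff' (w * X t) n.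
  rewrite mulr_sumr; apply: eq_bigr => n _; rewrite /cos_coeff' exprMn -exprnP.
  by field; exact: fact_neq0.
rewrite E; apply: (Rint_dct' (g := fun t => expR (`|w| * `|X t|) * `|h t|) _ _ _ _).2.
- move=> N; rewrite (_ : FN N = fun t => h t * \sum_(n < N) cos_coeff' (w * X t) n); last exact/funext.
  apply: measurable_funM => //; elim: N => [|N IH].
    by under eq_fun do rewrite big_ord0; exact: measurable_cst.
  under eq_fun do rewrite big_ord_recr /=; apply: measurable_funD => //.
  rewrite /cos_coeff'; do ! apply: measurable_funM; try exact: measurable_cst.
  by apply: measurable_funX; exact: measurable_funM.
- move=> t; under eq_fun do rewrite EF.
  apply: cvgM; first exact: cvg_cst.
  have := @cvg_cos_coeff' R (w * X t); rewrite (_ : series _ = fun N => \sum_(n < N) cos_coeff' (w * X t) n) //.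
  by apply/funext => N; exact: series_ordE.
- move=> N t; rewrite EF normrM mulrC ler_wpM2r //.
  apply: le_trans (ler_norm_sum _ _ _) _.
  rewrite -normrM; apply: le_trans (exp_coeff_even_le N (normr_ge0 _)).
  rewrite -[leLHS]addr0 lerD //; last by apply: sumr_ge0 => i _; exact: exp_coeff_ge0.
  apply: ler_sum => n _; rewrite /cos_coeff' /exp_coeff /= !normrM normfV normr_nat.
  by rewrite -exprnP normrX normrN1 expr1n mul1r normrX normrM.
- exact: iexp.
Qed.

Lemma cvg_sin_transform w :
  (fun N => \sum_(n < N) (-1) ^+ n * w ^+ n.*2.+1 / (n.*2.+1)`!%:R * mom n.*2.+1)
  @ \oo --> \int[mu]_t (h t * sin (w * X t)).
Proof.
pose FN N t := \sum_(n < N) (-1) ^+ n * w ^+ n.*2.+1 / (n.*2.+1)`!%:R * (X t ^+ n.*2.+1 * h t).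
have E : (fun N => \sum_(n < N) (-1) ^+ n * w ^+ n.*2.+1 / (n.*2.+1)`!%:R * mom n.*2.+1) =
    (fun N => \int[mu]_t FN N t).
  apply/funext => N; rewrite /FN; symmetry.
  exact: (@Rint_lincomb N (fun n => (-1) ^+ n * w ^+ n.*2.+1 / (n.*2.+1)`!%:R)
    (fun n t => X t ^+ n.*2.+1 * h t) (fun n => itg_Xh _)).2.
have EF N t : FN N t = h t * \sum_(n < N) sin_coeff' (w * X t) n.
  rewrite mulr_sumr; apply: eq_bigr => n _; rewrite /sin_coeff' exprMn -exprnP.
  by field; exact: fact_neq0.
rewrite E; apply: (Rint_dct' (g := fun t => expR (`|w| * `|X t|) * `|h t|) _ _ _ _).2.
- move=> N; rewrite (_ : FN N = fun t => h t * \sum_(n < N) sin_coeff' (w * X t) n); last exact/funext.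
  apply: measurable_funM => //; elim: N => [|N IH].
    by under eq_fun do rewrite big_ord0; exact: measurable_cst.
  under eq_fun do rewrite big_ord_recr /=; apply: measurable_funD => //.
  rewrite /sin_coeff'; do ! apply: measurable_funM; try exact: measurable_cst.
  by apply: measurable_funX; exact: measurable_funM.
- move=> t; under eq_fun do rewrite EF.
  apply: cvgM; first exact: cvg_cst.
  have := @cvg_sin_coeff' R (w * X t); rewrite (_ : series _ = fun N => \sum_(n < N) sin_coeff' (w * X t) n) //.
  by apply/funext => N; exact: series_ordE.
- move=> N t; rewrite EF normrM mulrC ler_wpM2r //.
  apply: le_trans (ler_norm_sum _ _ _) _.
  rewrite -normrM; apply: le_trans (exp_coeff_even_le N (normr_ge0 _)).
  rewrite -[leLHS]add0r lerD //; first by apply: sumr_ge0 => i _; exact: exp_coeff_ge0.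
  apply: ler_sum => n _; rewrite /sin_coeff' /exp_coeff /= !normrM normfV normr_nat.
  by rewrite -exprnP normrX normrN1 expr1n mul1r normrX normrM.
- exact: iexp.
Qed.

Section BoundedCoefficients.
Variables (b : nat -> R) (M : R).
Hypothesis bM : forall n, `|b n| <= M.

Definition bser x : R := limn (series (fun n => b n * exp_coeff x n)).

Lemma cvg_bser x : (fun N => \sum_(n < N) b n * exp_coeff x n) @ \oo --> bser x.
Proof.
under eq_fun do rewrite -(series_ordE (fun n => b n * exp_coeff x n)).
apply: normed_cvg; apply: (series_le_cvg (v_ := fun n => M * exp_coeff `|x| n)) => //.
- by move=> n /=; exact: normr_ge0.
- by move=> n; rewrite mulr_ge0 ?exp_coeff_ge0 // (le_trans _ (bM 0%N)).
- move=> n /=; rewrite normrM ler_pM // /exp_coeff /= normrM normrX.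
  by rewrite normfV normr_nat.
- rewrite (_ : (fun n => _) = M *: exp_coeff `|x|) //.
  by apply: is_cvg_seriesZ; exact: is_cvg_series_exp_coeff.
Qed.

Lemma bser_le x : 0 <= x -> `|bser x| <= M * expR x.
Proof.
move=> x0; apply: (lim_abs_le (@cvg_bser x)) => N.
apply: le_trans (ler_norm_sum _ _ _) _.
have M0 : 0 <= M by rewrite (le_trans _ (bM 0%N)).
apply: le_trans (_ : M * \sum_(n < N) exp_coeff x n <= _).
  rewrite mulr_sumr; apply: ler_sum => n _; rewrite normrM.
  by rewrite (ger0_norm (exp_coeff_ge0 _ x0)) ler_wpM2r ?exp_coeff_ge0.
by rewrite ler_wpM2l // exp_series_le.
Qed.

Lemma bser_hardy K : (forall x, 0 <= x -> `|bser x| <= K * expR (- x)) ->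
  forall x, bser x = b 0%N * expR (- x).
Proof.
move=> bK x; have bE := hardy_sequence bM (fun x => @cvg_bser x) bK.
have c : (fun N => b 0%N * \sum_(n < N) exp_coeff (- x) n) @ \oo --> b 0%N * expR (- x).
  by apply: cvgM; [exact: cvg_cst|exact: cvg_exp_series].
apply: (lim_uniq (@cvg_bser x) c) => N.
rewrite mulr_sumr; apply: eq_bigr => n _.
by rewrite (bE n) /exp_coeff /= [(- x) ^+ n]exprNn; ring.
Qed.

End BoundedCoefficients.

Lemma hardy_cos C' w :
  (forall w, `|\int[mu]_t (h t * cos (w * X t))| <= C' * expR (- (w ^+ 2 / (4 * alpha)))) ->
  \int[mu]_t (h t * cos (w * X t)) =
  \int[mu]_t h t * expR (- (w ^+ 2 / (4 * alpha))).
Proof.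
move=> hC; have aan : 4 * alpha != 0 by rewrite gt_eqF.
pose b n := (-1) ^+ n * mom n.*2 / qmom n.
have bM n : `|b n| <= C0.
  rewrite /b -mulrA normrM normrX normrN1 expr1n mul1r normrM normfV.
  rewrite (gtr0_norm (qmom_gt0 n)) ler_pdivrMr ?qmom_gt0 //; exact: mom_even_le.
have key v : bser b (v ^+ 2 / (4 * alpha)) = \int[mu]_t (h t * cos (v * X t)).
  apply: (lim_uniq (@cvg_bser b C0 bM _) (@cvg_cos_transform v)) => N.
  apply: eq_bigr => n _; rewrite /b /qmom /exp_coeff /= expr_div_n -exprM mul2n.
  by field; rewrite ?fact_neq0 ?expf_neq0.
have bK x : 0 <= x -> `|bser b x| <= C' * expR (- x).
  (* Every [x >= 0] is v^2 / (4 alpha) for v = sqrt(4 alpha x), so the bound on the transform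
     controls the series on the whole half-line. *)
  move=> x0; have e : x = Num.sqrt (x * (4 * alpha)) ^+ 2 / (4 * alpha).
    by rewrite sqr_sqrtr ?mulfK // mulr_ge0 // ltW.
  by rewrite e key; exact: hC.
rewrite -key (bser_hardy bM bK) /b expr0 mul1r /mom; congr (_ * _).
rewrite /qmom double0 fact0 expr0 mulr1 divr1 divr1.
by apply: eq_Rintegral => t _; rewrite expr0 mul1r.
Qed.

(** The sine transform is [w] times a series of the type already treated, hence a multiple of w
    e^(-w^2 / (4 alpha)). The extra factor [w] is incompatible with the assumed bound unless the
    multiple is 0. *)
Lemma hardy_sin C' w :
  (forall w, `|\int[mu]_t (h t * sin (w * X t))| <= C' * expR (- (w ^+ 2 / (4 * alpha)))) ->
  \int[mu]_t (h t * sin (w * X t)) = 0.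
Proof.
move=> hC; have aan : 4 * alpha != 0 by rewrite gt_eqF.
(* Chosen so that [v * bser b (v^2 / (4 alpha))] is the sine series at [v]. *)
pose b n := (-1) ^+ n * mom n.*2.+1 * n`!%:R * (4 * alpha) ^+ n / (n.*2.+1)`!%:R.
(* The bound [mom_odd_le] times n! (4 alpha)^n / (2n+1)! equals [C0] times 1 / (2n+1) + 1 / (2
   alpha). *)
pose M := C0 * (1 + (2 * alpha)^-1).
have bM n : `|b n| <= M.
  rewrite /b !normrM normrX normrN1 expr1n mul1r normfV !normr_nat.
  rewrite (gtr0_norm (exprn_gt0 n aa0)) ler_pdivrMr ?fact_gt0R //.
  apply: le_trans (_ : C0 * (qmom n + qmom n.+1) * n`!%:R * (4 * alpha) ^+ n <= _).
    rewrite ler_wpM2r ?exprn_ge0 ?(ltW aa0) // ler_wpM2r //; exact: mom_odd_le.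
  rewrite /M -!mulrA ler_wpM2l ?C0_ge0 //.
  have -> : (qmom n + qmom n.+1) * (n`!%:R * (4 * alpha) ^+ n) =
      (n.*2)`!%:R * (1 + (n.*2.+1)%:R / (2 * alpha)).
    rewrite /qmom doubleS !factS !natrM exprS.
    have -> : (n.*2.+2)%:R = 2 * n.+1%:R :> R by rewrite -natrM mul2n doubleS.
    have n1 : n.+1%:R != 0 :> R by rewrite pnatr_eq0.
    have a1 : alpha != 0 by rewrite gt_eqF.
    have := fact_neq0 n; have := fact_neq0 n.*2; have : (4 * alpha) ^+ n != 0.
      by rewrite expf_neq0.
    move: (n`!%:R) ((n.*2)`!%:R) (n.+1%:R) n1 (n.*2.+1%:R) (_ ^+ n) => u v k k0 j p p0 v0 u0.
    by field; rewrite p0 u0 k0 a1.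
  rewrite factS natrM mulrCA [leRHS]mulrA [in leRHS]mulrC.
  by rewrite ler_wpM2l // mulrDr mulr1 lerD // ler1n.
have key v : v * bser b (v ^+ 2 / (4 * alpha)) = \int[mu]_t (h t * sin (v * X t)).
  have c1 : (fun N => v * \sum_(n < N) b n * exp_coeff (v ^+ 2 / (4 * alpha)) n) @ \oo
      --> v * bser b (v ^+ 2 / (4 * alpha)).
    by apply: cvgM; [exact: cvg_cst|exact: (@cvg_bser b M bM)].
  apply: (lim_uniq c1 (@cvg_sin_transform v)) => N.
  rewrite mulr_sumr; apply: eq_bigr => n _.
  rewrite /b /exp_coeff /= expr_div_n -exprM mul2n [v ^+ n.*2.+1]exprS.
  by field; rewrite ?fact_neq0 ?expf_neq0.
pose w1 := Num.sqrt (4 * alpha).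
have w10 : 0 < w1 by rewrite sqrtr_gt0.
have M0 : 0 <= M by rewrite (le_trans _ (bM 0%N)).
have C'0 : 0 <= C'.
  have := hC 0; rewrite expr0n /= mul0r oppr0 expR0 mulr1; exact: le_trans.
(* For [x > 1] the frequency v = sqrt(4 alpha x) is at least [w1], so the hypothesis can be divided
   by it. For [x <= 1] the general bound M e^x is at most M e^2 e^(-x). *)
have bK x : 0 <= x -> `|bser b x| <= (C' / w1 + M * expR 2) * expR (- x).
  move=> x0; rewrite mulrDl; have [x1|x1] := leP x 1.
    apply: le_trans (bser_le bM x0) _; rewrite -[leLHS]add0r lerD //.
      by rewrite mulr_ge0 ?expR_ge0 // divr_ge0 // ltW.
    rewrite -mulrA -expRD ler_wpM2l // ler_expR; lra.
  have e : x = Num.sqrt (x * (4 * alpha)) ^+ 2 / (4 * alpha).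
    by rewrite sqr_sqrtr ?mulfK // mulr_ge0 // ltW.
  rewrite -[leLHS]addr0 lerD //; last exact: mulr_ge0 (mulr_ge0 M0 (expR_ge0 _)) (expR_ge0 _).
  have v0 : w1 <= Num.sqrt (x * (4 * alpha)).
    by apply: ler_wsqrtr; rewrite ler_peMl // ltW.
  have := hC (Num.sqrt (x * (4 * alpha))); rewrite -key -e normrM.
  rewrite ger0_norm ?sqrtr_ge0 // mulrAC ler_pdivlMr // mulrC => h1.
  by apply: le_trans h1; rewrite ler_wpM2l.
have SE v : \int[mu]_t (h t * sin (v * X t)) = v * (b 0%N * expR (- (v ^+ 2 / (4 * alpha)))).
  by rewrite -key (bser_hardy bM bK).
have b00 : b 0%N = 0.
  apply/eqP; apply/negPn/negP => bn.
  have bp : 0 < `|b 0%N| by rewrite normr_gt0.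
  (* At this frequency |w b_0| equals [C' + 1], which exceeds [C'] once the common Gaussian is
     cancelled. *)
  have := hC ((C' + 1) / `|b 0%N|); rewrite SE mulrA normrM (ger0_norm (expR_ge0 _)).
  rewrite ler_pM2r ?expR_gt0 // normrM normrM normfV normr_id divfK ?gt_eqF //.
  by rewrite ger0_norm; lra.
by rewrite SE b00 mul0r mulr0.
Qed.

End HardyMoments.

(** * Gaussians and product integrals *)

Section Gaussian.
Variable R : realType.
Local Notation mu := (@lebesgue_measure R).
Local Notation mT := (measurableTypeR R).
Implicit Types (a r w x : R).

Definition gs a (x : R) : R := expR (- a * x ^+ 2).

Lemma gs_gt0 a x : 0 < gs a x. Proof. exact: expR_gt0. Qed.

Lemma meas_gs a : measurable_fun setT (gs a).
Proof. rewrite /gs; mfun. Qed.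

(** The normal density of variance 1 / (2a) is proportional to [gs a]; integrability and positivity
    of the integral are read off from it. *)
Lemma gs_normal a : 0 < a -> exists2 s : R, s != 0 &
  gs a = fun x => (normal_peak s)^-1 * normal_pdf 0 s x.
Proof.
move=> a0; have s0 : 0 < (2 * a)^-1 by rewrite invr_gt0 mulr_gt0.
have sn0 : Num.sqrt (2 * a)^-1 != 0 by rewrite gt_eqF // sqrtr_gt0.
exists (Num.sqrt (2 * a)^-1) => //.
apply/funext => x; rewrite normal_pdfE // mulKf; last first.
  by rewrite gt_eqF // normal_peak_gt0.
rewrite /gs /normal_fun subr0 sqr_sqrtr ?(ltW s0) //.
congr expR; rewrite -mulr_natl; field; exact: lt0r_neq0.
Qed.

Lemma itg_gs a : 0 < a -> itg mu (gs a).
Proof.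
by move=> /gs_normal[s s0 ->]; apply: itgZ; exact: integrable_normal_pdf.
Qed.

Definition gint a : R := \int[mu]_x gs a x.

Lemma gint_gt0 a : 0 < a -> 0 < gint a.
Proof.
move=> /gs_normal[s s0 e]; rewrite /gint e RintegralZl //; last first.
  exact: integrable_normal_pdf.
by rewrite /Rintegral integral_normal_pdf /= mulr1 invr_gt0 normal_peak_gt0.
Qed.

(** The power is at most n! e^|x|, and completing the square absorbs all linear exponents at the
    price of half of [a]. *)
Lemma itg_gs_exp a n r : 0 < a ->
  itg mu (fun x => `|x| ^+ n * expR (r * `|x|) * gs a x).
Proof.
move=> a0; have a2 : 0 < a / 2 by rewrite divr_gt0.
apply: (@itg_dom _ _ R mu _ (fun x => n`!%:R * expR ((r + 1) ^+ 2 / (2 * a)) * gs (a / 2) x)).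
- apply: measurable_funM; last exact: meas_gs.
  apply: measurable_funM.
    by apply: measurable_funX; exact: normr_measurable.
  apply: (measurableT_comp (@measurable_expR R)).
  by apply: measurable_funM => //; exact: normr_measurable.
- move=> x; rewrite ger0_norm; last first.
    by rewrite !mulr_ge0 ?exprn_ge0 ?expR_ge0 // ltW // gs_gt0.
  apply: le_trans (_ : n`!%:R * expR `|x| * expR (r * `|x|) * gs a x <= _).
    rewrite ler_wpM2r ?(ltW (gs_gt0 _ _)) // ler_wpM2r ?expR_ge0 //.
    have := exp_coeff_le n (normr_ge0 x); rewrite /exp_coeff /=.
    by rewrite ler_pdivrMr ?fact_gt0R // mulrC.
  have key : expR `|x| * expR (r * `|x|) * gs a x <=
      expR ((r + 1) ^+ 2 / (2 * a)) * gs (a / 2) x.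
    rewrite /gs -!expRD ler_expR -(real_normK (num_real x)).
    move: (`|x|) => y; rewrite -subr_ge0.
    have -> : (r + 1) ^+ 2 / (2 * a) + - (a / 2) * y ^+ 2 -
       (y + r * y + - a * y ^+ 2) = (a * y - (r + 1)) ^+ 2 / (2 * a).
      by field; exact: lt0r_neq0.
    by rewrite divr_ge0 ?sqr_ge0 // mulr_ge0 // ltW.
  move: key; move: (gs a x) (gs (a / 2) x) (expR `|x|) (expR (r * `|x|)) (expR ((r + 1) ^+ 2 / (2 * a))) => u v p q t key.
  have -> : n`!%:R * p * q * u = n`!%:R * (p * q * u) by ring.
  by rewrite -[leRHS]mulrA ler_wpM2l.
- by apply: itgZ; exact: itg_gs.
Qed.

Lemma itg_gs_pow a n : 0 < a -> itg mu (fun x => x ^+ n * gs a x).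
Proof.
move=> a0; apply: (@itg_dom _ _ R mu _ _ _ _ (itg_gs_exp n 0 a0)).
  apply: measurable_funM; last exact: meas_gs.
  by apply: measurable_funX; exact: measurable_id.
move=> x; rewrite mul0r expR0 mulr1 normrM normrX (gtr0_norm (gs_gt0 _ _)) //.
Qed.

Lemma FTC_whole_line (F f : R -> R) : (forall x, is_derive x (1 : R) F (f x)) ->
  continuous f -> itg mu f ->
  (fun k => F k%:R) @ \oo --> (0 : R) -> (fun k => F (- k%:R)) @ \oo --> (0 : R) ->
  \int[mu]_x f x = 0.
Proof.
move=> dF cf itf F1 F2.
have cF : continuous F by exact: derive_continuous dF.
(* The bound [k.+1] keeps the interval nondegenerate, as the fundamental theorem of calculus
   requires. *)
pose fk k x := f x * \1_(`[- k.+1%:R, k.+1%:R]%classic) x.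
have fkE k : \int[mu]_x fk k x = F k.+1%:R - F (- k.+1%:R).
  have -> : fk k = f \_ `[- k.+1%:R, k.+1%:R].
    apply/funext => x; rewrite /fk indicE patchE.
    by case: (x \in _); rewrite ?mulr1 ?mulr0.
  have kk : - k.+1%:R < k.+1%:R :> R.
    by rewrite -subr_gt0 opprK addr_gt0 // ltr0n.
  rewrite -Rintegral_mkcond /Rintegral (@continuous_FTC2 _ f F) //.
  - exact: continuous_subspaceT.
  - split.
    + by move=> t _; apply: ex_derive; exact: dF.
    + by apply: cvg_at_right_filter; exact: cF.
    + by apply: cvg_at_left_filter; exact: cF.
  - by move=> t _; rewrite derive1E; apply: derive_val; exact: dF.
have c1 : (fun k => \int[mu]_x fk k x) @ \oo --> \int[mu]_x f x.
  apply: (@Rint_dct' _ _ R mu fk f (fun x => `|f x|) _ _ _ _).2.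
  - move=> k; apply: measurable_funM; first exact: itg_meas itf.
    by apply: measurable_indic; exact: measurable_itv.
  - move=> x; apply: cvg_near_cst; exists (Num.truncn `|x|).+1 => // k /= hk.
    rewrite /fk indicE mem_set ?mulr1 //= in_itv /= -ler_norml.
    apply: ltW; apply: lt_le_trans (truncnS_gt _) _.
    by rewrite ler_nat; exact: leqW.
  - move=> k x; rewrite /fk normrM indicE; case: (_ \in _).
      by rewrite normr1 mulr1.
    by rewrite normr0 mulr0.
  - exact: itg_abs.
have c2 : (fun k => F k.+1%:R - F (- k.+1%:R)) @ \oo --> (0 : R).
  rewrite -(subr0 0); apply: cvgB.
    by move: F1; rewrite -(cvg_shiftS (fun k => F k%:R)).
  by move: F2; rewrite -(cvg_shiftS (fun k => F (- k%:R))).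
exact: (lim_uniq c1 c2 fkE).
Qed.

Lemma is_derive_gs a x : is_derive x (1 : R) (gs a) (- (2 * a) * (x * gs a x)).
Proof.
rewrite /gs; eapply deq.
  eapply dexp; eapply dcmul; exact: dX.
by cbv beta; rewrite expr1; ring.
Qed.

Lemma gs_pow_derive a n x : is_derive x (1 : R) (fun x => x ^+ n.+1 * gs a x)
  (n.+1%:R * (x ^+ n * gs a x) - 2 * a * (x ^+ n.+2 * gs a x)).
Proof.
eapply deq; first by eapply dmul; [exact: dX|exact: is_derive_gs].
by cbv beta; rewrite !exprS; ring.
Qed.

(** The sign [e] covers both ends of the line at once. The power is at most n! e^k, and completing
    the square leaves a geometric sequence of ratio e^(-1). *)
Lemma gs_pow_cvg0 a n (e : R) : 0 < a -> `|e| = 1 ->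
  (fun k => (e * k%:R) ^+ n * gs a (e * k%:R)) @ \oo --> (0 : R).
Proof.
move=> a0 e1; have a20 : 0 < 2 * a by rewrite mulr_gt0.
apply: (@squeeze0 _ _ (fun k => n`!%:R * expR a^-1 * (expR (- 1)) ^+ k)).
  move=> k; rewrite normrM normrX normrM e1 mul1r normr_nat.
  rewrite (gtr0_norm (gs_gt0 _ _)) /gs exprMn -(real_normK (num_real e)) e1 expr1n mul1r.
  have k0 : 0 <= k%:R :> R by [].
  have := exp_coeff_le n k0; rewrite /exp_coeff /= ler_pdivrMr ?fact_gt0R // => h.
  apply: le_trans (_ : expR k%:R * n`!%:R * expR (- a * k%:R ^+ 2) <= _).
    by rewrite ler_wpM2r ?expR_ge0.
  rewrite -expRM_natl mulrN1.
  have key : expR k%:R * expR (- a * k%:R ^+ 2) <= expR a^-1 * expR (- k%:R).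
    rewrite -!expRD ler_expR; move: k0; move: (k%:R : R) => y y0; rewrite -subr_ge0.
    have -> : a^-1 + - y - (y + - a * y ^+ 2) = (a * y - 1) ^+ 2 / a.
      by field; exact: lt0r_neq0.
    by rewrite divr_ge0 ?sqr_ge0 // ltW.
  move: key; move: (expR k%:R) (expR (- a * k%:R ^+ 2)) (expR a^-1) (expR (- k%:R)) => p q t u key.
  have -> : p * n`!%:R * q = n`!%:R * (p * q) by ring.
  by rewrite -[leRHS]mulrA ler_wpM2l.
rewrite -[X in _ --> X](mulr0 (n`!%:R * expR a^-1)).
apply: cvgM; first exact: cvg_cst.
apply: cvg_expr; rewrite ger0_norm ?expR_ge0 // expRN invf_lt1 ?expR_gt0 //.
Qed.

Lemma cont_gs_pow a n : continuous (fun x : R => x ^+ n * gs a x).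
Proof.
case: n => [|n].
  apply: (@derive_continuous _ _ (fun x => - (2 * a) * (x * gs a x))) => x.
  rewrite (_ : (fun y => _) = gs a); first exact: is_derive_gs.
  by apply/funext => y; rewrite expr0 mul1r.
by apply: derive_continuous => x; exact: gs_pow_derive.
Qed.

Definition gmom a k : R := \int[mu]_x (x ^+ k * gs a x).

(** Integration by parts: the derivative of x^(k+1) e^(-a x^2) integrates to 0 over the line. *)
Lemma gmom_rec a k : 0 < a -> gmom a k.+2 = k.+1%:R / (2 * a) * gmom a k.
Proof.
move=> a0; have h : \int[mu]_x (k.+1%:R * (x ^+ k * gs a x) - 2 * a * (x ^+ k.+2 * gs a x)) = 0.
  apply: (FTC_whole_line (F := fun x => x ^+ k.+1 * gs a x)).
  - by move=> x; exact: gs_pow_derive.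
  - by move=> x; apply: cvgB; apply: cvgM; first [exact: cvg_cst|exact: cont_gs_pow].
  - by apply: itgB; apply: itgZ; exact: itg_gs_pow.
  - have := @gs_pow_cvg0 a k.+1 1 a0 (normr1 _).
    by under eq_fun do rewrite mul1r.
  - have := @gs_pow_cvg0 a k.+1 (-1) a0 (normrN1 _).
    by under eq_fun do rewrite mulN1r.
move: h; rewrite RintegralB //; [|exact: itgZ (itg_gs_pow _ a0)|exact: itgZ (itg_gs_pow _ a0)].
rewrite !RintegralZl //; [|exact: itg_gs_pow|exact: itg_gs_pow].
move=> /eqP; rewrite subr_eq0 => /eqP e.
have a1 : a != 0 by exact: lt0r_neq0.
rewrite /gmom; apply: (@mulfI _ (2 * a)); first by rewrite mulf_neq0.
by rewrite -e; field.
Qed.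

Lemma gmom1 a : 0 < a -> gmom a 1 = 0.
Proof.
move=> a0; have h : \int[mu]_x (- (2 * a) * (x ^+ 1 * gs a x)) = 0.
  apply: (FTC_whole_line (F := gs a)).
  - by move=> x; rewrite expr1; exact: is_derive_gs.
  - by move=> x; apply: cvgM; [exact: cvg_cst|exact: cont_gs_pow].
  - by apply: itgZ; exact: itg_gs_pow.
  - have := @gs_pow_cvg0 a 0 1 a0 (normr1 _).
    by under eq_fun do rewrite expr0 !mul1r.
  - have := @gs_pow_cvg0 a 0 (-1) a0 (normrN1 _).
    by under eq_fun do rewrite expr0 mul1r mulN1r.
move: h; rewrite RintegralZl //; last exact: itg_gs_pow.
move=> /eqP; rewrite mulf_eq0 oppr_eq0 mulf_eq0 pnatr_eq0 (gt_eqF a0) /=.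
by move/eqP.
Qed.

Lemma gmom_odd a k : 0 < a -> gmom a k.*2.+1 = 0.
Proof.
move=> a0; elim: k => [|k IH]; first exact: gmom1.
by rewrite doubleS gmom_rec // IH mulr0.
Qed.

Lemma gmom_even a k : 0 < a -> gmom a k.*2 = qmom a k * gint a.
Proof.
move=> a0; elim: k => [|k IH].
  rewrite /qmom double0 fact0 expr0 mulr1 divr1 mul1r.
  by apply: eq_Rintegral => x _; rewrite expr0 mul1r.
rewrite doubleS gmom_rec // IH mulrA; congr (_ * _).
rewrite /qmom doubleS !factS !natrM exprS.
have -> : (k.*2.+2)%:R = 2 * k.+1%:R :> R by rewrite -natrM mul2n doubleS.
have p0 : (4 * a) ^+ k != 0 by rewrite expf_neq0 // mulf_neq0 // lt0r_neq0.
have n1 : k.+1%:R != 0 :> R by rewrite pnatr_eq0.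
have a1 : a != 0 by exact: lt0r_neq0.
have v0 := fact_neq0 R k.
move: (k`!%:R) ((k.*2)`!%:R) (k.+1%:R) n1 (k.*2.+1%:R) (_ ^+ k) p0 v0 => u v m m0 j p p0 u0.
by field; rewrite p0 u0 m0 a1.
Qed.

Lemma gs_iexp a r : 0 < a -> itg mu (fun t => expR (r * `|t|) * `|gs a t|).
Proof.
move=> a0; apply: itg_ext (itg_gs_exp 0 r a0) => x.
by rewrite expr0 mul1r (gtr0_norm (gs_gt0 _ _)).
Qed.

(** Inserted into the cosine series, the even moments of the Gaussian cancel the factors (2n)! and
    leave the exponential series of -w^2 / (4a). *)
Lemma gs_cos a w : 0 < a ->
  \int[mu]_x (gs a x * cos (w * x)) = gint a * gs (4 * a)^-1 w.
Proof.
move=> a0; have c := @cvg_cos_transform _ mT R mu id (gs a) (@measurable_id _ _ _) (meas_gs a) (fun r => gs_iexp r a0) w.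
have c2 : (fun N => gint a * \sum_(n < N) exp_coeff (- (4 * a)^-1 * w ^+ 2) n) @ \oo
   --> gint a * gs (4 * a)^-1 w.
  by apply: cvgM; [exact: cvg_cst|exact: cvg_exp_series].
apply: (lim_uniq c c2) => N; rewrite mulr_sumr; apply: eq_bigr => n _.
have -> : mom mu id (gs a) n.*2 = gmom a n.*2 by [].
have -> : exp_coeff (- (4 * a)^-1 * w ^+ 2) n =
    (-1) ^+ n * ((4 * a) ^+ n)^-1 * w ^+ n.*2 / n`!%:R.
  have -> : - (4 * a)^-1 * w ^+ 2 = -1 * ((4 * a)^-1 * w ^+ 2) by ring.
  by rewrite /exp_coeff /= exprMn [(_ * w ^+ 2) ^+ n]exprMn exprVn -exprM mul2n mulrA.
rewrite gmom_even // /qmom.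
have v0 := fact_neq0 R n; have u0 := fact_neq0 R n.*2.
have p0 : (4 * a) ^+ n != 0 by rewrite expf_neq0 // mulf_neq0 // lt0r_neq0.
move: (n`!%:R) ((n.*2)`!%:R) (_ ^+ n) (w ^+ _) p0 v0 u0 => u v p q p0 v0 u0.
by field; rewrite p0 v0 u0.
Qed.

Lemma gs_sin a w : 0 < a -> \int[mu]_x (gs a x * sin (w * x)) = 0.
Proof.
move=> a0; have c := @cvg_sin_transform _ mT R mu id (gs a) (@measurable_id _ _ _) (meas_gs a) (fun r => gs_iexp r a0) w.
have c2 : (fun N : nat => 0 : R) @ \oo --> (0 : R) by exact: cvg_cst.
apply: (lim_uniq c c2) => N; apply: big1 => n _.
have -> : mom mu id (gs a) n.*2.+1 = gmom a n.*2.+1 by [].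
by rewrite gmom_odd // mulr0.
Qed.

End Gaussian.

(** * Integrals of products of one-variable functions *)

Section ProductIntegral.
Variable R : realType.
Local Notation mu := (@lebesgue_measure R).
Local Notation mT := (measurableTypeR R).

Lemma meas_fst2 (F : mT -> R) : measurable_fun setT F ->
  measurable_fun setT (fun z : mT * mT => F z.1).
Proof. by move=> m; exact: (measurableT_comp m (@measurable_fst _ _ mT mT)). Qed.

Lemma meas_snd2 (F : mT -> R) : measurable_fun setT F ->
  measurable_fun setT (fun z : mT * mT => F z.2).
Proof. by move=> m; exact: (measurableT_comp m (@measurable_snd _ _ mT mT)). Qed.

Lemma itg_prod (F G : mT -> R) : itg mu F -> itg mu G ->
  itg (leb2 R) (fun z => F z.1 * G z.2).
Proof.
move=> iF iG; have mF := itg_meas iF; have mG := itg_meas iG.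
apply/integrable12ltyP.
  apply/measurable_EFinP; apply: measurable_funM; first exact: meas_fst2.
  exact: meas_snd2.
have e x : (\int[mu]_y `|(F x * G y)%:E| = (`|F x| * \int[mu]_y `|G y|)%:E)%E.
  rewrite EFinM /Rintegral fineK; last first.
    exact: (integrable_fin_num measurableT (itg_abs iG)).
  rewrite -ge0_integralZl //.
  - by apply: eq_integral => y _; rewrite /= -EFinM normrM.
  - by apply/measurable_EFinP; exact: measurableT_comp.
under eq_integral do rewrite /= e.
under eq_integral do rewrite EFinM muleC.
rewrite ge0_integralZl //.
- apply: lte_mul_pinfty => //.
  + by rewrite lee_fin; apply: Rintegral_ge0.
  + by have /integrableP[_] := iF.
- by apply/measurable_EFinP; exact: measurableT_comp.
- by rewrite lee_fin; apply: Rintegral_ge0.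
Qed.

Lemma Rint_prod (F G : mT -> R) : itg mu F -> itg mu G ->
  \int[leb2 R]_z (F z.1 * G z.2) = (\int[mu]_x F x) * (\int[mu]_y G y).
Proof.
move=> iF iG; have := integral12_prod_meas1 (itg_prod iF iG).
rewrite /fubini_F => e; rewrite /Rintegral -e /=.
have e2 x : (\int[mu]_y (F x * G y)%:E = (\int[mu]_y G y)%:E * (F x)%:E)%E.
  rewrite /Rintegral fineK; last exact: (integrable_fin_num measurableT iG).
  transitivity (\int[mu]_y ((F x)%:E * (G y)%:E))%E.
    by apply: eq_integral => y _; rewrite EFinM.
  by rewrite integralZl // muleC.
under eq_integral do rewrite e2.
rewrite integralZl //.
rewrite -[X in (_ * X)%E]fineK; last exact: (integrable_fin_num measurableT iF).
by rewrite /= mulrC.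
Qed.

End ProductIntegral.

(** * Trigonometric transforms determine integrable functions *)

Section Threshold.
Variable R : realType.
Implicit Types (y z : R).

(* Steep polynomials: for 0 <= y <= 1 they converge to the indicator of
   [y < 1/2] (Bernoulli's inequality below 1/2, [1 - z <= e^-z] above). *)
Definition steep n y : R := (1 - y ^+ n) ^+ (n * 2 ^ n).

Lemma bernoulli m z : 0 <= z <= 1 -> 1 - m%:R * z <= (1 - z) ^+ m.
Proof.
move=> /andP[z0 z1]; elim: m => [|m IH]; first by rewrite mul0r subr0 expr0.
rewrite exprS; apply: le_trans (_ : (1 - z) * (1 - m%:R * z) <= _); last first.
  by rewrite ler_wpM2l // subr_ge0.
rewrite -natr1 -subr_ge0.
have -> : (1 - z) * (1 - m%:R * z) - (1 - (m%:R + 1) * z) = m%:R * z ^+ 2 by ring.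
by rewrite mulr_ge0 // sqr_ge0.
Qed.

Lemma steep01 n y : 0 <= y <= 1 -> 0 <= steep n y <= 1.
Proof.
move=> /andP[y0 y1]; have yn : 0 <= y ^+ n <= 1.
  by rewrite exprn_ge0 // exprn_ile1.
by rewrite /steep exprn_ge0 ?exprn_ile1 //; lra.
Qed.

Lemma cvg_steep y : 0 <= y <= 1 ->
  (fun n => steep n y) @ \oo --> ((y < 2^-1)%R%:R : R).
Proof.
move=> y01; have /andP[y0 y1] := y01.
have [yh|yh] := ltP y 2^-1.
  (* By Bernoulli [1 - steep n y] is at most n (2y)^n, and 2y < 1; the binomial, equal to n + 1,
     puts this in the form of [negbin_term_cvg]. *)
  apply/subr_cvg0; apply: (@squeeze0 _ _ (fun n => 'C(1 + n, 1)%:R * (2 * y) ^+ n)).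
    move=> n; have /andP[s0 s1] := steep01 n y01.
    rewrite ler0_norm ?subr_le0 // opprB bin1 add1n.
    have yn : 0 <= y ^+ n <= 1 by rewrite exprn_ge0 // exprn_ile1.
    have := bernoulli (n * 2 ^ n) yn; rewrite -/(steep n y) => h.
    apply: le_trans (_ : (n * 2 ^ n)%:R * y ^+ n <= _).
      by rewrite lerBlDl -lerBlDr.
    rewrite natrM natrX -mulrA -exprMn ler_wpM2r ?exprn_ge0 ?mulr_ge0 //.
    by rewrite ler_nat.
  by apply: negbin_term_cvg; rewrite mulr_ge0 //=; lra.
(* Here [steep n y] is at most e^(-n (2y)^n), and 2y >= 1. *)
apply: (@squeeze0 _ _ (fun n => expR (- 1) ^+ n)).
  move=> n; have /andP[s0 s1] := steep01 n y01; rewrite ger0_norm //.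
  have yn : 0 <= y ^+ n <= 1 by rewrite exprn_ge0 // exprn_ile1.
  apply: le_trans (_ : expR (- y ^+ n) ^+ (n * 2 ^ n) <= _).
    rewrite lerXn2r ?nnegrE ?expR_ge0 //; first by lra.
    exact: expR_ge1Dx.
  rewrite -!expRM_natl ler_expR mulrN mulrN1 lerN2 natrM natrX -mulrA -exprMn.
  rewrite ler_peMr // exprn_ege1 //; lra.
apply: cvg_expr; rewrite ger0_norm ?expR_ge0 // expRN invf_lt1 ?expR_gt0 //.
Qed.

End Threshold.

Section TrigonometricUniqueness.
Context d (T : measurableType d) (R : realType).
Variable mu : {measure set T -> \bar R}.
Variables (X h : T -> R).
Hypothesis mX : measurable_fun setT X.
Hypothesis ih : itg mu h.

(** Asking for all sine factors, and not only that [h * u] have integral 0, makes the class stable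
    under multiplication by sines. It therefore contains every polynomial in a single wave. *)
Definition annihilated (u : T -> R) := [/\ measurable_fun setT u,
  exists B : R, forall t, `|u t| <= B &
  forall a c : R, \int[mu]_t (h t * (u t * sin (a * X t + c))) = 0].

Lemma meas_sinX (a c : R) : measurable_fun setT (fun t => sin (a * X t + c)).
Proof. by mfun. Qed.

Lemma sin_le1 (x : R) : `|sin x| <= 1.
Proof. by rewrite ler_norml sin_geN1 sin_le1. Qed.

Lemma itg_bounded (u : T -> R) (B : R) : measurable_fun setT u -> (forall t, `|u t| <= B) ->
  itg mu (fun t => h t * u t).
Proof.
move=> mu' uB; apply: (itg_dom _ _ (itgZ B (itg_abs ih))).
  by apply: measurable_funM => //; exact: itg_meas ih.
by move=> t; rewrite normrM mulrC ler_wpM2r.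
Qed.

Lemma annihilated_itg u (a c : R) : annihilated u ->
  itg mu (fun t => h t * (u t * sin (a * X t + c))).
Proof.
case=> m [B uB] _; apply: (@itg_bounded _ (B * 1)).
  by apply: measurable_funM => //; exact: meas_sinX.
by move=> t; rewrite normrM ler_pM // sin_le1.
Qed.

Lemma annihilated_int u : annihilated u -> \int[mu]_t (h t * u t) = 0.
Proof.
(* Frequency 0 and phase [pi / 2] turn the sine into the constant 1. *)
case=> _ _ /(_ 0 (pi / 2)) e; rewrite -[RHS]e; apply: eq_Rintegral => t _.
by rewrite mul0r add0r sin_pihalf mulr1.
Qed.

Lemma annihilatedD u v : annihilated u -> annihilated v ->
  annihilated (fun t => u t + v t).
Proof.
move=> au av; have [m [B uB] e] := au; have [m' [B' vB] e'] := av; split.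
- exact: measurable_funD.
- by exists (B + B') => t; apply: le_trans (ler_normD _ _) _; exact: lerD.
- move=> a c; rewrite -[RHS](addr0 0) -[X in _ = X + _](e a c) -[X in _ = _ + X](e' a c).
  rewrite -RintegralD //; [|exact: annihilated_itg|exact: annihilated_itg].
  by apply: eq_Rintegral => t _; rewrite mulrDl mulrDr.
Qed.

Lemma annihilatedZ (k : R) u : annihilated u -> annihilated (fun t => k * u t).
Proof.
move=> au; have [m [B uB] e] := au; split.
- exact: measurable_funM.
- by exists (`|k| * B) => t; rewrite normrM ler_wpM2l.
- move=> a c; rewrite -[RHS](mulr0 k) -[X in _ = _ * X](e a c).
  rewrite -RintegralZl //; last exact: annihilated_itg.
  by apply: eq_Rintegral => t _; ring.
Qed.

Lemma annihilated_sin u (w b : R) : annihilated u ->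
  annihilated (fun t => u t * sin (w * X t + b)).
Proof.
move=> au; have [m [B uB] e] := au; split.
- by apply: measurable_funM => //; exact: meas_sinX.
- by exists (B * 1) => t; rewrite normrM ler_pM // sin_le1.
- move=> a c.
  (* sin p sin q = (cos(p - q) - cos(p + q)) / 2, with cosines written as sines shifted by
     [pi / 2]. *)
  have E t : h t * (u t * sin (w * X t + b) * sin (a * X t + c)) =
     2^-1 * (h t * (u t * sin ((w - a) * X t + (b - c + pi / 2)))) +
     (- 2^-1) * (h t * (u t * sin ((w + a) * X t + (b + c + pi / 2)))).
    rewrite !addrA !sinDpihalf.
    have -> : (w - a) * X t + b - c = (w * X t + b) - (a * X t + c) by ring.
    have -> : (w + a) * X t + b + c = (w * X t + b) + (a * X t + c) by ring.
    move: (w * X t + b) (a * X t + c) => p q.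
    by rewrite cosB cosD; field.
  under eq_Rintegral do rewrite E.
  rewrite RintegralD //; [|exact: itgZ (annihilated_itg _ _ au)|exact: itgZ (annihilated_itg _ _ au)].
  rewrite !RintegralZl //; [|exact: annihilated_itg|exact: annihilated_itg].
  by rewrite !e !mulr0 addr0.
Qed.

Hypothesis h_sin : forall a c : R, \int[mu]_t (h t * sin (a * X t + c)) = 0.

Lemma annihilated1 : annihilated (fun=> 1).
Proof.
split; first exact: measurable_cst.
  by exists 1 => t; rewrite normr1.
by move=> a c; under eq_Rintegral do rewrite mul1r; exact: h_sin.
Qed.

Section Wave.
Variables w b : R.
(** A sine rescaled to [0, 1], the domain of [steep]; lying below 1/2 means that the sine is
    negative. *)
Definition wave t : R := (1 + sin (w * X t + b)) / 2.

Lemma wave01 t : 0 <= wave t <= 1.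
Proof.
have := sin_geN1 (w * X t + b); have := trigo.sin_le1 (w * X t + b).
by rewrite /wave; lra.
Qed.

Lemma annihilated_ext u v : (forall t, u t = v t) -> annihilated u -> annihilated v.
Proof. by move=> /funext ->. Qed.

Lemma annihilated_wave u : annihilated u -> annihilated (fun t => u t * wave t).
Proof.
move=> au; apply: (annihilated_ext (u := fun t => 2^-1 * u t + 2^-1 * (u t * sin (w * X t + b)))).
  by move=> t; rewrite /wave; field.
by apply: annihilatedD; apply: annihilatedZ => //; exact: annihilated_sin.
Qed.

Lemma annihilated_waveX n u : annihilated u ->
  annihilated (fun t => u t * wave t ^+ n).
Proof.
elim: n u => [|n IH] u au.
  by apply: annihilated_ext au => t; rewrite expr0 mulr1.
by apply: annihilated_ext (IH _ (annihilated_wave au)) => t; rewrite exprS mulrA.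
Qed.

Lemma annihilated_steep n : annihilated (fun t => steep n (wave t)).
Proof.
rewrite /steep; elim: (n * 2 ^ n)%N => [|m IH].
  by apply: annihilated_ext annihilated1 => t; rewrite expr0.
apply: (annihilated_ext (u := fun t => (1 - wave t ^+ n) ^+ m + -1 * ((1 - wave t ^+ n) ^+ m * wave t ^+ n))).
  by move=> t; rewrite exprS; ring.
by apply: annihilatedD => //; apply: annihilatedZ; exact: annihilated_waveX.
Qed.

Lemma int_wave : \int[mu]_t (h t * ((wave t < 2^-1)%R%:R : R)) = 0.
Proof.
have c := (@Rint_dct' _ _ _ mu (fun n t => h t * steep n (wave t))
  (fun t => h t * ((wave t < 2^-1)%R%:R : R)) (fun t => `|h t|) _ _ _ (itg_abs ih)).
have {c} [||| _ c] := c.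
- move=> n; apply: measurable_funM; first exact: itg_meas ih.
  by have [] := annihilated_steep n.
- by move=> t; apply: cvgM; [exact: cvg_cst|apply: cvg_steep; exact: wave01].
- move=> n t; rewrite normrM ler_piMr //.
  by have /andP[s0 s1] := steep01 n (wave01 t); rewrite ger0_norm.
have c0 : (fun _ : nat => 0 : R) @ \oo --> (0 : R) by exact: cvg_cst.
apply: (lim_uniq c c0) => n; exact: annihilated_int (annihilated_steep n).
Qed.

End Wave.

(** A wave of frequency 1 / (k + 1) centred at [a] has argument of modulus below 1 on the window,
    and there the sine has the sign of its argument. *)
Lemma wave_lt k (a : R) t : `|X t - a| < k.+1%:R ->
  (wave k.+1%:R^-1 (- (k.+1%:R^-1 * a)) t < 2^-1) = (X t < a).
Proof.
move=> hk; rewrite /wave; set s := _ * X t + _.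
have k0 : 0 < k.+1%:R :> R by rewrite ltr0n.
have es : s = k.+1%:R^-1 * (X t - a) by rewrite /s mulrBr.
have s1 : `|s| < 1.
  by rewrite es normrM normfV normr_nat mulrC ltr_pdivrMr // mul1r.
have p2 : 1 < pi :> R by have := pi_ge2 R; lra.
have -> : ((1 + sin s) / 2 < 2^-1) = (sin s < 0).
  by apply/idP/idP => ?; lra.
have -> : (X t < a) = (s < 0).
  by rewrite es pmulr_rlt0 ?invr_gt0 // subr_lt0.
move: s1; rewrite ltr_norml => /andP[sa sb].
have [s0|s0|s0] := ltgtP s 0.
- have : 0 < sin (- s) by apply: sin_gt0_pi; apply/andP; split; lra.
  by rewrite sinN oppr_gt0.
- apply/negbTE; rewrite -leNgt; apply/ltW/sin_gt0_pi.
  by apply/andP; split; lra.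
- by rewrite s0 sin0 ltxx.
Qed.

(** As the waves slow down, their windows around [a] exhaust the line, so the indicators of their
    negative parts converge to the indicator of the ray. *)
Lemma int_ray (a : R) : \int[mu]_t (h t * \1_(X @^-1` `]-oo, a[%classic) t) = 0.
Proof.
pose wv k t : R := (wave k.+1%:R^-1 (- (k.+1%:R^-1 * a)) t < 2^-1)%R%:R.
have c := (@Rint_dct' _ _ _ mu (fun k t => h t * wv k t)
  (fun t => h t * \1_(X @^-1` `]-oo, a[%classic) t) (fun t => `|h t|) _ _ _ (itg_abs ih)).
have {c} [||| _ c] := c.
- move=> k; apply: measurable_funM; first exact: itg_meas ih.
  apply: (meas_lim (f_ := fun n t => steep n (wave k.+1%:R^-1 (- (k.+1%:R^-1 * a)) t))).
    by move=> n; have [] := annihilated_steep k.+1%:R^-1 (- (k.+1%:R^-1 * a)) n.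
  by move=> t; apply: cvg_steep; exact: wave01.
- move=> t; apply: cvgM; first exact: cvg_cst.
  apply: cvg_near_cst; exists (Num.truncn `|X t - a|).+1 => // k /= hk.
  rewrite /wv wave_lt; last first.
    by apply: lt_le_trans (truncnS_gt _) _; rewrite ler_nat; exact: leqW.
  rewrite indicE; congr (_%:R); congr nat_of_bool.
  apply/idP/idP => [xa|/set_mem]; first by apply/mem_set; rewrite /= in_itv.
  by rewrite /= in_itv.
- move=> k t; rewrite normrM ler_piMr // /wv.
  by case: (_ < _); rewrite ?normr1 ?normr0.
have c0 : (fun _ : nat => 0 : R) @ \oo --> (0 : R) by exact: cvg_cst.
apply: (lim_uniq c c0) => k; exact: int_wave.
Qed.

End TrigonometricUniqueness.

(** * From generating sets to generated sigma-algebras *)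

Section PiLambda.
Context d (T : measurableType d) (R : realType).
Variable mu : {measure set T -> \bar R}.
Variable h : T -> R.
Hypothesis ih : itg mu h.

Lemma itg_indic (A : set T) : measurable A -> itg mu (fun t => h t * \1_A t).
Proof.
move=> mA; apply: (itg_bounded (B := 1) ih).
  exact: measurable_indic.
by move=> t; rewrite indicE; case: (_ \in _); rewrite ?normr1 ?normr0.
Qed.

(** The sets over whose preimage [h] integrates to 0 form a lambda-system: differences by linearity,
    increasing unions by dominated convergence. The map [Y] allows both coordinate projections and
    the identity. *)
Lemma pi_lambda_int d' (S : measurableType d') (Y : T -> S) (G : set (set S)) :
  measurable_fun setT Y -> setI_closed G -> G `<=` measurable ->
  \int[mu]_t h t = 0 ->
  (forall A, G A -> \int[mu]_t (h t * \1_(Y @^-1` A) t) = 0) ->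
  forall A, <<s G >> A -> \int[mu]_t (h t * \1_(Y @^-1` A) t) = 0.
Proof.
move=> mY GI Gm h0 hG.
pose H := [set A : set S | measurable A /\ \int[mu]_t (h t * \1_(Y @^-1` A) t) = 0].
have mYA A : measurable A -> measurable (Y @^-1` A).
  by move=> mA; rewrite -[X in measurable X]setTI; exact: mY.
suff GH : <<s G >> `<=` H by move=> A /GH[].
apply: lambda_system_subset => //; last first.
  by move=> A GA; split; [exact: Gm|exact: hG].
split => //.
- split; first exact: measurableT.
  rewrite -[RHS]h0; apply: eq_Rintegral => t _.
  by rewrite indicE mem_set // mulr1.
- move=> A B BA [mA hA] [mB hB]; split; first exact: measurableD.
  rewrite -[RHS](subr0 0) -[X in _ = X - _]hA -[X in _ = _ - X]hB.
  rewrite -RintegralB //; [|exact: itg_indic (mYA _ mA)|exact: itg_indic (mYA _ mB)].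
  apply: eq_Rintegral => t _; rewrite -mulrBr !indicE; congr (_ * _).
  have [tB|tB] := pselect ((Y @^-1` B) t).
    rewrite (mem_set tB) (mem_set (BA _ tB : (Y @^-1` A) t)) subrr memNset //=.
    by case=> _; apply.
  rewrite (memNset tB) subr0.
  have [tA|tA] := pselect ((Y @^-1` A) t).
    by rewrite (mem_set tA) mem_set.
  by rewrite (memNset tA) memNset //= => -[].
- move=> F ndF HF; split; first by apply: bigcupT_measurable => i; have [] := HF i.
  have c := (@Rint_dct' _ _ _ mu (fun k t => h t * \1_(Y @^-1` F k) t)
    (fun t => h t * \1_(Y @^-1` \bigcup_i F i) t) (fun t => `|h t|) _ _ _ (itg_abs ih)).
  have {c} [||| _ c] := c.
  + move=> k; apply: itg_meas; apply: itg_indic; apply: mYA; by have [] := HF k.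
  + move=> t; apply: cvgM; first exact: cvg_cst.
    have [[i _ Fi]|nF] := pselect ((\bigcup_i F i) (Y t)).
      apply: cvg_near_cst; exists i => // k /= ik.
      rewrite !indicE !mem_set //; first by exists i.
      by have /subsetPset := ndF _ _ ik; apply.
    apply: cvg_near_cst; apply: nearW => k.
    by rewrite !indicE !memNset // => Fk; apply: nF; exists k.
  + move=> k t; rewrite normrM ler_piMr // indicE.
    by case: (_ \in _); rewrite ?normr1 ?normr0.
  have c0 : (fun _ : nat => 0 : R) @ \oo --> (0 : R) by exact: cvg_cst.
  by apply: (lim_uniq c c0) => k; have [] := HF k.
Qed.

End PiLambda.

Section TrigonometricUniqueness2.
Variable R : realType.
Local Notation mT := (measurableTypeR R).

Lemma int_borel d (T : measurableType d) (mu : {measure set T -> \bar R})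
    (X h : T -> R) (A : set mT) :
  @measurable_fun _ _ T mT setT X -> itg mu h ->
  (forall a c : R, \int[mu]_t (h t * sin (a * X t + c)) = 0) ->
  measurable A -> \int[mu]_t (h t * \1_(X @^-1` A) t) = 0.
Proof.
move=> mX ih hs mA.
have H := @pi_lambda_int _ T R mu h ih _ mT X (@RGenInftyO.G R) mX.
apply: H => //.
- move=> _ _ [x ->] [y ->]; exists (Num.min x y); apply/seteqP; split => z /=.
    by rewrite !in_itv /= lt_min => -[-> ->].
  by rewrite !in_itv /= lt_min => /andP[].
- by move=> _ [x ->]; exact: measurable_itv.
- rewrite -[RHS](hs 0 (pi / 2)); apply: eq_Rintegral => t _.
  by rewrite mul0r add0r sin_pihalf mulr1.
- by move=> _ [x ->]; exact: int_ray.
- have : (@RGenInftyO.G R).-sigma.-measurable A by rewrite -RGenInftyO.measurableE.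
  by [].
Qed.

(** The sine in the first coordinate is traded for the indicator of a Borel set while the second is
    held fixed, then the roles are exchanged. The integral of [g] thus vanishes over rectangles, and
    these generate the product sigma-algebra. *)
Lemma trig_uniqueness2 (g : mT * mT -> R) : itg (leb2 R) g ->
  (forall a c b e : R,
    \int[leb2 R]_z (g z * sin (a * z.1 + c) * sin (b * z.2 + e)) = 0) ->
  {ae leb2 R, forall z, g z = 0}.
Proof.
move=> ig hg.
have m1 : measurable_fun setT (fst : mT * mT -> mT) := measurable_fst.
have m2 : measurable_fun setT (snd : mT * mT -> mT) := measurable_snd.
have is2 b e : itg (leb2 R) (fun z => g z * sin (b * z.2 + e)).
  apply: (itg_bounded (B := 1) ig); first exact: (meas_sinX m2).
  by move=> z; exact: sin_le1.
have step1 (A : set mT) b e : measurable A ->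
    \int[leb2 R]_z (g z * sin (b * z.2 + e) * \1_(fst @^-1` A) z) = 0.
  move=> mA; apply: (int_borel m1 (is2 b e)) => // a c.
  rewrite -[RHS](hg a c b e); apply: eq_Rintegral => z _; ring.
have mfA (A : set mT) : measurable A -> measurable (fst @^-1` A : set (mT * mT)).
  by move=> mA; rewrite -[X in measurable X]setTI; exact: m1.
have step2 (A B : set mT) : measurable A -> measurable B ->
    \int[leb2 R]_z (g z * \1_(fst @^-1` A) z * \1_(snd @^-1` B) z) = 0.
  move=> mA mB; apply: (int_borel m2 (itg_indic ig (mfA _ mA))) => // b e.
  rewrite -[RHS](step1 A b e mA); apply: eq_Rintegral => z _; ring.
have ae0 : ae_eq (leb2 R) setT (EFin \o g) (cst 0%E).
  apply: integral_ae_eq => //.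
  move=> E _ mE; rewrite integral0.
  have hE : \int[leb2 R]_z (g z * \1_(idfun @^-1` E) z) = 0.
    apply: (@pi_lambda_int _ _ R (leb2 R) g ig _ _ idfun [set A `*` B | A in measurable & B in measurable]) => //.
    - exact: measurable_id.
    - move=> _ _ [A mA [B mB <-]] [A' mA' [B' mB' <-]].
      exists (A `&` A'); first exact: measurableI.
      exists (B `&` B'); first exact: measurableI.
      by rewrite setXI.
    - by move=> _ [A mA [B mB <-]]; exact: measurableX.
    - rewrite -[RHS](hg 0 (pi / 2) 0 (pi / 2)); apply: eq_Rintegral => z _.
      by rewrite !mul0r !add0r !sin_pihalf !mulr1.
    - move=> _ [A mA [B mB <-]]; rewrite -[RHS](step2 A B mA mB).
      apply: eq_Rintegral => z _; rewrite -mulrA; congr (_ * _).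
      rewrite !indicE -natrM; congr (_%:R).
      by rewrite mulnb; congr nat_of_bool; apply/idP/andP => [/set_mem[p q]|[/set_mem p /set_mem q]];
        [split; apply/mem_set|apply/mem_set].
    - by move: mE; rewrite measurable_prod_measurableType.
  have iE := itg_indic ig mE.
  have e : (\int[leb2 R]_(z in E) (EFin \o g) z = \int[leb2 R]_z (g z * \1_E z)%:E)%E.
    rewrite integral_mkcond; apply: eq_integral => z _.
    rewrite patchE indicE; case: ifP => _; rewrite ?mulr1 ?mulr0 //.
  rewrite e -[LHS]fineK; last exact: (integrable_fin_num measurableT iE).
  by have := hE; rewrite /Rintegral => ->.
by apply: filterS ae0 => z /(_ I) /= [].
Qed.

End TrigonometricUniqueness2.

(** * Hardy's theorem in two variables *)

Section Hardy2.
Variable R : realType.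
Local Notation mT := (measurableTypeR R).
Implicit Types (a w : R) (z : mT * mT).

Definition gauss2 a (z : R * R) : R := expR (- a * enorm z ^+ 2).

Lemma gauss2E a (z : R * R) : gauss2 a z = gs a z.1 * gs a z.2.
Proof.
rewrite /gauss2 /enorm sqr_sqrtr; last by rewrite addr_ge0 // sqr_ge0.
by rewrite mulrDr expRD.
Qed.

Lemma meas_gauss2 a : measurable_fun setT (gauss2 a : mT * mT -> R).
Proof.
rewrite (_ : gauss2 a = fun z : mT * mT => gs a z.1 * gs a z.2).
  by apply: measurable_funM; [apply: meas_fst2|apply: meas_snd2]; exact: meas_gs.
by apply/funext => z; exact: gauss2E.
Qed.

Lemma itg_gauss2 a : 0 < a -> itg (leb2 R) (gauss2 a : mT * mT -> R).
Proof.
move=> a0; apply: (itg_ext (f := fun z : mT * mT => gs a z.1 * gs a z.2)).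
  by move=> z; rewrite gauss2E.
by apply: itg_prod; exact: itg_gs.
Qed.

Definition gauss_dom a (h : mT * mT -> R) :=
  measurable_fun setT h /\ exists C, forall z, `|h z| <= C * gauss2 a z.

Lemma gauss_dom_itg a h : 0 < a -> gauss_dom a h -> itg (leb2 R) h.
Proof.
by move=> a0 [mh [C hC]]; apply: (itg_dom mh hC); apply: itgZ; exact: itg_gauss2.
Qed.

(** With [u] a cosine or sine of the second variable, the one-variable theorem in the first variable
    still applies to the product. *)
Lemma gauss_domM a h (u : mT * mT -> R) : measurable_fun setT u ->
  (forall z, `|u z| <= 1) -> gauss_dom a h -> gauss_dom a (fun z => h z * u z).
Proof.
move=> mu u1 [mh [C hC]]; split; first exact: measurable_funM.
exists C => z; rewrite normrM; apply: le_trans (hC z).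
by rewrite -[leRHS]mulr1 ler_wpM2l.
Qed.

Lemma meas_cos2 w : measurable_fun setT (fun z => cos (w * z.2)).
Proof.
apply: (meas_snd2 (F := fun x : mT => cos (w * x))).
apply: (measurableT_comp (continuous_measurable_fun (@continuous_cos _))).
exact: measurable_funM.
Qed.

Lemma meas_sin2 w : measurable_fun setT (fun z => sin (w * z.2)).
Proof.
apply: (meas_snd2 (F := fun x : mT => sin (w * x))).
apply: (measurableT_comp (continuous_measurable_fun (@continuous_sin _))).
exact: measurable_funM.
Qed.

Lemma cos_norm_le1 (x : R) : `|cos x| <= 1.
Proof. by rewrite ler_norml cos_geN1 cos_le1. Qed.

Section OneVariable.
Variables (a : R) (h : mT * mT -> R).
Hypotheses (a0 : 0 < a) (dh : gauss_dom a h).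

Let mh : measurable_fun setT h := dh.1.

Lemma dom_iexp1 r : itg (leb2 R) (fun z => expR (r * `|z.1|) * `|h z|).
Proof.
have [_ [C hC]] := dh.
apply: (itg_dom (g := fun z => (expR (r * `|z.1|) * gs a z.1) * (C * gs a z.2))).
- apply: measurable_funM; last by apply: measurableT_comp.
  apply: (meas_fst2 (F := fun x : mT => expR (r * `|x|))).
  apply: (measurableT_comp (@measurable_expR R)).
  by apply: measurable_funM => //; exact: normr_measurable.
- move=> z; rewrite normrM normr_id (ger0_norm (expR_ge0 _)).
  rewrite -mulrA ler_wpM2l ?expR_ge0 //; apply: le_trans (hC z) _.
  by rewrite gauss2E mulrCA.
- apply: (itg_prod (F := fun x : mT => expR (r * `|x|) * gs a x) (G := fun x : mT => C * gs a x)).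
    by apply: itg_ext (itg_gs_exp 0 r a0) => x /=; rewrite expr0 mul1r.
  by apply: itgZ; exact: itg_gs.
Qed.

Lemma dom_iexp2 r : itg (leb2 R) (fun z => expR (r * `|z.2|) * `|h z|).
Proof.
have [_ [C hC]] := dh.
apply: (itg_dom (g := fun z => (C * gs a z.1) * (expR (r * `|z.2|) * gs a z.2))).
- apply: measurable_funM; last by apply: measurableT_comp.
  apply: (meas_snd2 (F := fun x : mT => expR (r * `|x|))).
  apply: (measurableT_comp (@measurable_expR R)).
  by apply: measurable_funM => //; exact: normr_measurable.
- move=> z; rewrite normrM normr_id (ger0_norm (expR_ge0 _)).
  rewrite mulrCA ler_wpM2l ?expR_ge0 //; apply: le_trans (hC z) _.
  by rewrite gauss2E mulrA.
- apply: (itg_prod (G := fun x : mT => expR (r * `|x|) * gs a x) (F := fun x : mT => C * gs a x)).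
    by apply: itgZ; exact: itg_gs.
  by apply: itg_ext (itg_gs_exp 0 r a0) => x /=; rewrite expr0 mul1r.
Qed.

Lemma dom_hmom1 : exists C0, forall n,
  \int[leb2 R]_z (z.1 ^+ n.*2 * `|h z|) <= C0 * qmom a n.
Proof.
have [_ [C hC]] := dh; exists (C * gint a * gint a) => n.
have ev x : 0 <= x ^+ n.*2 :> R by rewrite -muln2 exprM sqr_ge0.
have i1 := itg_gs_pow n.*2 a0; have i2 := itgZ C (itg_gs a0).
have ig := itg_prod i1 i2.
have b z : `|z.1 ^+ n.*2 * `|h z| | <= z.1 ^+ n.*2 * gs a z.1 * (C * gs a z.2).
  rewrite normrM normr_id (ger0_norm (ev _)) -mulrA ler_wpM2l //.
  by apply: le_trans (hC z) _; rewrite gauss2E mulrCA.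
have i : itg (leb2 R) (fun z => z.1 ^+ n.*2 * `|h z|).
  apply: (itg_dom _ b ig); apply: measurable_funM; last exact: measurableT_comp.
  by apply: (meas_fst2 (F := fun x : mT => x ^+ n.*2)); exact: measurable_funX.
apply: le_trans (ler_norm _) _; apply: le_trans (Rint_le_dom i ig b) _.
rewrite (Rint_prod i1 i2) -/(gmom a n.*2) gmom_even // RintegralZl ?itg_gs //.
by rewrite -/(gint a) le_eqVlt; apply/orP; left; apply/eqP; ring.
Qed.

Lemma dom_hmom2 : exists C0, forall n,
  \int[leb2 R]_z (z.2 ^+ n.*2 * `|h z|) <= C0 * qmom a n.
Proof.
have [_ [C hC]] := dh; exists (C * gint a * gint a) => n.
have ev x : 0 <= x ^+ n.*2 :> R by rewrite -muln2 exprM sqr_ge0.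
have i1 := itg_gs_pow n.*2 a0; have i2 := itgZ C (itg_gs a0).
have ig := itg_prod i2 i1.
have b z : `|z.2 ^+ n.*2 * `|h z| | <= C * gs a z.1 * (z.2 ^+ n.*2 * gs a z.2).
  rewrite normrM normr_id (ger0_norm (ev _)) mulrCA ler_wpM2l //.
  by apply: le_trans (hC z) _; rewrite gauss2E mulrA.
have i : itg (leb2 R) (fun z => z.2 ^+ n.*2 * `|h z|).
  apply: (itg_dom _ b ig); apply: measurable_funM; last exact: measurableT_comp.
  by apply: (meas_snd2 (F := fun x : mT => x ^+ n.*2)); exact: measurable_funX.
apply: le_trans (ler_norm _) _; apply: le_trans (Rint_le_dom i ig b) _.
rewrite (Rint_prod i2 i1) -/(gmom a n.*2) gmom_even // RintegralZl ?itg_gs //.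
by rewrite -/(gint a) le_eqVlt; apply/orP; left; apply/eqP; ring.
Qed.

Lemma gs_inv4 w : gs (4 * a)^-1 w = expR (- (w ^+ 2 / (4 * a))).
Proof. by rewrite /gs mulNr mulrC. Qed.

Variable C' : R.

Lemma hardy_cos1 w :
  (forall w, `|\int[leb2 R]_z (h z * cos (w * z.1))| <= C' * gs (4 * a)^-1 w) ->
  \int[leb2 R]_z (h z * cos (w * z.1)) = \int[leb2 R]_z h z * gs (4 * a)^-1 w.
Proof.
move=> H; have [C0 hm] := dom_hmom1; rewrite gs_inv4.
apply: (hardy_cos (X := fst : mT * mT -> R) a0 _ mh dom_iexp1 hm (C' := C')).
  exact: (meas_fst2 (F := fun x : mT => x)).
by move=> v; rewrite -gs_inv4.
Qed.

Lemma hardy_sin1 w :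
  (forall w, `|\int[leb2 R]_z (h z * sin (w * z.1))| <= C' * gs (4 * a)^-1 w) ->
  \int[leb2 R]_z (h z * sin (w * z.1)) = 0.
Proof.
move=> H; have [C0 hm] := dom_hmom1.
apply: (hardy_sin (X := fst : mT * mT -> R) a0 _ mh dom_iexp1 hm (C' := C')).
  exact: (meas_fst2 (F := fun x : mT => x)).
by move=> v; rewrite -gs_inv4.
Qed.

Lemma hardy_cos2 w :
  (forall w, `|\int[leb2 R]_z (h z * cos (w * z.2))| <= C' * gs (4 * a)^-1 w) ->
  \int[leb2 R]_z (h z * cos (w * z.2)) = \int[leb2 R]_z h z * gs (4 * a)^-1 w.
Proof.
move=> H; have [C0 hm] := dom_hmom2; rewrite gs_inv4.
apply: (hardy_cos (X := snd : mT * mT -> R) a0 _ mh dom_iexp2 hm (C' := C')).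
  exact: (meas_snd2 (F := fun x : mT => x)).
by move=> v; rewrite -gs_inv4.
Qed.

Lemma hardy_sin2 w :
  (forall w, `|\int[leb2 R]_z (h z * sin (w * z.2))| <= C' * gs (4 * a)^-1 w) ->
  \int[leb2 R]_z (h z * sin (w * z.2)) = 0.
Proof.
move=> H; have [C0 hm] := dom_hmom2.
apply: (hardy_sin (X := snd : mT * mT -> R) a0 _ mh dom_iexp2 hm (C' := C')).
  exact: (meas_snd2 (F := fun x : mT => x)).
by move=> v; rewrite -gs_inv4.
Qed.

End OneVariable.

Definition tr2 (u v : R -> R) (h : mT * mT -> R) (w : R * R) : R :=
  \int[leb2 R]_z (h z * u (w.1 * z.1) * v (w.2 * z.2)).

Lemma tr2C u v h (w : R * R) :
  tr2 u v h w = \int[leb2 R]_z (h z * v (w.2 * z.2) * u (w.1 * z.1)).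
Proof. by apply: eq_Rintegral => z _; rewrite mulrAC. Qed.

Section TwoVariables.
Variables (a C' : R) (g : mT * mT -> R).
Hypotheses (a0 : 0 < a) (dg : gauss_dom a g).
Local Notation b := (4 * a)^-1.

Let bound u v := forall w : R * R, `|tr2 u v g w| <= C' * gauss2 b w.

Hypotheses (bcc : bound cos cos) (bsc : bound sin cos) (bcs : bound cos sin)
  (bss : bound sin sin).

Let dc2 w : gauss_dom a (fun z => g z * cos (w * z.2)).
Proof. by apply: gauss_domM => //; [exact: meas_cos2|move=> z; exact: cos_norm_le1]. Qed.

Let ds2 w : gauss_dom a (fun z => g z * sin (w * z.2)).
Proof. by apply: gauss_domM => //; [exact: meas_sin2|move=> z; exact: sin_le1]. Qed.

(** With [w2] frozen, its Gaussian factor joins the constant. *)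
Let b1 (u v : R -> R) w2 : bound u v -> forall w1,
  `|\int[leb2 R]_z (g z * v (w2 * z.2) * u (w1 * z.1))| <= (C' * gs b w2) * gs b w1.
Proof.
move=> H w1; have := H (w1, w2); rewrite tr2C gauss2E /= => /le_trans; apply.
by rewrite mulrA [leLHS]mulrAC.
Qed.

(** Frequency [w1 = 0] turns the cosine into 1 and leaves a transform in the second variable
    alone. *)
Let b2 (v : R -> R) : bound cos v -> forall w2,
  `|\int[leb2 R]_z (g z * v (w2 * z.2))| <= C' * gs b w2.
Proof.
move=> H w2; have := H (0, w2); rewrite gauss2E /= {1}/gs expr0n /= mulr0 expR0 mul1r.
congr (`|_| <= _); apply: eq_Rintegral => z _.
by rewrite /= mul0r cos0 mulr1.
Qed.

(** Hardy in x_1, applied to g cos(w_2 x_2), reduces the double transform to its value at w_1 = 0;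
    Hardy in x_2 then treats that value. *)
Lemma hardy_cc (w : R * R) : tr2 cos cos g w = \int[leb2 R]_z g z * gauss2 b w.
Proof.
rewrite tr2C (hardy_cos1 a0 (dc2 w.2) w.1 (b1 w.2 bcc)).
by rewrite (hardy_cos2 a0 dg w.2 (b2 bcc)) gauss2E -!mulrA [gs b w.2 * _]mulrC.
Qed.

Lemma hardy_cs (w : R * R) : tr2 cos sin g w = 0.
Proof.
rewrite tr2C (hardy_cos1 a0 (ds2 w.2) w.1 (b1 w.2 bcs)).
by rewrite (hardy_sin2 a0 dg w.2 (b2 bcs)) mul0r.
Qed.

Lemma hardy_sc (w : R * R) : tr2 sin cos g w = 0.
Proof. by rewrite tr2C (hardy_sin1 a0 (dc2 w.2) w.1 (b1 w.2 bsc)). Qed.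

Lemma hardy_ss (w : R * R) : tr2 sin sin g w = 0.
Proof. by rewrite tr2C (hardy_sin1 a0 (ds2 w.2) w.1 (b1 w.2 bss)). Qed.

End TwoVariables.

Lemma meas_tr (u : R -> R) w : measurable_fun setT u ->
  measurable_fun setT (fun x : mT => u (w * x)).
Proof.
by move=> mu; apply: measurableT_comp => //; exact: measurable_funM.
Qed.

Lemma meas_cosT : measurable_fun setT (@cos R).
Proof. exact: (continuous_measurable_fun (@continuous_cos _)). Qed.

Lemma meas_sinT : measurable_fun setT (@sin R).
Proof. exact: (continuous_measurable_fun (@continuous_sin _)). Qed.

Lemma tr2_gauss (u v : R -> R) a (w : R * R) : 0 < a ->
  measurable_fun setT u -> measurable_fun setT v ->
  (forall x, `|u x| <= 1) -> (forall x, `|v x| <= 1) ->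
  tr2 u v (gauss2 a) w =
  \int[@lebesgue_measure R]_x (gs a x * u (w.1 * x)) *
  \int[@lebesgue_measure R]_x (gs a x * v (w.2 * x)).
Proof.
move=> a0 mu mv u1 v1.
rewrite -Rint_prod; first last.
- by apply: (itg_bounded (B := 1) (itg_gs a0)) => //; exact: meas_tr.
- by apply: (itg_bounded (B := 1) (itg_gs a0)) => //; exact: meas_tr.
by apply: eq_Rintegral => z _; rewrite gauss2E; ring.
Qed.

Lemma tr2_gauss_cc a (w : R * R) : 0 < a ->
  tr2 cos cos (gauss2 a) w = gint a ^+ 2 * gauss2 (4 * a)^-1 w.
Proof.
move=> a0; rewrite tr2_gauss //; try exact: meas_cosT; try exact: cos_norm_le1.
rewrite !gs_cos // gauss2E; ring.
Qed.

Lemma tr2_gauss_sl a (v : R -> R) (w : R * R) : 0 < a -> measurable_fun setT v ->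
  (forall x, `|v x| <= 1) -> tr2 sin v (gauss2 a) w = 0.
Proof.
move=> a0 mv v1; rewrite tr2_gauss //; try exact: meas_sinT; try exact: sin_le1.
by rewrite gs_sin // mul0r.
Qed.

Lemma tr2_gauss_sr a (u : R -> R) (w : R * R) : 0 < a -> measurable_fun setT u ->
  (forall x, `|u x| <= 1) -> tr2 u sin (gauss2 a) w = 0.
Proof.
move=> a0 mv v1; rewrite tr2_gauss //; try exact: meas_sinT; try exact: sin_le1.
by rewrite gs_sin // mulr0.
Qed.

Lemma meas_tr2 (u v : R -> R) (w : R * R) :
  measurable_fun setT u -> measurable_fun setT v ->
  measurable_fun setT (fun z : mT * mT => u (w.1 * z.1) * v (w.2 * z.2)).
Proof.
move=> mu mv; apply: measurable_funM.
  exact: (meas_fst2 (meas_tr w.1 mu)).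
exact: (meas_snd2 (meas_tr w.2 mv)).
Qed.

Lemma itg_tr2 (u v : R -> R) (h : mT * mT -> R) (w : R * R) :
  itg (leb2 R) h -> measurable_fun setT u -> measurable_fun setT v ->
  (forall x, `|u x| <= 1) -> (forall x, `|v x| <= 1) ->
  itg (leb2 R) (fun z => h z * u (w.1 * z.1) * v (w.2 * z.2)).
Proof.
move=> ih mu mv u1 v1.
apply: (itg_ext (f := fun z => h z * (u (w.1 * z.1) * v (w.2 * z.2)))).
  by move=> z; rewrite mulrA.
apply: (itg_bounded (B := 1) ih); first exact: meas_tr2.
by move=> z; rewrite normrM -[leRHS]mulr1 ler_pM.
Qed.

(** The difference of [g] and a suitable multiple of the Gaussian has all four transforms equal to
    0, so it vanishes almost everywhere by uniqueness. *)
Lemma hardy2 a C' (g : mT * mT -> R) : 0 < a -> gauss_dom a g ->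
  (forall w : R * R, `|tr2 cos cos g w| <= C' * gauss2 (4 * a)^-1 w) ->
  (forall w : R * R, `|tr2 sin cos g w| <= C' * gauss2 (4 * a)^-1 w) ->
  (forall w : R * R, `|tr2 cos sin g w| <= C' * gauss2 (4 * a)^-1 w) ->
  (forall w : R * R, `|tr2 sin sin g w| <= C' * gauss2 (4 * a)^-1 w) ->
  exists K : R, {ae leb2 R, forall z, g z = K * gauss2 a z}.
Proof.
move=> a0 dg bcc bsc bcs bss; have gi0 : gint a ^+ 2 != 0.
  by rewrite expf_neq0 // gt_eqF // gint_gt0.
(* [gint a ^+ 2] is the integral of [gauss2 a], so this [K] matches the total integrals. *)
set K := \int[leb2 R]_z g z / gint a ^+ 2; exists K.
have ig := gauss_dom_itg a0 dg; have iG := itg_gauss2 a0.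
have iB : itg (leb2 R) (fun z => g z - K * gauss2 a z) by apply: itgB => //; exact: itgZ.
have c1 := cos_norm_le1; have s1 := @sin_le1 R.
have mc := meas_cosT; have ms := meas_sinT.
have trB (u v : R -> R) (w : R * R) : measurable_fun setT u -> measurable_fun setT v ->
    (forall x, `|u x| <= 1) -> (forall x, `|v x| <= 1) ->
    tr2 u v (fun z => g z - K * gauss2 a z) w = tr2 u v g w - K * tr2 u v (gauss2 a) w.
  move=> mu mv u1 v1; rewrite /tr2 -RintegralZl //; last exact: itg_tr2.
  rewrite -RintegralB //; first last.
  - by apply: itgZ; exact: itg_tr2.
  - exact: itg_tr2.
  by apply: eq_Rintegral => z _; ring.
have hcc (w : R * R) : tr2 cos cos (fun z => g z - K * gauss2 a z) w = 0.
  rewrite trB // (hardy_cc a0 dg bcc) tr2_gauss_cc // mulrA /K divfK //.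
  by rewrite subrr.
have hsc (w : R * R) : tr2 sin cos (fun z => g z - K * gauss2 a z) w = 0.
  by rewrite trB // (hardy_sc a0 dg bsc) tr2_gauss_sl // mulr0 subrr.
have hcs (w : R * R) : tr2 cos sin (fun z => g z - K * gauss2 a z) w = 0.
  by rewrite trB // (hardy_cs a0 dg bcs) tr2_gauss_sr // mulr0 subrr.
have hss (w : R * R) : tr2 sin sin (fun z => g z - K * gauss2 a z) w = 0.
  by rewrite trB // (hardy_ss a0 dg bss) tr2_gauss_sl // mulr0 subrr.
suff H p c q e : \int[leb2 R]_z ((g z - K * gauss2 a z) * sin (p * z.1 + c) *
    sin (q * z.2 + e)) = 0.
  have H0 := trig_uniqueness2 iB H.
  by apply: filterS H0 => z /eqP; rewrite subr_eq0 => /eqP.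
set h := fun z => g z - K * gauss2 a z.
pose t (u v : R -> R) z := h z * u (p * z.1) * v (q * z.2).
have it (u v : R -> R) : measurable_fun setT u -> measurable_fun setT v ->
    (forall x, `|u x| <= 1) -> (forall x, `|v x| <= 1) -> itg (leb2 R) (t u v).
  by move=> mu mv u1 v1; apply: (itg_tr2 (p, q)).
(* The addition formula expands the shifted sines into the four transforms at (p, q). *)
transitivity (\int[leb2 R]_z (cos c * cos e * t sin sin z + cos c * sin e * t sin cos z +
   (sin c * cos e * t cos sin z + sin c * sin e * t cos cos z))).
  apply: eq_Rintegral => z _; rewrite !sinD /t /h; ring.
have iss := it sin sin ms ms s1 s1; have isc := it sin cos ms mc s1 c1.
have ics := it cos sin mc ms c1 s1; have icc := it cos cos mc mc c1 c1.
rewrite !RintegralD //; try (do ?apply: itgD; apply: itgZ => //).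
rewrite !RintegralZl //.
have := hss (p, q); have := hsc (p, q); have := hcs (p, q); have := hcc (p, q).
by rewrite /tr2 -/h /t /= => -> -> -> ->; rewrite !mulr0 !addr0.
Qed.

End Hardy2.

(** * The quaternionic transform *)

Section QuaternionTransform.
Variable R : realType.
Local Notation mT := (measurableTypeR R).
Implicit Types (a w x y t : R) (p q : quat R) (f g : mT * mT -> quat R).

Lemma mulqE p q : p * q = mulq p q. Proof. by []. Qed.

Lemma qnormM p q : qnorm (p * q) = qnorm p * qnorm q.
Proof.
rewrite /qnorm -sqrtrM; last by rewrite !addr_ge0 ?sqr_ge0.
by congr Num.sqrt; rewrite mulqE /mulq /=; ring.
Qed.

Lemma qnorm_ge0 p : 0 <= qnorm p. Proof. exact: sqrtr_ge0. Qed.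

Lemma qnorm_comp p : [/\ `|q1 p| <= qnorm p, `|qi p| <= qnorm p,
  `|qj p| <= qnorm p & `|qk p| <= qnorm p].
Proof.
have s x y : 0 <= y -> `|x| <= Num.sqrt (x ^+ 2 + y).
  by move=> y0; rewrite -sqrtr_sqr ler_wsqrtr // lerDl.
rewrite /qnorm; split.
- by rewrite -!addrA s // !addr_ge0 ?sqr_ge0.
- by rewrite -!addrA addrCA s // !addr_ge0 ?sqr_ge0.
- by rewrite addrAC addrC s // !addr_ge0 ?sqr_ge0.
- by rewrite addrC s // !addr_ge0 ?sqr_ge0.
Qed.

Lemma qnorm_real x : qnorm (qreal x) = `|x|.
Proof. by rewrite /qnorm /= expr0n /= !addr0 sqrtr_sqr. Qed.

Lemma qnorm_eq0 p : qnorm p = 0 -> p = 0.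
Proof.
have [h1 hi hj hk] := qnorm_comp p => e; move: h1 hi hj hk.
rewrite e !normr_le0; case: p {e} => a b c d /=.
by move=> /eqP-> /eqP-> /eqP-> /eqP->.
Qed.

Lemma qnorm_in_i (z : R[i]) : qnorm (in_i z) = cabs z.
Proof. by case: z => a b; rewrite /qnorm /= expr0n /= !addr0. Qed.

Lemma qnorm_in_j (z : R[i]) : qnorm (in_j z) = cabs z.
Proof. by case: z => a b; rewrite /qnorm /= expr0n /= !addr0. Qed.

Lemma in_iM (u v : R[i]) : in_i (u * v) = in_i u * in_i v.
Proof. by case: u v => a b [c d]; rewrite mulqE; congr Quat => /=; ring. Qed.

Lemma in_jM (u v : R[i]) : in_j (u * v) = in_j u * in_j v.
Proof. by case: u v => a b [c d]; rewrite mulqE; congr Quat => /=; ring. Qed.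

Lemma cisD x y : cis (x + y) = cis x * cis y.
Proof. by congr Complex; rewrite ?cosD ?sinD //; ring. Qed.

Lemma cabs_cis x : cabs (cis x) = 1.
Proof. by rewrite /cis /= cos2Dsin2 sqrtr1. Qed.

Lemma cisNK x : cis (- x) * cis x = 1.
Proof. by rewrite -cisD addNr /cis cos0 sin0. Qed.

Lemma qmeasurableM f g : qmeasurable f -> qmeasurable g ->
  qmeasurable (fun z => f z * g z).
Proof.
move=> [f1 f2 f3 f4] [g1 g2 g3 g4].
rewrite /qmeasurable /GRing.mul /= /mulq /=; split;
  repeat first [assumption | apply: measurable_funB | apply: measurable_funD
    | apply: measurable_funM].
Qed.

Lemma qmeasurable_cis_i (u : mT * mT -> R) : measurable_fun setT u ->
  qmeasurable (fun z => in_i (cis (u z))).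
Proof.
move=> mu; split => //=; apply: measurableT_comp => //;
  [exact: meas_cosT|exact: meas_sinT].
Qed.

Lemma qmeasurable_cis_j (u : mT * mT -> R) : measurable_fun setT u ->
  qmeasurable (fun z => in_j (cis (u z))).
Proof.
move=> mu; split => //=; apply: measurableT_comp => //;
  [exact: meas_cosT|exact: meas_sinT].
Qed.

Definition qdom a f := qmeasurable f /\ exists C, forall z, qnorm (f z) <= C * gauss2 a z.

Lemma qdom_comp a f : qdom a f ->
  [/\ gauss_dom a (fun z => q1 (f z)), gauss_dom a (fun z => qi (f z)),
      gauss_dom a (fun z => qj (f z)) & gauss_dom a (fun z => qk (f z))].
Proof.
by move=> [[m1 mi mj mk] [C hC]]; split; split => //; exists C => z;
  apply: le_trans (hC z); have [] := qnorm_comp (f z).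
Qed.

Definition qitg f := [/\ itg (leb2 R) (fun z => q1 (f z)), itg (leb2 R) (fun z => qi (f z)),
  itg (leb2 R) (fun z => qj (f z)) & itg (leb2 R) (fun z => qk (f z))].

Lemma qdom_itg a f : 0 < a -> qdom a f -> qitg f.
Proof. by move=> a0 /qdom_comp[? ? ? ?]; split; exact: (gauss_dom_itg a0). Qed.

Lemma Rint4 (k1 k2 k3 k4 : R) (f1 f2 f3 f4 f : mT * mT -> R) :
  itg (leb2 R) f1 -> itg (leb2 R) f2 -> itg (leb2 R) f3 -> itg (leb2 R) f4 ->
  (forall z, f z = k1 * f1 z + k2 * f2 z + k3 * f3 z + k4 * f4 z) ->
  \int[leb2 R]_z f z = k1 * (\int[leb2 R]_z f1 z) + k2 * (\int[leb2 R]_z f2 z) +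
    k3 * (\int[leb2 R]_z f3 z) + k4 * (\int[leb2 R]_z f4 z).
Proof.
move=> i1 i2 i3 i4 e.
rewrite -!RintegralZl //.
have z1 := itgZ k1 i1; have z2 := itgZ k2 i2.
have z3 := itgZ k3 i3; have z4 := itgZ k4 i4.
rewrite -!RintegralD //; try (do ?apply: itgD => //).
by apply: eq_Rintegral => z _; rewrite e.
Qed.

Lemma qintegral_mull p f : qitg f -> qintegral (fun z => p * f z) = p * qintegral f.
Proof.
case: p => a b c d [i1 ii ij ik]; rewrite mulqE /qintegral /mulq; congr Quat => /=.
- by rewrite (Rint4 (k1 := a) (k2 := - b) (k3 := - c) (k4 := - d) i1 ii ij ik);
    [ring|move=> z /=; ring].
- by rewrite (Rint4 (k1 := b) (k2 := a) (k3 := - d) (k4 := c) i1 ii ij ik);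
    [ring|move=> z /=; ring].
- by rewrite (Rint4 (k1 := c) (k2 := d) (k3 := a) (k4 := - b) i1 ii ij ik);
    [ring|move=> z /=; ring].
- by rewrite (Rint4 (k1 := d) (k2 := - c) (k3 := b) (k4 := a) i1 ii ij ik);
    [ring|move=> z /=; ring].
Qed.

Lemma qintegral_mulr p f : qitg f -> qintegral (fun z => f z * p) = qintegral f * p.
Proof.
case: p => a b c d [i1 ii ij ik]; rewrite mulqE /qintegral /mulq; congr Quat => /=.
- by rewrite (Rint4 (k1 := a) (k2 := - b) (k3 := - c) (k4 := - d) i1 ii ij ik);
    [ring|move=> z /=; ring].
- by rewrite (Rint4 (k1 := b) (k2 := a) (k3 := d) (k4 := - c) i1 ii ij ik);
    [ring|move=> z /=; ring].
- by rewrite (Rint4 (k1 := c) (k2 := - d) (k3 := a) (k4 := b) i1 ii ij ik);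
    [ring|move=> z /=; ring].
- by rewrite (Rint4 (k1 := d) (k2 := c) (k3 := - b) (k4 := a) i1 ii ij ik);
    [ring|move=> z /=; ring].
Qed.

Definition qft f (w : R * R) : quat R := qintegral (fun z =>
  in_i (cis (- (w.1 * z.1))) * f z * in_j (cis (- (w.2 * z.2)))).

(** Each component of the transform contains each of the four parities in (w_1, w_2) exactly once,
    attached to four different components of [f]; sign changes of w_1 and w_2 can therefore separate
    them. *)
Lemma qft_components f (w : R * R) : qitg f -> qft f w = Quat
  (tr2 cos cos (fun z => q1 (f z)) w + tr2 sin cos (fun z => qi (f z)) w +
   tr2 cos sin (fun z => qj (f z)) w + tr2 sin sin (fun z => qk (f z)) w)
  (tr2 cos cos (fun z => qi (f z)) w - tr2 sin cos (fun z => q1 (f z)) w +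
   tr2 cos sin (fun z => qk (f z)) w - tr2 sin sin (fun z => qj (f z)) w)
  (tr2 cos cos (fun z => qj (f z)) w + tr2 sin cos (fun z => qk (f z)) w
   - tr2 cos sin (fun z => q1 (f z)) w - tr2 sin sin (fun z => qi (f z)) w)
  (tr2 cos cos (fun z => qk (f z)) w - tr2 sin cos (fun z => qj (f z)) w
   - tr2 cos sin (fun z => qi (f z)) w + tr2 sin sin (fun z => q1 (f z)) w).
Proof.
move=> [i1 ii ij ik].
have mc := @meas_cosT R; have ms := @meas_sinT R.
have c1 := @cos_norm_le1 R; have s1 := @sin_le1 R.
have icc h ih := @itg_tr2 R cos cos h w ih mc mc c1 c1.
have isc h ih := @itg_tr2 R sin cos h w ih ms mc s1 c1.
have ics h ih := @itg_tr2 R cos sin h w ih mc ms c1 s1.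
have iss h ih := @itg_tr2 R sin sin h w ih ms ms s1 s1.
rewrite /qft /qintegral; congr Quat => /=.
- rewrite (Rint4 (k1 := 1) (k2 := 1) (k3 := 1) (k4 := 1)
    (icc _ i1) (isc _ ii) (ics _ ij) (iss _ ik)) ?mul1r ?mulN1r //.
  by move=> z /=; rewrite !cosN !sinN; ring.
- rewrite (Rint4 (k1 := 1) (k2 := -1) (k3 := 1) (k4 := -1)
    (icc _ ii) (isc _ i1) (ics _ ik) (iss _ ij)) ?mul1r ?mulN1r //.
  by move=> z /=; rewrite !cosN !sinN; ring.
- rewrite (Rint4 (k1 := 1) (k2 := 1) (k3 := -1) (k4 := -1)
    (icc _ ij) (isc _ ik) (ics _ i1) (iss _ ii)) ?mul1r ?mulN1r //.
  by move=> z /=; rewrite !cosN !sinN; ring.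
- rewrite (Rint4 (k1 := 1) (k2 := -1) (k3 := -1) (k4 := 1)
    (icc _ ik) (isc _ ij) (ics _ ii) (iss _ i1)) ?mul1r ?mulN1r //.
  by move=> z /=; rewrite !cosN !sinN; ring.
Qed.

Lemma tr2_cos1N (v : R -> R) (h : mT * mT -> R) x y :
  tr2 cos v h (- x, y) = tr2 cos v h (x, y).
Proof. by apply: eq_Rintegral => z _; rewrite /= mulNr cosN. Qed.

Lemma tr2_cos2N (u : R -> R) (h : mT * mT -> R) x y :
  tr2 u cos h (x, - y) = tr2 u cos h (x, y).
Proof. by apply: eq_Rintegral => z _; rewrite /= mulNr cosN. Qed.

Lemma tr2N (u v : R -> R) (h : mT * mT -> R) x y : itg (leb2 R) h ->
  measurable_fun setT u -> measurable_fun setT v ->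
  (forall x, `|u x| <= 1) -> (forall x, `|v x| <= 1) ->
  \int[leb2 R]_z - (h z * u (x * z.1) * v (y * z.2)) = - tr2 u v h (x, y).
Proof. by move=> ih mu mv u1 v1; rewrite RintN //; exact: (itg_tr2 (x, y)). Qed.

Lemma tr2_sin1N (v : R -> R) (h : mT * mT -> R) x y : itg (leb2 R) h ->
  measurable_fun setT v -> (forall x, `|v x| <= 1) ->
  tr2 sin v h (- x, y) = - tr2 sin v h (x, y).
Proof.
move=> ih mv v1; rewrite -tr2N //; [|exact: meas_sinT|exact: sin_le1].
by apply: eq_Rintegral => z _; rewrite /= mulNr sinN; ring.
Qed.

Lemma tr2_sin2N (u : R -> R) (h : mT * mT -> R) x y : itg (leb2 R) h ->
  measurable_fun setT u -> (forall x, `|u x| <= 1) ->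
  tr2 u sin h (x, - y) = - tr2 u sin h (x, y).
Proof.
move=> ih mv v1; rewrite -tr2N //; [|exact: meas_sinT|exact: sin_le1].
by apply: eq_Rintegral => z _; rewrite /= mulNr sinN; ring.
Qed.

(** Each of s, t, u, v is a signed mean of r1, ..., r4, so the bound [e] is inherited without an
    extra constant. *)
Lemma four_signs (s t u v e r1 r2 r3 r4 : R) :
  `|r1| <= e -> `|r2| <= e -> `|r3| <= e -> `|r4| <= e ->
  r1 = s + t + u + v -> r2 = s - t + u - v ->
  r3 = s + t - u - v -> r4 = s - t - u + v ->
  [/\ `|s| <= e, `|t| <= e, `|u| <= e & `|v| <= e].
Proof.
move=> h1 h2 h3 h4 e1 e2 e3 e4; move: h1 h2 h3 h4; rewrite e1 e2 e3 e4.
rewrite !ler_norml => /andP[? ?] /andP[? ?] /andP[? ?] /andP[? ?].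
by split; apply/andP; split; lra.
Qed.

Lemma qnorm_le p e : qnorm p <= e ->
  [/\ `|q1 p| <= e, `|qi p| <= e, `|qj p| <= e & `|qk p| <= e].
Proof.
by have [a b c d] := qnorm_comp p => h; split; apply: le_trans h.
Qed.

Lemma gauss2N1 a x y : gauss2 a (- x, y) = gauss2 a (x, y).
Proof. by rewrite /gauss2 /enorm /= sqrrN. Qed.

Lemma gauss2N2 a x y : gauss2 a (x, - y) = gauss2 a (x, y).
Proof. by rewrite /gauss2 /enorm /= sqrrN. Qed.

Definition tr2_bounded (h : mT * mT -> R) (e : R) (w : R * R) :=
  [/\ `|tr2 cos cos h w| <= e, `|tr2 sin cos h w| <= e,
      `|tr2 cos sin h w| <= e & `|tr2 sin sin h w| <= e].

Lemma qft_bounded f b C (w : R * R) : qitg f ->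
  (forall w : R * R, qnorm (qft f w) <= C * gauss2 b w) ->
  [/\ tr2_bounded (fun z => q1 (f z)) (C * gauss2 b w) w,
      tr2_bounded (fun z => qi (f z)) (C * gauss2 b w) w,
      tr2_bounded (fun z => qj (f z)) (C * gauss2 b w) w &
      tr2_bounded (fun z => qk (f z)) (C * gauss2 b w) w].
Proof.
move=> iF; have [i1 ii ij ik] := iF; case: w => x y H.
have mc := @meas_cosT R; have ms := @meas_sinT R.
have c1 := @cos_norm_le1 R; have s1 := @sin_le1 R.
set e := C * _.
(* The Gaussian is even in each variable, so all four sign choices give the same bound [e]. *)
have := H (x, y); have := H (- x, y); have := H (x, - y); have := H (- x, - y).
rewrite !gauss2N1 !gauss2N2 -/e !qft_components //.
rewrite !tr2_cos1N !tr2_cos2N !tr2_sin1N // !tr2_sin2N //.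
move=> /qnorm_le[/= a1 a2 a3 a4] /qnorm_le[/= b1 b2 b3 b4].
move=> /qnorm_le[/= d1 d2 d3 d4] /qnorm_le[/= e1 e2 e3 e4].
pose T (u v : R -> R) (c : quat R -> R) := tr2 u v (fun z => c (f z)) (x, y).
have [k1 k2 k3 k4] : [/\ `|T cos cos (@q1 R)| <= e, `|T sin cos (@qi R)| <= e,
    `|T cos sin (@qj R)| <= e & `|T sin sin (@qk R)| <= e].
  by apply: (four_signs e1 d1 b1 a1); rewrite /T; ring.
have [l1 l2 l3 l4] : [/\ `|T cos cos (@qi R)| <= e, `|- T sin cos (@q1 R)| <= e,
    `|T cos sin (@qk R)| <= e & `|- T sin sin (@qj R)| <= e].
  by apply: (four_signs e2 d2 b2 a2); rewrite /T; ring.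
have [m1 m2 m3 m4] : [/\ `|T cos cos (@qj R)| <= e, `|T sin cos (@qk R)| <= e,
    `|- T cos sin (@q1 R)| <= e & `|- T sin sin (@qi R)| <= e].
  by apply: (four_signs e3 d3 b3 a3); rewrite /T; ring.
have [n1 n2 n3 n4] : [/\ `|T cos cos (@qk R)| <= e, `|- T sin cos (@qj R)| <= e,
    `|- T cos sin (@qi R)| <= e & `|T sin sin (@q1 R)| <= e].
  by apply: (four_signs e4 d4 b4 a4); rewrite /T; ring.
by rewrite !normrN in l2 l4 m3 m4 n2 n3.
Qed.

End QuaternionTransform.

(** * Reduction of the quadratic-phase transform to the Fourier transform *)

Section QuadraticPhase.
Variable R : realType.
Local Notation mT := (measurableTypeR R).
Implicit Types (a w x y t : R) (p q : quat R) (f g : mT * mT -> quat R).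

(* In the shape [K * qreal _] the real Gaussian can be moved past any quaternion. *)
Lemma hardy_qft a C g : 0 < a -> qdom a g ->
  (forall w : R * R, qnorm (qft g w) <= C * gauss2 (4 * a)^-1 w) ->
  exists K : quat R, {ae leb2 R, forall z, g z = K * qreal (gauss2 a z)}.
Proof.
move=> a0 dg H; have ig := qdom_itg a0 dg.
have [d1 di dj dk] := qdom_comp dg.
have B (w : R * R) := qft_bounded w ig H.
have [K1 h1] : exists K : R, {ae leb2 R, forall z, q1 (g z) = K * gauss2 a z}.
  by apply: (hardy2 (C' := C) a0 d1) => w; have [[]] := B w.
have [Ki hi] : exists K : R, {ae leb2 R, forall z, qi (g z) = K * gauss2 a z}.
  by apply: (hardy2 (C' := C) a0 di) => w; have [_ []] := B w.
have [Kj hj] : exists K : R, {ae leb2 R, forall z, qj (g z) = K * gauss2 a z}.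
  by apply: (hardy2 (C' := C) a0 dj) => w; have [_ _ []] := B w.
have [Kk hk] : exists K : R, {ae leb2 R, forall z, qk (g z) = K * gauss2 a z}.
  by apply: (hardy2 (C' := C) a0 dk) => w; have [_ _ _ []] := B w.
exists (Quat K1 Ki Kj Kk).
apply: filterS (filterI (filterI h1 hi) (filterI hj hk)) => z [[e1 ei] [ej ek]].
rewrite mulqE; move: e1 ei ej ek; case: (g z) => /= ? ? ? ? -> -> -> ->.
by congr Quat => /=; ring.
Qed.

Variables mu1 mu2 : qpf_param R.
Hypotheses (hb1 : qb mu1 != 0) (hb2 : qb mu2 != 0).

Definition phase (mu : qpf_param R) x := qa mu * x ^+ 2 + qd mu * x.

(* The value at [w / b] of the factor of the kernel that does not depend on [x]. *)
Definition kernel_weight (mu : qpf_param R) w : R[i] :=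
  sqrtc (Complex 0 (qb mu / (2 * pi))) *
  cis (- (qc mu * (w / qb mu) ^+ 2 + qe mu * (w / qb mu))).

Definition kernel_norm (mu : qpf_param R) := cabs (sqrtc (Complex 0 (qb mu / (2 * pi)))).

Lemma kernel_normE mu w : cabs (kernel_weight mu w) = kernel_norm mu.
Proof. by rewrite /kernel_weight cabsM cabs_cis mulr1. Qed.

Lemma kernel_norm_gt0 mu : qb mu != 0 -> 0 < kernel_norm mu.
Proof.
move=> b0; rewrite lt_def cabs_ge0 andbT /kernel_norm.
rewrite cabs_eq0 sqrtc_eq0; apply/eqP => -[/eqP].
by rewrite mulf_eq0 (negbTE b0) /= invr_eq0 mulf_eq0 pnatr_eq0 /= gt_eqF // pi_gt0.
Qed.

(** Evaluation at [w / b] turns the cross term b x w into x w; the kernel then splits into a weight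
    in [w], a Fourier kernel and a chirp in [x]. *)
Lemma kernelE mu x w : qb mu != 0 -> qpf_kernel mu x (w / qb mu) =
  kernel_weight mu w * cis (- (w * x)) * cis (- phase mu x).
Proof.
move=> b0; rewrite /qpf_kernel /kernel_weight -!mulrA; congr (_ * _).
by rewrite -!cisD /phase; congr cis; field.
Qed.

Definition chirp f z := in_i (cis (- phase mu1 z.1)) * f z * in_j (cis (- phase mu2 z.2)).
Definition unchirp f z := in_i (cis (phase mu1 z.1)) * f z * in_j (cis (phase mu2 z.2)).

Lemma chirpK f z : unchirp (chirp f) z = f z.
Proof.
rewrite /unchirp /chirp !mulrA -in_iM -mulrA -in_jM cisNK mulr1.
by rewrite -{1}[phase mu1 _]opprK cisNK mul1r.
Qed.

Lemma unchirpK f z : chirp (unchirp f) z = f z.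
Proof.
rewrite /unchirp /chirp !mulrA -in_iM -mulrA -in_jM cisNK mul1r.
by rewrite -{1}[phase mu2 _]opprK cisNK mulr1.
Qed.

Lemma qnorm_chirp f z : qnorm (chirp f z) = qnorm (f z).
Proof. by rewrite !qnormM qnorm_in_i qnorm_in_j !cabs_cis mul1r mulr1. Qed.

Lemma qnorm_unchirp f z : qnorm (unchirp f z) = qnorm (f z).
Proof. by rewrite !qnormM qnorm_in_i qnorm_in_j !cabs_cis mul1r mulr1. Qed.

Lemma meas_phase mu : measurable_fun setT (fun x : mT => phase mu x).
Proof.
rewrite /phase; by apply: measurable_funD; apply: measurable_funM.
Qed.

Lemma qmeasurable_unchirp f : qmeasurable f -> qmeasurable (unchirp f).
Proof.
move=> mf; apply: qmeasurableM; first apply: qmeasurableM => //.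
  by apply: qmeasurable_cis_i; exact: (meas_fst2 (meas_phase mu1)).
by apply: qmeasurable_cis_j; exact: (meas_snd2 (meas_phase mu2)).
Qed.

Lemma qmeasurable_chirp f : qmeasurable f -> qmeasurable (chirp f).
Proof.
move=> mf; apply: qmeasurableM; first apply: qmeasurableM => //.
  apply: qmeasurable_cis_i; apply: measurableT_comp; first exact: oppr_measurable.
  exact: (meas_fst2 (meas_phase mu1)).
apply: qmeasurable_cis_j; apply: measurableT_comp; first exact: oppr_measurable.
exact: (meas_snd2 (meas_phase mu2)).
Qed.

Lemma qdom_chirp a f : qdom a f -> qdom a (chirp f).
Proof.
move=> [mf [C hC]]; split; first exact: qmeasurable_chirp.
by exists C => z; rewrite qnorm_chirp.
Qed.

Lemma qdom_qft a g (w : R * R) : qdom a g -> qdom a (fun z =>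
  in_i (cis (- (w.1 * z.1))) * g z * in_j (cis (- (w.2 * z.2)))).
Proof.
move=> [mg [C hC]]; split; last first.
  by exists C => z; rewrite !qnormM qnorm_in_i qnorm_in_j !cabs_cis mul1r mulr1.
apply: qmeasurableM; first apply: qmeasurableM => //.
  apply: qmeasurable_cis_i; apply: measurableT_comp; first exact: oppr_measurable.
  by apply: (meas_fst2 (F := fun x : mT => w.1 * x)); exact: measurable_funM.
apply: qmeasurable_cis_j; apply: measurableT_comp; first exact: oppr_measurable.
by apply: (meas_snd2 (F := fun x : mT => w.2 * x)); exact: measurable_funM.
Qed.

(** Factors from the plane of i commute with each other on the left of [f], and those from the plane
    of j on its right. The weights can thus be moved to the outer ends and taken out of the integral
    without crossing [f]. *)
Lemma qqpftE a f (w : R * R) : 0 < a -> qdom a f ->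
  qqpft mu1 mu2 f (w.1 / qb mu1, w.2 / qb mu2) =
  in_i (kernel_weight mu1 w.1) * qft (chirp f) w * in_j (kernel_weight mu2 w.2).
Proof.
move=> a0 df; have dg := qdom_qft w (qdom_chirp df); have ig := qdom_itg a0 dg.
rewrite /qft -qintegral_mull // -qintegral_mulr; last first.
  have [mg [C hC]] := dg; apply: (qdom_itg a0); split.
    by apply: qmeasurableM => //; split; exact: measurable_cst.
  exists (qnorm (in_i (kernel_weight mu1 w.1)) * C) => z.
  by rewrite qnormM -[leRHS]mulrA; apply: ler_wpM2l; [exact: qnorm_ge0|exact: hC].
rewrite /qqpft; congr qintegral; apply/funext => z /=.
rewrite !kernelE // /chirp.
move: (kernel_weight mu1 _) (kernel_weight mu2 _) => u v.
rewrite !in_iM !mulrA -!mulrA; do 4 congr (_ * _).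
by rewrite -!in_jM; congr in_j; ring.
Qed.

Lemma qnorm_qqpft a f (w : R * R) : 0 < a -> qdom a f ->
  qnorm (qqpft mu1 mu2 f (w.1 / qb mu1, w.2 / qb mu2)) =
  kernel_norm mu1 * kernel_norm mu2 * qnorm (qft (chirp f) w).
Proof.
move=> a0 df; rewrite (qqpftE _ a0 df) !qnormM qnorm_in_i qnorm_in_j !kernel_normE.
by rewrite mulrAC.
Qed.

Lemma hardy_bounds_qdom a b f : qL 2%:E f -> hardy_bounds mu1 mu2 a b f -> qdom a f.
Proof. by move=> [mf _] [C [_ [_ _ hC _]]]; split => //; exists C. Qed.

Lemma hardy_bounds_qft a b f : 0 < a -> qL 2%:E f -> hardy_bounds mu1 mu2 a b f ->
  exists C, forall w : R * R, qnorm (qft (chirp f) w) <= C * gauss2 b w.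
Proof.
move=> a0 Lf hf; have df := hardy_bounds_qdom Lf hf; case: hf => C [C' [_ _ _ H]].
have k0 : 0 < kernel_norm mu1 * kernel_norm mu2 by rewrite mulr_gt0 ?kernel_norm_gt0.
exists (C' / (kernel_norm mu1 * kernel_norm mu2)) => w.
by rewrite mulrAC ler_pdivlMr // mulrC -(qnorm_qqpft _ a0 df).
Qed.

Lemma hardy_critical a b f : 0 < a -> b = (4 * a)^-1 ->
  qdom a f -> (exists C, forall w : R * R, qnorm (qft (chirp f) w) <= C * gauss2 b w) ->
  exists K : quat R, {ae leb2 R, forall z : mT * mT, chirp f z = K * qreal (gauss2 a z)}.
Proof.
by move=> a0 -> df [C hC]; apply: (hardy_qft a0 (qdom_chirp df) hC).
Qed.

Lemma hardy_eq a b f : 0 < a -> a * b = 4^-1 -> qL 2%:E f ->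
  hardy_bounds mu1 mu2 a b f ->
  exists K : quat R, {ae leb2 R, forall x : mT * mT,
    f x = in_i (cis (qa mu1 * x.1 ^+ 2 + qd mu1 * x.1)) * K
          * qreal (expR (- a * enorm x ^+ 2))
          * in_j (cis (qa mu2 * x.2 ^+ 2 + qd mu2 * x.2))}.
Proof.
move=> a0 ab Lf hf; have bE : b = (4 * a)^-1.
  by rewrite invfM -ab mulrAC divff ?mul1r // gt_eqF.
have [K hK] := hardy_critical a0 bE (hardy_bounds_qdom Lf hf) (hardy_bounds_qft a0 Lf hf).
exists K; apply: filterS hK => z hz.
by rewrite -[LHS]chirpK /unchirp hz [in_i _ * (_ * _)]mulrA.
Qed.

(** A unit square to the right of [B] has measure 1 and cannot lie in a null set. *)
Lemma ae_exists_ge (B : R) (P : mT * mT -> Prop) : {ae leb2 R, forall z, P z} ->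
  exists2 z : mT * mT, B <= z.1 & P z.
Proof.
case=> N [mN N0 sub]; apply: contrapT => H.
have SN : `[B, B + 1]%classic `*` `[0, 1]%classic `<=` N.
  move=> z [/=]; rewrite in_itv /= => /andP[Bz _] _; apply: sub => /= Pz; apply: H.
  by exists z.
have : (leb2 R (`[B, (B + 1)%R]%classic `*` `[0%R, 1%R]%classic : set (mT * mT)) <= leb2 R N)%E.
  apply: le_measure => //; rewrite inE //.
  by apply: measurableX; exact: measurable_itv.
have -> : (leb2 R (`[B, (B + 1)%R]%classic `*` `[0%R, 1%R]%classic : set (mT * mT)) =
    @lebesgue_measure R `[B, (B + 1)%R]%classic * @lebesgue_measure R `[0%R, 1%R]%classic)%E.
  by apply: product_measure1E; exact: measurable_itv.
rewrite N0 !lebesgue_measure_itv /= !lte_fin ltrDl ltr01 -!EFinB -EFinM lee_fin.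
by rewrite addrAC subrr add0r subr0 mulr1 ler10.
Qed.

Lemma hardy_gt a b f : 0 < a -> 0 < b -> 4^-1 < a * b -> qL 2%:E f ->
  hardy_bounds mu1 mu2 a b f -> {ae leb2 R, forall z : mT * mT, f z = 0}.
Proof.
move=> a0 b0 ab Lf hf; set a' := (4 * b)^-1.
have a'0 : 0 < a' by rewrite invr_gt0 mulr_gt0.
have a'a : a' < a by rewrite /a' invfM ltr_pdivrMr.
have bE : b = (4 * a')^-1 by rewrite /a'; field; rewrite gt_eqF.
have [mf [C hC]] := hardy_bounds_qdom Lf hf.
have C0 : 0 <= C.
  have := le_trans (qnorm_ge0 _) (hC (0, 0)).
  by rewrite pmulr_lge0 // expR_gt0.
have df' : qdom a' f.
  split => //; exists C => z; apply: le_trans (hC z) _; rewrite ler_wpM2l //.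
  by rewrite ler_expR ler_wpM2r ?sqr_ge0 // lerN2 ltW.
have [K hK] := hardy_critical a'0 bE df' (hardy_bounds_qft a0 Lf hf).
suff K0 : K = 0.
  apply: filterS hK => z hz.
  by rewrite -[LHS]chirpK /unchirp hz K0 mul0r mulr0 mul0r.
apply: qnorm_eq0; apply/eqP; rewrite eq_le qnorm_ge0 andbT leNgt; apply/negP => k0.
have d0 : 0 < a - a' by rewrite subr_gt0.
(* At a point where [f] has the Gaussian form, the bound gives |K| e^((a - a') |z|^2) <= C. The
   choice of [B] makes |z|^2 exceed C / (|K| (a - a')), contradicting e^t >= 1 + t; the summand 1
   ensures [z.1 >= 1], so that [z.1 <= z.1 ^+ 2 <= |z|^2]. *)
have [z Bz e] := ae_exists_ge (C / (qnorm K * (a - a')) + 1) hK.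
have := hC z; rewrite -(qnorm_chirp f z) e qnormM qnorm_real.
rewrite ger0_norm ?expR_ge0 // -ler_pdivlMr ?expR_gt0 // -mulrA -expRN -expRD.
rewrite (_ : _ + _ = - (a - a') * enorm z ^+ 2); last by ring.
rewrite mulNr expRN ler_pdivlMr ?expR_gt0 // leNgt => /negP; apply.
apply: lt_le_trans (_ : qnorm K * (1 + (a - a') * enorm z ^+ 2) <= _); last first.
  by rewrite ler_wpM2l ?qnorm_ge0 // expR_ge1Dx.
have n2 : enorm z ^+ 2 = z.1 ^+ 2 + z.2 ^+ 2.
  by rewrite /enorm sqr_sqrtr // addr_ge0 // sqr_ge0.
have c0 : 0 <= C / (qnorm K * (a - a')) by rewrite divr_ge0 // mulr_ge0 ?qnorm_ge0 // ltW.
have z1 : z.1 <= enorm z ^+ 2.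
  rewrite n2; apply: le_trans (_ : z.1 ^+ 2 <= _); last by rewrite lerDl sqr_ge0.
  by rewrite expr2 ler_peMl //; nra.
have : C < qnorm K * (a - a') * enorm z ^+ 2.
  rewrite mulrC -ltr_pdivrMr ?mulr_gt0 //; apply: lt_le_trans z1.
  by apply: lt_le_trans Bz; rewrite ltrDl.
move=> /lt_le_trans; apply; rewrite -mulrA ler_wpM2l ?qnorm_ge0 //.
by rewrite lerDr.
Qed.

End QuadraticPhase.

(** * Witnesses in the subcritical case *)

Section InfinitelyMany.
Variable R : realType.
Local Notation mT := (measurableTypeR R).
Variables (mu1 mu2 : qpf_param R) (a : R).
Hypotheses (hb1 : qb mu1 != 0) (hb2 : qb mu2 != 0) (a0 : 0 < a).
Implicit Types (f g : mT * mT -> quat R).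

Lemma qL2_gauss f c : 0 <= c -> qmeasurable f ->
  (forall z, qnorm (f z) = c * gauss2 a z) -> qL 2%:E f.
Proof.
move=> c0 mf e; split => //.
have -> : (fun x => qnorm (f x)) = (fun z => c * gauss2 a z) by apply/funext.
have m : measurable_fun setT (fun z : mT * mT => c * gauss2 a z).
  by apply: measurable_funM => //; exact: meas_gauss2.
apply/andP; split; first by rewrite inE.
rewrite inE /= /finite_norm unlock; apply: poweR_lty.
(* The square of a Gaussian of parameter [a] is one of parameter [2 * a]. *)
have i : itg (leb2 R) (fun z : mT * mT => c ^+ 2 * gauss2 (2 * a) z).
  by apply: itgZ; apply: itg_gauss2; rewrite mulr_gt0.
have /integrableP[_] := i; congr (_ < _)%E; apply: eq_integral => z _ /=.
have g0 : 0 <= c * gauss2 a z by rewrite mulr_ge0 // expR_ge0.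
rewrite !ger0_norm //; last by rewrite mulr_ge0 ?sqr_ge0 // expR_ge0.
rewrite powR_mulrn // exprMn /gauss2 -expRM_natl.
by congr (_ * expR _)%:E; ring.
Qed.

Definition witness (n : nat) : mT * mT -> quat R :=
  unchirp mu1 mu2 (fun z => qreal (n%:R * gauss2 a z)).

Lemma qmeasurable_gauss (c : R) : qmeasurable (fun z : mT * mT => qreal (c * gauss2 a z)).
Proof.
split; try exact: measurable_cst.
by apply: measurable_funM => //; exact: meas_gauss2.
Qed.

Lemma qnorm_witness n z : qnorm (witness n z) = n%:R * gauss2 a z.
Proof.
by rewrite qnorm_unchirp qnorm_real ger0_norm // mulr_ge0 // expR_ge0.
Qed.

Lemma qmeasurable_witness n : qmeasurable (witness n).
Proof. by apply: qmeasurable_unchirp; exact: qmeasurable_gauss. Qed.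

Lemma qdom_witness n : qdom a (witness n).
Proof.
split; first exact: qmeasurable_witness.
by exists n%:R => z; rewrite qnorm_witness.
Qed.

Lemma tr2_0 (u v : R -> R) (w : R * R) : tr2 u v (fun=> 0) w = 0.
Proof.
rewrite /tr2 /Rintegral (_ : (fun z => _) = cst 0%E) ?integral0 //.
by apply/funext => z /=; rewrite !mul0r.
Qed.

Lemma tr2Z (u v : R -> R) (c : R) (w : R * R) :
  measurable_fun setT u -> measurable_fun setT v ->
  (forall x, `|u x| <= 1) -> (forall x, `|v x| <= 1) ->
  tr2 u v (fun z => c * gauss2 a z) w = c * tr2 u v (gauss2 a) w.
Proof.
move=> mu mv u1 v1; rewrite /tr2 -RintegralZl //; last first.
  exact: (itg_tr2 _ (itg_gauss2 a0)).
by apply: eq_Rintegral => z _; rewrite !mulrA.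
Qed.

(** The Gaussian is even in both variables, so only the cosine-cosine transform survives. *)
Lemma qft_gauss (c : R) (w : R * R) :
  qft (fun z => qreal (c * gauss2 a z)) w =
  qreal (c * (gint a ^+ 2 * gauss2 (4 * a)^-1 w)).
Proof.
have d : qdom a (fun z => qreal (c * gauss2 a z)).
  split; first exact: qmeasurable_gauss.
  by exists `|c| => z; rewrite qnorm_real normrM (ger0_norm (expR_ge0 _)).
have mc := @meas_cosT R; have ms := @meas_sinT R.
have c1 := @cos_norm_le1 R; have s1 := @sin_le1 R.
rewrite (qft_components _ (qdom_itg a0 d)) /= !tr2_0 !tr2Z //.
rewrite tr2_gauss_cc // !tr2_gauss_sr // !tr2_gauss_sl //.
by rewrite !mulr0 !subr0 !addr0.
Qed.

Lemma hardy_bounds_witness b n : a * b < 4^-1 ->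
  hardy_bounds mu1 mu2 a b (witness n).
Proof.
move=> ab; pose k := kernel_norm mu1 * kernel_norm mu2 * (n%:R * gint a ^+ 2).
have k0 : 0 <= k.
  apply: mulr_ge0; last by apply: mulr_ge0 => //; exact: sqr_ge0.
  by rewrite ltW // mulr_gt0 ?kernel_norm_gt0.
(* For [n = 0] both natural constants vanish, whereas positive ones are required. *)
exists (n%:R + 1), (k + 1); split.
- by rewrite ltr_wpDl.
- by rewrite ltr_wpDl.
- by move=> z; rewrite qnorm_witness ler_wpM2r ?expR_ge0 // lerDl.
move=> w; rewrite (qnorm_qqpft hb1 hb2 w a0 (qdom_witness n)).
rewrite (_ : chirp _ _ _ = fun z => qreal (n%:R * gauss2 a z)); last first.
  by apply/funext => z; rewrite unchirpK.
rewrite qft_gauss qnorm_real ger0_norm; last first.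
  by rewrite mulr_ge0 // mulr_ge0 ?sqr_ge0 //; exact: expR_ge0.
apply: le_trans (_ : k * gauss2 (4 * a)^-1 w <= _).
  by rewrite /k le_eqVlt; apply/orP; left; apply/eqP; ring.
apply: ler_pM => //; rewrite ?expR_ge0 ?lerDl //.
rewrite ler_expR ler_wpM2r ?sqr_ge0 // lerN2 invfM.
by rewrite ler_pdivlMr // mulrC ltW.
Qed.

(** One common point is enough: the norms there are [m] and [n] times the same positive number. *)
Lemma witness_inj m n : {ae leb2 R, forall z : mT * mT, witness m z = witness n z} -> m = n.
Proof.
move=> /(ae_exists_ge 0)[z _ /(congr1 (@qnorm R))]; rewrite !qnorm_witness.
move=> /(mulIf (lt0r_neq0 (expR_gt0 _))) /eqP; rewrite eqr_nat => /eqP.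
by [].
Qed.

Lemma infinite_hardy b : a * b < 4^-1 ->
  infinite_set [set ae_class f | f in
    [set f : R * R -> quat R | qL 2%:E f /\ hardy_bounds mu1 mu2 a b f]].
Proof.
move=> ab fin; apply: infinite_nat.
apply: sub_finite_set (finite_preimage (f := fun n => ae_class (witness n)) _ fin).
  move=> n _ /=; exists (witness n) => //; split; last exact: hardy_bounds_witness.
  apply: (qL2_gauss (c := n%:R)) => //; first exact: qmeasurable_witness.
  exact: qnorm_witness.
move=> m n _ _ e; apply: witness_inj.
have : ae_class (witness m) (witness m) by apply: aeW.
by rewrite e.
Qed.

End InfinitelyMany.

Theorem theorem4p4 (R : realType) (mu1 mu2 : qpf_param R)
    (hb1 : qb mu1 != 0) (hb2 : qb mu2 != 0)
    (alpha beta : R) (halpha : 0 < alpha) (hbeta : 0 < beta) :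
  [/\ 4^-1 < alpha * beta ->
        forall f : R * R -> quat R,
          qL 2%:E f -> hardy_bounds mu1 mu2 alpha beta f ->
          {ae leb2 R, forall x, f x = 0},
      alpha * beta = 4^-1 ->
        forall f : R * R -> quat R,
          qL 2%:E f -> hardy_bounds mu1 mu2 alpha beta f ->
          exists K : quat R, {ae leb2 R, forall x : R * R,
            f x = in_i (cis (qa mu1 * x.1 ^+ 2 + qd mu1 * x.1)) * K
                  * qreal (expR (- alpha * enorm x ^+ 2))
                  * in_j (cis (qa mu2 * x.2 ^+ 2 + qd mu2 * x.2))}
    & alpha * beta < 4^-1 ->
        infinite_set [set ae_class f | f in
          [set f : R * R -> quat R |
            qL 2%:E f /\ hardy_bounds mu1 mu2 alpha beta f]]].
Proof.
split => [ab f Lf hf|ab f Lf hf|].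
- exact: (hardy_gt hb1 hb2 halpha hbeta ab Lf hf).
- exact: (hardy_eq hb1 hb2 halpha ab Lf hf).
- exact: infinite_hardy.
Qed.
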